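(* Let $n\ge 1$ be an integer and let $c:T_n\to\mathbb{Z}$ be a configuration of size $n$. Then $c$ is a permutation triangle of size $n$ if and only if all of the following hold: (1) every entry of $c$ is either $0$ or $1$; (2) the sum of all entries of $c$ is $\left\lfloor\frac{n+1}{2}\right\rfloor$; (3) for every $1\le i\le n$, the top $i$ rows of $c$ contain at most $i$ entries equal to $1$; (4) for every $1\le i\le n$, the left-most $i$ columns of $c$ contain at most $i$ entries equal to $1$; (5) for every $1\le i\le n$, the right-most $i$ columns of $c$ contain at most $i$ entries equal to $1$; (6) for every $1\le i\le n$, every upward triangle of size $i$ of entries of $c$ contains at most $i$ entries equal to $1$.
   Context: Let $n\ge 1$. Groves: let $V_n=\{(i,j)\in\mathbb{Z}^2 : |i|+|j|\le n,\ j\le 0,\ i+j\equiv n \bmod 2\}$, viewed as a triangular-lattice triangle: two points of $V_n$ are adjacent if they differ by $\pm(2,0)$, $\pm(1,1)$ or $\pm(1,-1)$. The boundary vertices are those $(i,j)\in V_n$ with $j=0$ or $|i|+|j|=n$. A simplified grove of size $n$ is a graph $G$ with vertex set $V_n$ whose edges all join adjacent points, such that $G$ is acyclic and the following connectivity condition holds: every connected component of $G$ contains exactly one of the following sets (which partition the boundary vertices), and each of these sets is contained in some component (so distinct sets lie in distinct components): - the singletons $\{(-n,0)\}$, $\{(n,0)\}$, $\{(0,-n)\}$; - west pairs $\{(-i,0),(\frac{-n-i}{2},\frac{-n+i}{2})\}$ for $0<i<n$, $i\equiv n\bmod 2$; - east pairs $\{(i,0),(\frac{n+i}{2},\frac{-n+i}{2})\}$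 for $0<i<n$, $i\equiv n\bmod 2$; - south pairs $\{(-n+i,-i),(n-i,-i)\}$ for integers $\frac n2<i<n$; - if $n$ is even, the middle triplet $\{(0,0),(-\frac n2,-\frac n2),(\frac n2,-\frac n2)\}$. Alternating sign triangles: a downward triangle is a triple $(a,b),(a-1,b+1),(a+1,b+1)$ of points of $V_n$. Let $T_n=\{(r,s)\in\mathbb{Z}^2 : r\ge 1,\ s\ge 1,\ r+s\le n+1\}$. The downward triangles are indexed by $T_n$: $(r,s)$ corresponds to the downward triangle with bottom vertex $(-n+r+2s-2,\,-r)$, i.e. the $s$-th from the left in the $r$-th row from the top. A configuration of size $n$ is a function $c:T_n\to\mathbb{Z}$; its values are its entries. Given a simplified grove $G$ of size $n$, assign to each downward triangle the number $1-e$, where $e$ is the number of edges of $G$ joining two vertices of that triangle. An alternating sign triangle of size $n$ is a configuration arising in this way from some simplified grove of size $n$ (its entries are in $\{-1,0,1\}$). A permutation triangle is an alternating sign triangle all of whose entries are $0$ or $1$. Sub-arrays: the $r$-th row from the top consists of the entries at positions $(r,s)\in T_n$ with that $r$. The $k$-th column from the left consists of the positions $(r,s)\in T_n$ with $s=k$ (a line parallel to the left side of the triangle), and the $k$-th column from the right consists of the positions with $n+2-r-s=k$ (a line parallel to the right side). An upward triangle of size $i$ of entries is a set of positions $\{(r+p,\,s-q): 0\le q\le p\le i-1\}$ entirely contained in $T_n$ (so it has $i$ rows, with $1,2,\dots,i$ entries from top to bottom). *)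

(* Defs.v *)
From mathcomp Require Import all_boot all_order all_algebra.

Set Implicit Arguments.
Unset Strict Implicit.
Unset Printing Implicit Defensive.

Import Order.TTheory GRing.Theory Num.Theory.
Local Open Scope ring_scope.

Definition point : Type := int * int.

Definition grove_vertex (n : nat) : pred point :=
  [pred v | [&& `|v.1| + `|v.2| <= n%:Z, v.2 <= 0 &
                (v.1 + v.2 == n%:Z %[mod 2])%Z]].

Definition adjacent (u v : point) : bool :=
  v - u \in ([:: (2, 0); (-2, 0); (1, 1); (-1, -1); (1, -1); (-1, 1)]
              : seq point).

(* The prescribed sets of boundary vertices, each listed without repetition.
   They are pairwise disjoint, so no set is listed in two different ways.
   All the divisions by 2 are exact. *)
Inductive boundary_block (n : nat) : seq point -> Prop :=
  | WestCorner : boundary_block n [:: (- n%:Z, 0)]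
  | EastCorner : boundary_block n [:: (n%:Z, 0)]
  | SouthCorner : boundary_block n [:: (0, - n%:Z)]
  | WestPair (i : int) of 0 < i < n%:Z & (i = n%:Z %[mod 2])%Z :
      boundary_block n
        [:: (- i, 0); (((- n%:Z - i) %/ 2)%Z, ((- n%:Z + i) %/ 2)%Z)]
  | EastPair (i : int) of 0 < i < n%:Z & (i = n%:Z %[mod 2])%Z :
      boundary_block n
        [:: (i, 0); (((n%:Z + i) %/ 2)%Z, ((- n%:Z + i) %/ 2)%Z)]
  | SouthPair (i : int) of n%:Z < 2 * i & i < n%:Z :
      boundary_block n [:: (- n%:Z + i, - i); (n%:Z - i, - i)]
  | MiddleTriplet of ~~ odd n :
      boundary_block n
        [:: (0, 0); (- (n%:Z %/ 2)%Z, - (n%:Z %/ 2)%Z);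
            ((n%:Z %/ 2)%Z, - (n%:Z %/ 2)%Z)].

Definition same_component (G : rel point) (u v : point) : Prop :=
  exists2 p : seq point, path G u p & v = last u p.

Definition block_in_component (G : rel point) (B : seq point) (v : point) :
    Prop :=
  forall b : point, b \in B -> same_component G v b.

(* A graph on the vertices of size n is given by its edge relation, which is
   false off these vertices; adjacency already excludes loops.  In a simple
   graph, the cycles are the repetition-free closed walks with at least three
   vertices: [ucycle] also holds of the empty sequence and of the two ends of
   an edge. *)
Record simplified_grove (n : nat) (G : rel point) : Prop := SimplifiedGrove {
  grove_sym : symmetric G;
  grove_edge : forall u v : point, G u v ->
    [&& u \in grove_vertex n, v \in grove_vertex n & adjacent u v];
  grove_acyclic : forall p : seq point, ucycle G p -> (size p < 3)%N;
  grove_component : forall v : point, v \in grove_vertex n ->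
    exists! B : seq point, boundary_block n B /\ block_in_component G B v;
  grove_block : forall B : seq point, boundary_block n B ->
    exists2 v : point, v \in grove_vertex n & block_in_component G B v
}.

Definition in_tri (n : nat) (t : nat * nat) : bool :=
  [&& 0 < t.1, 0 < t.2 & t.1 + t.2 <= n.+1]%N.

(* The bound n.+1 on the coordinates only serves finiteness: in_tri implies
   that both are at most n. *)
Definition tri (n : nat) : Type :=
  {t : 'I_n.+1 * 'I_n.+1 | in_tri n (val t.1, val t.2)}.

Definition tri_row (n : nat) (t : tri n) : nat := (val t).1.
Definition tri_lcol (n : nat) (t : tri n) : nat := (val t).2.
Definition tri_rcol (n : nat) (t : tri n) : nat :=
  (n.+2 - tri_row t - tri_lcol t)%N.

Definition configuration (n : nat) : Type := tri n -> int.

Definition bottom_vertex (n : nat) (t : tri n) : point :=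
  (- n%:Z + (tri_row t)%:Z + 2 * (tri_lcol t)%:Z - 2, - (tri_row t)%:Z).

Definition triangle_edges (n : nat) (G : rel point) (t : tri n) : nat :=
  let a := bottom_vertex t in
  let b := (a.1 - 1, a.2 + 1) in
  let c := (a.1 + 1, a.2 + 1) in
  (G a b + G a c + G b c)%N.

Definition alternating_sign_triangle (n : nat) (c : configuration n) : Prop :=
  exists2 G : rel point, simplified_grove n G &
    forall t : tri n, c t = 1 - (triangle_edges G t)%:Z.

Definition zero_one (n : nat) (c : configuration n) : Prop :=
  forall t : tri n, c t = 0 \/ c t = 1.

Definition permutation_triangle (n : nat) (c : configuration n) : Prop :=
  alternating_sign_triangle c /\ zero_one c.

Definition ones_in (n : nat) (c : configuration n) (A : pred (tri n)) : nat :=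
  #|[set t : tri n | A t && (c t == 1)]|.

(* When the truncated subtraction s - q differs from the integer one it gives
   0, which is not the second coordinate of a position. *)
Definition upward_triangle (r s i : nat) : seq (nat * nat) :=
  [seq ((r + p)%N, (s - q)%N) | p <- iota 0 i, q <- iota 0 p.+1].

(* Main.v *)
From Stdlib Require Import Relations Classical.
Require Import Defs.
From mathcomp Require Import all_boot all_order all_algebra zify.

Set Implicit Arguments.
Unset Strict Implicit.
Unset Printing Implicit Defensive.

(* Label the downward triangles without a one by the direction of their single
   edge.  Necessity is a count of edges: if every vertex of a set I is joined to
   a vertex outside I, then at least |I| edges have an end in I.  Sufficiency
   goes by induction from n - 2 to n.  Three strips issued from a one d, each
   made of one triangle in every further line parallel to a side, are filled
   with edges parallel to that side; deleting d and the strips glues the three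
   remaining regions into a triangle of size n - 2, and the conditions survive
   if the strips do not split the saturated sets avoiding d.  Such strips exist,
   by uncrossing saturated sets, once d lies in every saturated set of left-most
   columns and no two saturated sets of lines parallel to the other two sides
   stop the strip between them.  If saturated sets of lines of two sides share a
   one, their ones may first be slid to the last of these lines: the grove above
   that line can always be rebuilt from the labels that reach it from below.
   Otherwise saturated sets of lines of different sides are disjoint, and one of
   two sides provides a suitable d. *)

(** * Counting edges and components *)

(** Only connectivity has to be arranged. There are n + 1 more vertices than downward triangles, and
    n + 1 + floor((n + 1) / 2) boundary blocks. With floor((n + 1) / 2) ones, the edges are thus
    exactly as many as in a forest with one component per block: once every vertex reaches a block
    and every block is connected, acyclicity and separation are automatic, and edges can be glued
    without watching for cycles.

    The bound on a triangle is affine in its three sides, so two saturated triangles can be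
    exchanged for their hull and their intersection. The pairs that resist are sets of lines
    parallel to two different sides, whose union is neither a triangle nor a set of lines; this is
    the obstacle to a strip. If [d] lies in every saturated set of left-most columns, two of the
    three strips meet no such pair. The third is allowed to enter a saturated set beyond a one of
    its outermost line: that one keeps its line while the number of lines drops, so it leaves the
    set and makes up for the absence of [d]. *)

Definition edge_conn (T : eqType) (E : seq (T * T)) : T -> T -> Prop :=
  clos_refl_sym_trans T (fun u v => (u, v) \in E).

Lemma conn_mono (T : Type) (R R' : T -> T -> Prop) (u v : T) :
  (forall x y, R x y -> clos_refl_sym_trans T R' x y) ->
  clos_refl_sym_trans T R u v -> clos_refl_sym_trans T R' u v.
Proof.
move=> sRR'; elim=> {u v} [x y /sRR' //|x|x y _ IH|x y z _ IHxy _ IHyz].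
- exact: rst_refl.
- exact: rst_sym.
- exact: rst_trans IHxy IHyz.
Qed.

Lemma conn_invariant (T U : Type) (R : T -> T -> Prop) (f : T -> U) (u v : T) :
  (forall x y, R x y -> f x = f y) -> clos_refl_sym_trans T R u v -> f u = f v.
Proof. by move=> fR; elim=> {u v} // [x y z _ -> _ ->]. Qed.

(* Both graph counts below come from contracting the edges one at a time:
   each contraction identifies at most two representatives. *)
Lemma contraction (T : eqType) (V : seq T) (E : seq (T * T)) :
  uniq V ->
  exists f : T -> T,
    [/\ forall u, edge_conn E u (f u),
        forall u v, (u, v) \in E -> f u = f v &
        size V <= size (undup (map f V)) + size E].
Proof.
move=> uV; elim: E => [|[x y] E [f [cf fE szf]]].
  by exists id; split=> //; [move=> u; exact: rst_refl | rewrite map_id undup_id ?addn0].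
pose g u := if f u == f x then f y else f u.
have sub u v : edge_conn E u v -> edge_conn ((x, y) :: E) u v.
  by apply: conn_mono => a b abE; apply: rst_step; rewrite inE abE orbT.
exists g; split.
- move=> u; rewrite /g; case: eqP => [fux|_]; last exact/sub/cf.
  apply: (rst_trans _ _ _ (f x)); first by rewrite -fux; exact/sub/cf.
  apply: (rst_trans _ _ _ x); first exact/rst_sym/sub/cf.
  apply: (rst_trans _ _ _ y); last exact/sub/cf.
  by apply: rst_step; rewrite inE eqxx.
- move=> u v; rewrite inE => /orP[/eqP[-> ->]|/fE fuv]; rewrite /g ?fuv //.
  by rewrite eqxx; case: eqP.
- have: size (undup (map f V)) <= size (f x :: undup (map g V)).
    apply: uniq_leq_size; first exact: undup_uniq.
    move=> w; rewrite mem_undup => /mapP[u uV' ->]; rewrite inE mem_undup.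
    case: eqP => //= nfux; apply/mapP; exists u => //.
    by rewrite /g; case: eqP.
  by move=> /= leq; lia.
Qed.

Lemma conn_count (T : eqType) (V R : seq T) (E : seq (T * T)) :
  uniq V -> (forall v, v \in V -> exists2 r, r \in R & edge_conn E v r) ->
  size V <= size R + size E.
Proof.
move=> uV VR; have [f [cf fE szV]] := contraction E uV.
have: size (undup (map f V)) <= size (map f R).
  apply: uniq_leq_size; first exact: undup_uniq.
  move=> w; rewrite mem_undup => /mapP[v /VR[r rR cvr] ->].
  by rewrite (conn_invariant fE cvr) map_f.
by rewrite size_map; lia.
Qed.

(** Acyclicity in the inductive form that the count consumes: each edge joins two different
    components of the edges after it. *)
Fixpoint forest (T : eqType) (E : seq (T * T)) : Prop :=
  if E is e :: E' then ~ edge_conn E' e.1 e.2 /\ forest E' else True.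

(** Each contraction now merges two different representatives, since the ends of an edge are not
    connected by the later ones; every edge therefore costs a component. *)
Lemma forest_count (T : eqType) (V K : seq T) (E : seq (T * T)) :
  uniq V -> uniq K -> {subset K <= V} ->
  (forall e, e \in E -> e.1 \in V /\ e.2 \in V) -> forest E ->
  (forall u v, u \in K -> v \in K -> edge_conn E u v -> u = v) ->
  size K + size E <= size V.
Proof.
move=> uV uK KV EV fE Kinj.
suff [f [cf szf]] : exists f : T -> T, (forall u, edge_conn E u (f u)) /\
    size (undup (map f V)) + size E <= size V.
  have: size (map f K) <= size (undup (map f V)).
    apply: uniq_leq_size.
      rewrite map_inj_in_uniq // => u v uKin vKin fuv; apply: Kinj => //.
      by apply: (rst_trans _ _ _ (f u)); [exact: cf | rewrite fuv; exact/rst_sym/cf].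
    by move=> w /mapP[k kK ->]; rewrite mem_undup map_f // KV.
  by rewrite size_map; lia.
suff [f [cf _ szf]] : exists f : T -> T, [/\ forall u, edge_conn E u (f u),
    forall u v, (u, v) \in E -> f u = f v &
    size (undup (map f V)) + size E <= size V] by exists f.
elim: E EV fE {Kinj} => [|[x y] E IH] EV.
  move=> _; exists id; split=> //; first by move=> u; exact: rst_refl.
  by rewrite map_id undup_id ?addn0.
case=> /= nxy /IH[|f [cf fE szf]].
  by move=> e eE; apply: EV; rewrite inE eE orbT.
pose g u := if f u == f x then f y else f u.
have sub u v : edge_conn E u v -> edge_conn ((x, y) :: E) u v.
  by apply: conn_mono => a b abE; apply: rst_step; rewrite inE abE orbT.
have [xV yV] : x \in V /\ y \in V by apply: (EV (x, y)); rewrite inE eqxx.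
have nf : f y <> f x.
  move=> fyx; apply: nxy; apply: (rst_trans _ _ _ (f x)); first exact: cf.
  by rewrite -fyx; apply: rst_sym; exact: cf.
exists g; split.
- move=> u; rewrite /g; case: eqP => [fux|_]; last exact/sub/cf.
  apply: (rst_trans _ _ _ (f x)); first by rewrite -fux; exact/sub/cf.
  apply: (rst_trans _ _ _ x); first exact/rst_sym/sub/cf.
  apply: (rst_trans _ _ _ y); last exact/sub/cf.
  by apply: rst_step; rewrite inE eqxx.
- move=> u v; rewrite inE => /orP[/eqP[-> ->]|/fE fuv]; rewrite /g ?fuv //.
  by rewrite eqxx; case: eqP.
- have: size (f x :: undup (map g V)) <= size (undup (map f V)).
    apply: uniq_leq_size => /=.
      rewrite undup_uniq andbT mem_undup; apply/negP => /mapP[u _]; rewrite /g.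
      by case: eqP => [_ /esym|? /esym].
    move=> w; rewrite inE => /orP[/eqP->|]; first by rewrite mem_undup map_f.
    rewrite mem_undup => /mapP[u uV' ->]; rewrite mem_undup /g.
    by case: ifP => _; apply: map_f.
  by move=> /= leq; lia.
Qed.

(** * Saturated sets and strips *)

(** Submodularity in counting form: an inequality between indicators is summed over [S]. The variant
    below is strict as soon as one element [d] is. *)
Lemma count2_le (T : eqType) (S : seq T) (a b c e : pred T) :
  {in S, forall x, a x + b x <= c x + e x} ->
  count a S + count b S <= count c S + count e S.
Proof.
elim: S => //= x S IH H.
have := IH (fun y yS => H y (@mem_behead _ (x :: S) y yS)).
have := H x (mem_head x S); lia.
Qed.

Lemma count2_lt (T : eqType) (S : seq T) (a b c e : pred T) (d : T) :
  d \in S -> a d + b d < c d + e d ->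
  {in S, forall x, a x + b x <= c x + e x} ->
  count a S + count b S < count c S + count e S.
Proof.
elim: S => //= x S IH; rewrite inE => /orP[/eqP<-|dS] lt_d H.
  have := @count2_le _ S a b c e (fun y yS => H y (@mem_behead _ (d :: S) y yS)).
  lia.
have := IH dS lt_d (fun y yS => H y (@mem_behead _ (x :: S) y yS)).
have := H x (mem_head x S); lia.
Qed.

Lemma count_le_in (T : eqType) (S : seq T) (P Q : pred T) :
  {in S, forall x, P x -> Q x} -> count P S <= count Q S.
Proof.
elim: S => //= x S IH H; apply: leq_add.
  by have := H x (mem_head x S); case: (P x) => // ->.
by apply: IH => y yS; apply: H; rewrite inE yS orbT.
Qed.

Lemma count_remD (T : eqType) (S : seq T) (P : pred T) (d : T) :
  d \in S -> count P S = P d + count P (rem d S).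
Proof. by move=> dS; rewrite (permP (perm_to_rem dS)). Qed.

Section Tri.
Variables (T : eqType) (S : seq T).

Definition cpre (p : T -> nat) m := count (fun x => p x < m) S.

(** For coordinates of sum n - 1 this box is an upward triangle of size X + Y + Z - n - 1, possibly
    cut off by the sides. *)
Definition ctri (p1 p2 p3 : T -> nat) X Y Z :=
  count (fun x => [&& p1 x < X, p2 x < Y & p3 x < Z]) S.

Lemma ctriC (p1 p2 p3 : T -> nat) X Y Z :
  ctri p1 p2 p3 X Y Z = ctri p1 p3 p2 X Z Y.
Proof. by apply: eq_count => x /=; rewrite [(_ < Y) && _]andbC. Qed.

Lemma ctriR (p1 p2 p3 : T -> nat) X Y Z :
  ctri p1 p2 p3 X Y Z = ctri p2 p3 p1 Y Z X.
Proof. by apply: eq_count => x /=; case: (_ < X) => //=; rewrite ?andbT // !andbF. Qed.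

Lemma cpre_edge (p : T -> nat) m :
  cpre p m <= m -> m < cpre p m.+1 -> exists2 w, w \in S & p w = m.
Proof.
move=> le1 lt2; have [/hasP[w wS /eqP]|/hasPn no] := boolP (has (fun x => p x == m) S).
  by exists w.
suff: cpre p m.+1 = cpre p m by lia.
by apply: eq_in_count => x xS /=; have := no x xS; lia.
Qed.

(** The coordinates are parameters so that one construction of strips serves all three directions.
    The triangle bound covers truncated boxes too, which makes it available for hulls and
    intersections. *)
Record convex_bounds (p1 p2 p3 : T -> nat) (n : nat) : Prop := ConvexBounds {
  cb_sum : forall x, x \in S -> p1 x + p2 x + p3 x + 1 = n;
  cb_pre1 : forall m, cpre p1 m <= m;
  cb_pre2 : forall m, cpre p2 m <= m;
  cb_pre3 : forall m, cpre p3 m <= m;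
  cb_tri : forall X Y Z, n + 1 <= X + Y + Z ->
    ctri p1 p2 p3 X Y Z + n + 1 <= X + Y + Z
}.

Lemma convex_boundsC (p1 p2 p3 : T -> nat) n :
  convex_bounds p1 p2 p3 n -> convex_bounds p1 p3 p2 n.
Proof.
case=> h h1 h2 h3 ht; split=> //; first by move=> x /h; lia.
by move=> X Y Z le; rewrite ctriC; have := ht X Z Y; lia.
Qed.

Lemma convex_boundsR (p1 p2 p3 : T -> nat) n :
  convex_bounds p1 p2 p3 n -> convex_bounds p2 p3 p1 n.
Proof.
case=> h h1 h2 h3 ht; split=> //; first by move=> x /h; lia.
by move=> X Y Z le; rewrite -ctriR; have := ht Z X Y; lia.
Qed.

(** Each one is by itself a saturated triangle of size one. This forbids repetitions in [S] and
    later keeps the strips off the other ones. *)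
Lemma cb_cell (p1 p2 p3 : T -> nat) n x :
  convex_bounds p1 p2 p3 n -> x \in S ->
  ctri p1 p2 p3 (p1 x).+1 (p2 x).+1 (p3 x).+1 = 1.
Proof.
move=> cb xS; have := cb_sum cb xS.
have := @cb_tri _ _ _ _ cb (p1 x).+1 (p2 x).+1 (p3 x).+1.
have : 0 < ctri p1 p2 p3 (p1 x).+1 (p2 x).+1 (p3 x).+1.
  by rewrite -has_count; apply/hasP; exists x; rewrite ?ltnSn.
lia.
Qed.

Lemma cb_uniq (p1 p2 p3 : T -> nat) n : convex_bounds p1 p2 p3 n -> uniq S.
Proof.
move=> cb; apply: count_mem_uniq => x; have [xS|/count_memPn //] := boolP (x \in S).
have le1 : count_mem x S <= 1.
  rewrite -(cb_cell cb xS); apply: count_le_in => y _ /eqP ->.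
  by rewrite !ltnSn.
have : 0 < count_mem x S by rewrite -has_count has_pred1.
by rewrite /=; lia.
Qed.

(* A cell the strip starting at [d] may visit: it lies in no saturated
   triangle avoiding [d]; it lies in a saturated set of columns avoiding [d]
   only on the side of the triangle or, when [wit] holds, only beyond some one
   on the outermost of these columns. *)
Record admissible (wit : bool) (p1 p2 p3 : T -> nat) n d (a b c : nat) : Prop :=
  Admissible {
  adm_tri : forall X Y Z, ctri p1 p2 p3 X Y Z + n + 1 = X + Y + Z ->
    ~~ [&& p1 d < X, p2 d < Y & p3 d < Z] -> ~~ [&& a < X, b < Y & c < Z];
  adm_2 : forall Y, cpre p2 Y = Y -> Y <= p2 d -> b < Y ->
    c = 0 \/ wit /\ exists2 w, w \in S & p2 w + 1 = Y /\ c < p3 w;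
  adm_3 : forall Z, cpre p3 Z = Z -> Z <= p3 d -> c < Z ->
    b = 0 \/ wit /\ exists2 w, w \in S & p3 w + 1 = Z /\ b < p2 w
}.

Lemma admissibleC wit (p1 p2 p3 : T -> nat) n d a b c :
  admissible wit p1 p2 p3 n d a b c -> admissible wit p1 p3 p2 n d a c b.
Proof.
case=> ht h2 h3; split=> // X Y Z; rewrite ctriC => tight avoid.
have := ht X Z Y; rewrite ![(_ < Z) && _]andbC; apply=> //; lia.
Qed.

(** The obstacles to stepping from (a, b, c) to (a + 1, b - 1, c): the step enters a saturated
    triangle ending at b, or saturated first b lines for [p2], or leaves the big triangle. When b <=
    p2 d these sets avoid [d]. *)
Definition blocked (wit : bool) (p1 p2 p3 : T -> nat) (n a b c : nat) :=
  (exists X Z, [/\ ctri p1 p2 p3 X b Z + n + 1 = X + b + Z,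
                   a + 1 < X & c < Z]) \/
  (cpre p2 b = b /\
   (b = 0 \/ 0 < c /\ (wit -> forall w, w \in S -> p2 w + 1 = b -> p3 w <= c))).

Lemma unblocked wit (p1 p2 p3 : T -> nat) n d a b c :
  admissible wit p1 p2 p3 n d a b c -> b <= p2 d ->
  ~ blocked wit p1 p2 p3 n a b c ->
  0 < b /\ admissible wit p1 p2 p3 n d a.+1 b.-1 c.
Proof.
case=> ht h2 h3 led nb; have b_gt0 : 0 < b.
  rewrite lt0n; apply/eqP => b0; apply: nb; right.
  by rewrite b0 /cpre; split; [elim: (S) | left].
split=> //; split.
- move=> X Y Z tight avoid; apply/negP => /and3P[ltX ltY ltZ].
  have [ltbY|leYb] := ltnP b Y.
    by have := ht X Y Z tight avoid; rewrite ltbY ltZ; lia.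
  have eqY : Y = b by lia.
  by apply: nb; left; exists X, Z; rewrite -eqY tight; split=> //; lia.
- move=> Y tight leY ltY; have [ltbY|leYb] := ltnP b Y; first exact: h2.
  have eqY : Y = b by lia.
  have [c0|c_gt0] := posnP c; [by left | right].
  apply: NNPP => nw; apply: nb; right; split; first by rewrite -eqY.
  right; split=> // wt w wS ew; rewrite leqNgt; apply/negP => lt; apply: nw.
  by split=> //; exists w => //; split=> //; lia.
- move=> Z tight leZ ltZ; have [b0|[wt [w wS [ew lt]]]] := h3 Z tight leZ ltZ.
    by left; lia.
  by right; split=> //; exists w => //; split=> //; lia.
Qed.

Section Uncross.
Variables (wit : bool) (p1 p2 p3 : T -> nat) (n : nat) (d : T) (a b c : nat).
Hypotheses (cb : convex_bounds p1 p2 p3 n) (dS : d \in S).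
Hypothesis adm : admissible wit p1 p2 p3 n d a b c.
Hypotheses (sum : a + b + c + 1 = n) (leb : b <= p2 d) (lec : c <= p3 d).

(** Exchange both triangles for their hull and intersection. If the hull contained [d], which lies
    in neither triangle, the exchange would be strict and break a bound. So the hull is saturated,
    avoids [d] and contains the current cell, against admissibility. *)
Lemma uncross_tri_tri X Z X' Y :
  ctri p1 p2 p3 X b Z + n + 1 = X + b + Z -> a + 1 < X -> c < Z ->
  ctri p1 p2 p3 X' Y c + n + 1 = X' + Y + c -> a + 1 < X' -> b < Y -> False.
Proof.
move=> tA ltX ltZ tB ltX' ltY; pose t := maxn X X'; pose u := minn X X'.
have bt := @cb_tri _ _ _ _ cb t Y Z; have bu := @cb_tri _ _ _ _ cb u b c.
have ptw : {in S, forall x, [&& p1 x < X, p2 x < b & p3 x < Z] +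
    [&& p1 x < X', p2 x < Y & p3 x < c] <=
    [&& p1 x < t, p2 x < Y & p3 x < Z] + [&& p1 x < u, p2 x < b & p3 x < c]}.
  by move=> x _; rewrite /t /u; lia.
have le : ctri p1 p2 p3 X b Z + ctri p1 p2 p3 X' Y c <=
  ctri p1 p2 p3 t Y Z + ctri p1 p2 p3 u b c := count2_le ptw.
have avoid : ~~ [&& p1 d < t, p2 d < Y & p3 d < Z].
  apply/negP => din.
  have : ctri p1 p2 p3 X b Z + ctri p1 p2 p3 X' Y c <
    ctri p1 p2 p3 t Y Z + ctri p1 p2 p3 u b c by apply: count2_lt dS _ ptw; lia.
  by rewrite /t /u in bt bu *; lia.
have tight : ctri p1 p2 p3 t Y Z + n + 1 = t + Y + Z.
  by rewrite /t /u in bt bu le *; lia.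
by have := adm_tri adm tight avoid; rewrite /t; lia.
Qed.

(** Exchange the triangle and the first c lines for the first Z lines and a smaller triangle. The
    first Z lines are then saturated, and they contain neither [d] nor a witness, either of which
    would make the exchange strict. Admissibility leaves b = 0, where the triangle is empty although
    its size is positive. *)
Lemma uncross_tri_pre X Z :
  ctri p1 p2 p3 X b Z + n + 1 = X + b + Z -> a + 1 < X -> c < Z ->
  cpre p3 c = c -> False.
Proof.
move=> tA ltX ltZ tB.
have bu := @cb_tri _ _ _ _ cb X b c; have bZ := cb_pre3 cb Z.
have ptw : {in S, forall x, [&& p1 x < X, p2 x < b & p3 x < Z] + (p3 x < c) <=
    (p3 x < Z) + [&& p1 x < X, p2 x < b & p3 x < c]}.
  by move=> x _; lia.
have strict w : w \in S -> p3 w < Z -> c <= p3 w -> b <= p2 w -> False.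
  move=> wS ltw lew leb2.
  have : ctri p1 p2 p3 X b Z + cpre p3 c < cpre p3 Z + ctri p1 p2 p3 X b c.
    by apply: count2_lt wS _ ptw; lia.
  by lia.
have le : ctri p1 p2 p3 X b Z + cpre p3 c <= cpre p3 Z + ctri p1 p2 p3 X b c.
  exact: count2_le ptw.
have leZd : Z <= p3 d by rewrite leqNgt; apply/negP => /(strict d dS); apply.
have tZ : cpre p3 Z = Z by lia.
have [b0|[_ [w wS [ew lt]]]] := adm_3 adm tZ leZd ltZ; last first.
  by apply: (strict w wS); lia.
suff : ctri p1 p2 p3 X b Z = 0 by lia.
by rewrite b0 /ctri (@eq_count _ _ pred0) ?count_pred0 // => x /=; rewrite andbF.
Qed.

End Uncross.

(** The pair of obstacles that does not uncross: at the corner cell (a, Y, Z) between two saturated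
    sets of lines avoiding [d], a strip can take neither step. The last inequality of the first
    group places this cell on the line of [d] or later. *)
Definition clash (wit : bool) (p1 p2 p3 : T -> nat) (n : nat) (d : T) (Y Z : nat) :=
  [/\ 0 < Y, 0 < Z, Y <= p2 d, Z <= p3 d & p1 d + Y + Z + 1 <= n] /\
  [/\ cpre p2 Y = Y, cpre p3 Z = Z &
      wit -> (forall w, w \in S -> p2 w + 1 = Y -> p3 w <= Z) /\
             (forall w, w \in S -> p3 w + 1 = Z -> p2 w <= Y)].

Lemma strip_step wit (p1 p2 p3 : T -> nat) n d a b c :
  convex_bounds p1 p2 p3 n -> d \in S -> admissible wit p1 p2 p3 n d a b c ->
  (forall Y Z, ~ clash wit p1 p2 p3 n d Y Z) ->
  a + b + c + 1 = n -> p1 d <= a -> b <= p2 d -> c <= p3 d -> a + 1 < n ->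
  (0 < b /\ admissible wit p1 p2 p3 n d a.+1 b.-1 c) \/
  (0 < c /\ admissible wit p1 p2 p3 n d a.+1 b c.-1).
Proof.
move=> cb dS adm nc sum lea leb lec lta.
have cb' := convex_boundsC cb; have adm' := admissibleC adm.
have [bl2|/(unblocked adm leb)] := classic (blocked wit p1 p2 p3 n a b c); last by left.
have [bl3|/(unblocked adm' lec)[c0 /admissibleC]] :=
  classic (blocked wit p1 p3 p2 n a c b); last by right.
exfalso; case: bl2 bl3 => [[X [Z [tA ltX ltZ]]]|[tA nA]] [[X' [Y [tB ltX' ltY]]]|[tB nB]].
- apply: (uncross_tri_tri cb dS adm sum leb lec tA ltX ltZ _ ltX' ltY).
  by rewrite ctriC; lia.
- exact: (uncross_tri_pre cb dS adm sum leb lec tA ltX ltZ tB).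
- have sum' : a + c + b + 1 = n by lia.
  exact: (uncross_tri_pre cb' dS adm' sum' lec leb tB ltX' ltY tA).
- case: nA nB => [b0|[c_gt0 nA]] [c0|[b_gt0 nB]]; try lia.
  apply: (nc b c); split; first by split=> //; lia.
  by split=> // wt; split; [exact: nA | exact: nB].
Qed.

(** The cell of the strip on line a is (a, f a, g a), from [d] itself to the last line n - 1. *)
Record strip (wit : bool) (p1 p2 p3 : T -> nat) n d (f g : nat -> nat) : Prop := Strip {
  st_start2 : f (p1 d) = p2 d;
  st_start3 : g (p1 d) = p3 d;
  st_sum : forall a, p1 d <= a < n -> a + f a + g a + 1 = n;
  st_step : forall a, p1 d <= a -> a + 1 < n ->
    (f a = (f a.+1).+1 /\ g a = g a.+1) \/ (f a = f a.+1 /\ g a = (g a.+1).+1);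
  st_adm : forall a, p1 d <= a < n -> admissible wit p1 p2 p3 n d a (f a) (g a)
}.

Lemma strip_exists wit (p1 p2 p3 : T -> nat) n d :
  convex_bounds p1 p2 p3 n -> d \in S -> (forall Y Z, ~ clash wit p1 p2 p3 n d Y Z) ->
  exists f g, strip wit p1 p2 p3 n d f g.
Proof.
move=> cb dS nc; have sd := cb_sum cb dS.
(* The induction on the last line m also carries f a <= p2 d and g a <= p3 d: they ensure that the
   obstacles met avoid [d]. *)
suff H m : exists f g, [/\ f (p1 d) = p2 d /\ g (p1 d) = p3 d,
   forall a, p1 d <= a < n -> a <= m -> a + f a + g a + 1 = n,
   forall a, p1 d <= a -> a + 1 < n -> a + 1 <= m ->
    (f a = (f a.+1).+1 /\ g a = g a.+1) \/ (f a = f a.+1 /\ g a = (g a.+1).+1),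
   forall a, p1 d <= a < n -> a <= m -> f a <= p2 d /\ g a <= p3 d &
   forall a, p1 d <= a < n -> a <= m -> admissible wit p1 p2 p3 n d a (f a) (g a)].
  have [f [g [[h2 h3] hs hst _ ha]]] := H n.
  by exists f, g; split=> // a lea *; [apply: hs | apply: hst | apply: ha]; lia.
elim: m => [|m [f [g [[h2 h3] hs hst hle ha]]]]; last first.
  have [ltd|led] := ltnP m (p1 d).
    exists (fun=> p2 d), (fun=> p3 d); split=> // a; try by move=> *; lia.
    move=> lea leam; have -> : a = p1 d by lia.
    by split; [move=> X Y Z _ | move=> *; lia..].
  have [ltn|len] := leqP n m.+1.
    exists f, g; split=> // a.
    - by move=> *; apply: hs; lia.
    - by move=> *; apply: hst; lia.
    - by move=> *; apply: hle; lia.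
    - by move=> *; apply: ha; lia.
  have lem : p1 d <= m < n by lia.
  have [lf lg] := hle m lem (leqnn m); have sm := hs m lem (leqnn m).
  have lem1 : m + 1 < n by lia.
  have [b' [c' [adm' st']]] : exists b' c', admissible wit p1 p2 p3 n d m.+1 b' c' /\
      ((f m = b'.+1 /\ g m = c') \/ (f m = b' /\ g m = c'.+1)).
    case: (strip_step cb dS (ha m lem (leqnn m)) nc sm led lf lg lem1) => [][gt0 adm'].
      by exists (f m).-1, (g m); split=> //; lia.
    by exists (f m), (g m).-1; split=> //; lia.
  exists (fun a => if a == m.+1 then b' else f a),
         (fun a => if a == m.+1 then c' else g a).
  split.
  - by case: eqP => [?|_] //; lia.
  - move=> a lea leam; case: eqP => [->|ne]; [lia | apply: hs; lia].
  - move=> a lea lta leam; rewrite eqSS; case: eqP => [?|_]; first lia.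
    by case: eqP => [->|ne] //; apply: hst; lia.
  - by move=> a lea leam; case: eqP => [_|ne]; [lia | apply: hle; lia].
  - by move=> a lea leam; case: eqP => [->|ne] //; apply: ha; lia.
exists (fun=> p2 d), (fun=> p3 d); split=> // a; try by move=> *; lia.
move=> lea leam; have -> : a = p1 d by lia.
by split; [move=> X Y Z _ | move=> *; lia..].
Qed.

Section StripTheory.
Variables (wit : bool) (p1 p2 p3 : T -> nat) (n : nat) (d : T) (f g : nat -> nat).
Hypothesis st : strip wit p1 p2 p3 n d f g.

Lemma stripC : strip wit p1 p3 p2 n d g f.
Proof.
case: st => h2 h3 hs hst ha; split=> // a.
- by move=> /hs; lia.
- by move=> lea lta; case: (hst a lea lta); [right | left]; lia.
- by move=> /ha /admissibleC.
Qed.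

Lemma strip_mono a a' : p1 d <= a -> a <= a' -> a' < n -> f a' <= f a /\ g a' <= g a.
Proof.
move=> lea; elim: a' => [|a' IH] leaa ltn; first by have -> : a = 0 by lia.
have [lt|ge] := ltnP a' a; first by have -> : a = a'.+1 by lia.
by have := IH ge (ltnW ltn); have := st_step st (a := a'); lia.
Qed.

Lemma strip_le a : p1 d <= a -> a < n -> f a <= p2 d /\ g a <= p3 d.
Proof.
move=> lea lta; rewrite -(st_start2 st) -(st_start3 st).
exact: strip_mono.
Qed.

(** Another one on the strip would be a saturated triangle avoiding [d], and the strip enters
    none. *)
Lemma strip_notin x : convex_bounds p1 p2 p3 n -> d \in S -> x \in S ->
  p1 d < p1 x -> p2 x = f (p1 x) -> False.
Proof.
move=> cb dS xS lt e2; have sx := cb_sum cb xS; have sd := cb_sum cb dS.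
have rng : p1 d <= p1 x < n by lia.
have ss := st_sum st rng.
have := adm_tri (st_adm st rng) (X := (p1 x).+1) (Y := (p2 x).+1) (Z := (p3 x).+1).
by rewrite (cb_cell cb xS); lia.
Qed.

Section Avoid.
Variables (X Y Z : nat).
Hypothesis tight : ctri p1 p2 p3 X Y Z + n + 1 = X + Y + Z.

(** The strip starts with [p2] at least Y and keeps [p3] below Z; going below Y on a line before X
    would put it inside the triangle. *)
Lemma strip_side2 a : Y <= p2 d -> p3 d < Z ->
  p1 d <= a -> a < n -> a < X -> Y <= f a.
Proof.
move=> leY ltZ lea; have avoid : ~~ [&& p1 d < X, p2 d < Y & p3 d < Z] by lia.
elim: a lea => [|a IH] lea ltan ltaX.
  have -> : 0 = p1 d by lia.
  by rewrite (st_start2 st).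
have [e|ne] := eqVneq (p1 d) a.+1; first by rewrite -e (st_start2 st).
have := IH _ (ltnW ltan) (ltnW ltaX); have := st_step st (a := a).
have rng : p1 d <= a.+1 < n by lia.
by have := adm_tri (st_adm st rng) tight avoid; have := strip_le lea ltan; lia.
Qed.

Lemma strip_dichotomy : Y <= p2 d -> Z <= p3 d ->
  p1 d + p2 d + p3 d + 1 = n ->
  (forall a, n + 1 <= a + Y + Z -> a < X -> a < n -> Y <= f a) \/
  (forall a, n + 1 <= a + Y + Z -> a < X -> a < n -> Z <= g a).
Proof.
move=> leY leZ sum; have avoid : ~~ [&& p1 d < X, p2 d < Y & p3 d < Z] by lia.
(* This is the line of the apex, where the triangle has a single cell. The strip passes on one side
   of it and cannot cross over later. *)
have [a0 ea0] : exists a0, a0 = n + 1 - Y - Z by eexists.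
have [leX|ltX] := leqP (minn X n) a0; first by left=> a; lia.
have rng0 : p1 d <= a0 < n by lia.
have s0 := st_sum st rng0.
have av0 := adm_tri (st_adm st rng0) tight avoid.
have [leYf|ltfY] := leqP Y (f a0); [left | right]; elim=> [|a IH] lea ltaX ltan;
  try (have <- : a0 = 0 by lia); try lia.
- have [lt|ge] := ltnP (a + Y + Z) (n + 1).
    by have <- : a0 = a.+1 by lia.
  have rng : p1 d <= a.+1 < n by lia.
  have := adm_tri (st_adm st rng) tight avoid.
  by have := IH ge (ltnW ltaX) (ltnW ltan); have := st_step st (a := a);
    have := st_sum st rng; lia.
- have [lt|ge] := ltnP (a + Y + Z) (n + 1).
    have <- : a0 = a.+1 by lia.
    by lia.
  have rng : p1 d <= a.+1 < n by lia.
  have := adm_tri (st_adm st rng) tight avoid.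
  by have := IH ge (ltnW ltaX) (ltnW ltan); have := st_step st (a := a);
    have := st_sum st rng; lia.
Qed.

End Avoid.
End StripTheory.

End Tri.

(** * Groves in barycentric coordinates *)

(* Barycentric coordinates: a vertex of size n is a triple of sum n (its
   distances to the top, left and right sides) and a downward triangle is a
   triple x of sum n - 1, with vertices x + e1 (bottom), x + e2 (top right)
   and x + e3 (top left). *)
Notation triple := (nat * nat * nat)%type.

Definition c1 (x : triple) := x.1.1.
Definition c2 (x : triple) := x.1.2.
Definition c3 (x : triple) := x.2.
Arguments c1 !x /.
Arguments c2 !x /.
Arguments c3 !x /.

Lemma tripleP (x y : triple) : c1 x = c1 y -> c2 x = c2 y -> c3 x = c3 y -> x = y.
Proof. by case: x y => [[? ?] ?] [[? ?] ?] /= -> -> ->. Qed.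

(* The edge of the triangle [x] opposite to its vertex x + e_m. *)
Definition ends (m : nat) (x : triple) : triple * triple :=
  match m with
  | 1 => ((c1 x, (c2 x).+1, c3 x), (c1 x, c2 x, (c3 x).+1))
  | 2 => (((c1 x).+1, c2 x, c3 x), (c1 x, c2 x, (c3 x).+1))
  | _ => (((c1 x).+1, c2 x, c3 x), (c1 x, (c2 x).+1, c3 x))
  end.

(* [S] lists the triangles with a one; each other triangle [x] has the one edge
   selected by [ch x]. *)
Definition gedge n (S : seq triple) (ch : triple -> nat) (u v : triple) :=
  exists x, [/\ c1 x + c2 x + c3 x + 1 = n, x \notin S & (u, v) = ends (ch x) x].

Definition gconn n S ch := clos_refl_sym_trans triple (gedge n S ch).

Lemma gconn_edge n S ch x :
  c1 x + c2 x + c3 x + 1 = n -> x \notin S ->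
  gconn n S ch (ends (ch x) x).1 (ends (ch x) x).2.
Proof. by move=> sx xS; apply: rst_step; exists x; split=> //; case: (ends _ _). Qed.

Lemma gconn_map n S ch n' S' ch' (f : triple -> triple) u v :
  (forall x, c1 x + c2 x + c3 x + 1 = n' -> x \notin S' ->
     gconn n S ch (f (ends (ch' x) x).1) (f (ends (ch' x) x).2)) ->
  gconn n' S' ch' u v -> gconn n S ch (f u) (f v).
Proof.
move=> H; elim=> {u v} [u v [x [sx xS uv]]|u|u v _|u v w _ uv _ vw].
- by have := H x sx xS; rewrite -uv.
- exact: rst_refl.
- exact: rst_sym.
- exact: rst_trans uv vw.
Qed.

Definition boundary (n : nat) (w : triple) :=
  (c1 w + c2 w + c3 w == n) && [|| c1 w == 0, c2 w == 0 | c3 w == 0].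

(* The connections required for 2 d < n are the west, east and south pairs, and
   those for 2 d = n amount to the middle triplet. *)
Definition solution n S ch :=
  (forall v, c1 v + c2 v + c3 v = n -> exists2 w, boundary n w & gconn n S ch v w) /\
  (forall d, 2 * d <= n ->
    [/\ gconn n S ch (0, d, n - d) (d, 0, n - d),
        gconn n S ch (0, n - d, d) (d, n - d, 0) &
        gconn n S ch (n - d, 0, d) (n - d, d, 0)]).

Definition solvable n S := exists ch, solution n S ch.

Definition balanced n (S : seq triple) :=
  convex_bounds S c1 c2 c3 n /\ size S = uphalf n.

(** * Symmetries of the triangle *)

Definition swap12 (x : triple) : triple := (c2 x, c1 x, c3 x).
Definition rot3 (x : triple) : triple := (c2 x, c3 x, c1 x).
Definition unrot3 (x : triple) : triple := (c3 x, c1 x, c2 x).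

Lemma swap12K : involutive swap12. Proof. by case=> [[]]. Qed.
Lemma rot3K : cancel rot3 unrot3. Proof. by case=> [[]]. Qed.
Lemma unrot3K : cancel unrot3 rot3. Proof. by case=> [[]]. Qed.

Lemma count_preim (P : pred triple) (f : triple -> triple) S :
  count P (map f S) = count (fun x => P (f x)) S.
Proof. by rewrite count_map; apply: eq_count. Qed.

Lemma cpre_map (p : triple -> nat) (f : triple -> triple) S m :
  cpre (map f S) p m = cpre S (fun x => p (f x)) m.
Proof. by rewrite /cpre count_preim. Qed.

Lemma ctri_map (p1 p2 p3 : triple -> nat) (f : triple -> triple) S X Y Z :
  ctri (map f S) p1 p2 p3 X Y Z =
  ctri S (fun x => p1 (f x)) (fun x => p2 (f x)) (fun x => p3 (f x)) X Y Z.
Proof. by rewrite /ctri count_preim. Qed.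

Lemma convex_bounds_map (f : triple -> triple) (S : seq triple) p1 p2 p3 n :
  convex_bounds S (fun x => p1 (f x)) (fun x => p2 (f x)) (fun x => p3 (f x)) n ->
  convex_bounds (map f S) p1 p2 p3 n.
Proof.
case=> h h1 h2 h3 ht; split=> [x /mapP[y yS ->]|m|m|m|X Y Z le].
- exact: h.
- by rewrite cpre_map.
- by rewrite cpre_map.
- by rewrite cpre_map.
- by rewrite ctri_map; exact: ht.
Qed.

Lemma balanced_swap12 n S : balanced n S -> balanced n (map swap12 S).
Proof.
case=> cb sz; split; last by rewrite size_map.
by apply: convex_bounds_map; exact/convex_boundsR/convex_boundsC/convex_boundsR/convex_boundsR.
Qed.

Lemma balanced_rot3 n S : balanced n S -> balanced n (map rot3 S).
Proof.
case=> cb sz; split; last by rewrite size_map.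
by apply: convex_bounds_map; exact/convex_boundsR.
Qed.

Lemma solvable_swap12 n S : solvable n (map swap12 S) -> solvable n S.
Proof.
case=> ch [cb pat].
pose ch' x := match ch (swap12 x) with 1 => 2 | 2 => 1 | m => m end.
have conn u v : gconn n (map swap12 S) ch u v -> gconn n S ch' (swap12 u) (swap12 v).
  apply: gconn_map => x sx xS.
  have xS' : swap12 x \notin S by apply: contra xS => /(map_f swap12); rewrite swap12K.
  have := @gconn_edge n S ch' (swap12 x) _ xS'; rewrite /ch' swap12K.
  case: x sx {xS xS'} => [[i j] k] /= sx; case: (ch _) => [|[|[|m]]] /= H.
  - by apply: rst_sym; apply: H; lia.
  - by apply: H; lia.
  - by apply: H; lia.
  - by apply: rst_sym; apply: H; lia.
exists ch'; split=> [v sv|d led].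
  have [|w bw cw] := cb (swap12 v); first by case: v sv => [[]] /=; lia.
  exists (swap12 w); last by rewrite -[v]swap12K; exact: conn.
  by case: w bw {cw} => [[]]; rewrite /boundary /=; lia.
have [p1 p2 p3] := pat d led; split; last exact: (conn _ _ p2).
- by apply: rst_sym; exact: (conn _ _ p1).
- exact: (conn _ _ p3).
Qed.

Lemma solvable_rot3 n S : solvable n (map rot3 S) -> solvable n S.
Proof.
case=> ch [cb pat].
pose ch' x := match ch (rot3 x) with 1 => 2 | 2 => 3 | _ => 1 end.
have conn u v : gconn n (map rot3 S) ch u v -> gconn n S ch' (unrot3 u) (unrot3 v).
  apply: gconn_map => x sx xS.
  have xS' : unrot3 x \notin S by apply: contra xS => /(map_f rot3); rewrite unrot3K.
  have := @gconn_edge n S ch' (unrot3 x) _ xS'; rewrite /ch' unrot3K.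
  case: x sx {xS xS'} => [[i j] k] /= sx; case: (ch _) => [|[|[|m]]] /= H.
  - by apply: H; lia.
  - by apply: rst_sym; apply: H; lia.
  - by apply: rst_sym; apply: H; lia.
  - by apply: H; lia.
exists ch'; split=> [v sv|d led].
  have [|w bw cw] := cb (rot3 v); first by case: v sv => [[]] /=; lia.
  exists (unrot3 w); last by rewrite -[v]rot3K; exact: conn.
  by case: w bw {cw} => [[]]; rewrite /boundary /=; lia.
have [p1 p2 p3] := pat d led; split; last exact: (conn _ _ p1).
- by apply: rst_sym; exact: (conn _ _ p2).
- by apply: rst_sym; exact: (conn _ _ p3).
Qed.

(** * Deleting a one and its strips *)

Section Reduction.
Variables (n : nat) (S : seq triple) (d : triple).
Variables (sg sg3 ep ep3 om om2 : nat -> nat).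
Hypotheses (n_ge2 : 2 <= n) (bal : balanced n S) (dS : d \in S).
Hypothesis stS : strip S false c1 c2 c3 n d sg sg3.
Hypothesis stE : strip S true c2 c1 c3 n d ep ep3.
Hypothesis stW : strip S false c3 c1 c2 n d om om2.
Hypothesis gapL : forall m, 0 < m -> cpre S c2 m = m -> c2 d < m.

Let cb123 : convex_bounds S c1 c2 c3 n := proj1 bal.
Let cb231 : convex_bounds S c2 c3 c1 n := convex_boundsR cb123.
Let cb312 : convex_bounds S c3 c1 c2 n := convex_boundsR cb231.
Let cb213 : convex_bounds S c2 c1 c3 n := convex_boundsC cb231.
Let sumd : c1 d + c2 d + c3 d + 1 = n := cb_sum cb123 dS.

(* The three strips issued from the one [d] cut the triangle into a top, a left
   and a right region, numbered 0, 1 and 2; deleting the strips moves these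
   regions by -e2-e3, -e1-e3 and -e1-e2 respectively. *)
Definition cell_region (x : triple) : nat :=
  if c1 d < c1 x then (if c2 x < sg (c1 x) then 1 else 2)
  else if c2 d < c2 x then (if c1 x < ep (c2 x) then 0 else 2)
  else (if c1 x < om (c3 x) then 0 else 1).

(** The weak inequalities put the two ends of a strip edge into different regions, so that the
    deletion identifies exactly vertices that such edges join. *)
Definition vertex_region (v : triple) : nat :=
  if c1 d < c1 v then (if c2 v <= sg (c1 v) then 1 else 2)
  else if c2 d < c2 v then (if c1 v <= ep (c2 v) then 0 else 2)
  else (if c1 v <= om (c3 v) then 0 else 1).

Definition shift (l : nat) (v : triple) : triple :=
  match l with
  | 0 => (c1 v, (c2 v).-1, (c3 v).-1)
  | 1 => ((c1 v).-1, c2 v, (c3 v).-1)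
  | _ => ((c1 v).-1, (c2 v).-1, c3 v)
  end.

Definition reduced := [seq shift (cell_region x) x | x <- rem d S].

(** When several coordinates of [x] exceed those of [d], the strips in these directions agree on the
    region, so any of them may be used to read it off. *)
Lemma cell_regionE x : c1 x + c2 x + c3 x + 1 = n -> c2 d < c2 x ->
  cell_region x = if c1 x < ep (c2 x) then 0 else 2.
Proof.
move=> sx lt2; rewrite /cell_region lt2; case: ltnP => // lt1.
have [||ls _] := strip_le stS (a := c1 x); try lia.
have [||le _] := strip_le stE (a := c2 x); try lia.
by rewrite ifF; [rewrite ifF // |]; lia.
Qed.

Lemma cell_regionW x : c1 x + c2 x + c3 x + 1 = n -> c3 d < c3 x ->
  cell_region x = if c1 x < om (c3 x) then 0 else 1.
Proof.
move=> sx lt3; rewrite /cell_region.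
have [||lw1 lw2] := strip_le stW (a := c3 x); try lia.
have rw : c3 d <= c3 x < n by lia.
have sw := st_sum stW rw.
case: ltnP => lt1.
  have rs : c1 d <= c1 x < n by lia.
  have ss := st_sum stS rs; have [||ls1 ls2] := strip_le stS (a := c1 x); try lia.
  by rewrite ifT ?ifF //; lia.
case: ltnP => // lt2.
have re : c2 d <= c2 x < n by lia.
have se := st_sum stE re; have [||le1 le2] := strip_le stE (a := c2 x); try lia.
by rewrite !ifT //; lia.
Qed.

Lemma region_cases x : c1 x + c2 x + c3 x + 1 = n ->
  x = d \/ [\/ c1 d < c1 x, c2 d < c2 x | c3 d < c3 x].
Proof.
move=> sx; have [lt|le1] := ltnP (c1 d) (c1 x); first by right; constructor 1.
have [lt|le2] := ltnP (c2 d) (c2 x); first by right; constructor 2.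
have [lt|le3] := ltnP (c3 d) (c3 x); first by right; constructor 3.
by left; apply: tripleP; lia.
Qed.

(** No strip can cross a saturated triangle avoiding [d]. The cases record which sides of the
    triangle separate it from [d], hence which strips pass near it. *)
Lemma region_uniform X Y Z :
  ctri S c1 c2 c3 X Y Z + n + 1 = X + Y + Z ->
  ~~ [&& c1 d < X, c2 d < Y & c3 d < Z] ->
  exists2 l, l < 3 & forall x, c1 x + c2 x + c3 x + 1 = n ->
    [&& c1 x < X, c2 x < Y & c3 x < Z] -> cell_region x = l.
Proof.
move=> tS avoid.
have tE : ctri S c2 c1 c3 Y X Z + n + 1 = Y + X + Z.
  by rewrite ctriC -ctriR; lia.
have tW : ctri S c3 c1 c2 Z X Y + n + 1 = Z + X + Y by rewrite ctriR; lia.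
have [le1|lt1] := leqP X (c1 d); have [le2|lt2] := leqP Y (c2 d);
  have [le3|lt3] := leqP Z (c3 d); last by lia.
- exists 0 => // x sx; lia.
- have sW : c3 d + c1 d + c2 d + 1 = n by lia.
  have [side|side] := strip_dichotomy stW tW le1 le2 sW; [exists 0 | exists 1] => // x sx xA;
    (rewrite cell_regionW; try lia); case: ltnP => // h; have := side (c3 x);
    have := st_sum stW (a := c3 x); lia.
- have sE : c2 d + c1 d + c3 d + 1 = n by lia.
  have [side|side] := strip_dichotomy stE tE le1 le3 sE; [exists 0 | exists 2] => // x sx xA;
    (rewrite cell_regionE; try lia); case: ltnP => // h; have := side (c2 x);
    have := st_sum stE (a := c2 x); lia.
- exists 0 => // x sx xA; have [e|[lt|lt|lt]] := region_cases sx.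
  + by rewrite e in xA; lia.
  + lia.
  + rewrite cell_regionE //; case: ltnP => // h; have := strip_side2 stE tE le1 lt3 (a := c2 x).
    lia.
  + rewrite cell_regionW //; case: ltnP => // h; have := strip_side2 stW tW le1 lt2 (a := c3 x).
    lia.
- have [side|side] := strip_dichotomy stS tS le2 le3 sumd; [exists 1 | exists 2] => // x sx xA;
    (rewrite /cell_region ifT; try lia); case: ltnP => // h; have := side (c1 x);
    have := st_sum stS (a := c1 x); lia.
- exists 1 => // x sx xA; have [e|[lt|lt|lt]] := region_cases sx.
  + by rewrite e in xA; lia.
  + rewrite /cell_region lt; case: ltnP => // h; have := strip_side2 stS tS le2 lt3 (a := c1 x).
    lia.
  + lia.
  + have tW' : ctri S c3 c2 c1 Z Y X + n + 1 = Z + Y + X by rewrite ctriC; lia.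
    rewrite cell_regionW //; case: ltnP => // h; have := strip_side2 (stripC stW) tW' le2 lt1 (a := c3 x).
    have := st_sum stW (a := c3 x); lia.
- exists 2 => // x sx xA; have [e|[lt|lt|lt]] := region_cases sx.
  + by rewrite e in xA; lia.
  + have tS' : ctri S c1 c3 c2 X Z Y + n + 1 = X + Z + Y by rewrite ctriC; lia.
    rewrite /cell_region lt; case: ltnP => // h; have := strip_side2 (stripC stS) tS' le3 lt2 (a := c1 x).
    have := st_sum stS (a := c1 x); lia.
  + have tE' : ctri S c2 c3 c1 Y Z X + n + 1 = Y + Z + X by rewrite ctriC; lia.
    rewrite cell_regionE //; case: ltnP => // h; have := strip_side2 (stripC stE) tE' le3 lt1 (a := c2 x).
    have := st_sum stE (a := c2 x); lia.
  + lia.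
Qed.

Let sub_rem x : x \in rem d S -> [/\ x \in S, x <> d & c1 x + c2 x + c3 x + 1 = n].
Proof.
rewrite (mem_rem_uniq _ (cb_uniq cb123)) inE => /andP[/eqP xd xS].
by split=> //; exact: (cb_sum cb123).
Qed.

Lemma region_pos x : x \in rem d S ->
  [\/ [/\ cell_region x = 0, 0 < c2 x & 0 < c3 x],
      [/\ cell_region x = 1, 0 < c1 x & 0 < c3 x] |
      [/\ cell_region x = 2, 0 < c1 x & 0 < c2 x]].
Proof.
move=> /sub_rem[xS xd sx]; have [//|[lt|lt|lt]] := region_cases sx.
- have nS := strip_notin stS cb123 dS xS lt.
  have rS : c1 d <= c1 x < n by lia.
  have sS := st_sum stS rS; rewrite /cell_region lt; case: ltnP => h; last first.
    by constructor 3; split=> //; lia.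
  by constructor 2; split=> //; lia.
- have nE : c1 x <> ep (c2 x) := fun e => strip_notin stE cb213 dS xS lt e.
  have rE : c2 d <= c2 x < n by lia.
  have sE := st_sum stE rE; rewrite cell_regionE //; case: ltnP => h.
    by constructor 1; split=> //; lia.
  by constructor 3; split=> //; lia.
- have nW : c1 x <> om (c3 x) := fun e => strip_notin stW cb312 dS xS lt e.
  have rW : c3 d <= c3 x < n by lia.
  have sW := st_sum stW rW; rewrite cell_regionW //; case: ltnP => h.
    by constructor 1; split=> //; lia.
  by constructor 2; split=> //; lia.
Qed.

(** The preimage lies in a triangle of size one more. The excess is paid by [d] if it is inside, or
    by slack if the triangle is not saturated. Otherwise the preimage lies in one region, whose
    shift fixes a coordinate, and a triangle of the right size already contains it. *)
Lemma reduced_tri X Y Z : n - 2 + 1 <= X + Y + Z ->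
  ctri reduced c1 c2 c3 X Y Z + (n - 2) + 1 <= X + Y + Z.
Proof.
move=> le; pose P x := let y := shift (cell_region x) x in
  [&& c1 y < X, c2 y < Y & c3 y < Z].
have -> : ctri reduced c1 c2 c3 X Y Z = count P (rem d S).
  by rewrite /reduced /ctri count_map; apply: eq_count.
pose A x := [&& c1 x < X.+1, c2 x < Y.+1 & c3 x < Z.+1].
have PA : {in rem d S, forall x, P x -> A x}.
  move=> x xr; rewrite /P /A; case: (region_pos xr) => -[-> ? ?] /=; lia.
have leA : count P (rem d S) <= count A (rem d S) := count_le_in PA.
have eA : count A S = A d + count A (rem d S) := count_remD A dS.
have bA : n + 1 <= X.+1 + Y.+1 + Z.+1 -> count A S + n + 1 <= X.+1 + Y.+1 + Z.+1.
  exact: (cb_tri cb123).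
have [Ad|nAd] := boolP (A d); first by rewrite Ad in eA; lia.
have [lt|ge] := ltnP (count A S + n + 1) (X.+1 + Y.+1 + Z.+1); first by lia.
have tight : ctri S c1 c2 c3 X.+1 Y.+1 Z.+1 + n + 1 = X.+1 + Y.+1 + Z.+1.
  by change (count A S + n + 1 = X.+1 + Y.+1 + Z.+1); lia.
have [l l3 reg] := region_uniform tight nAd.
suff [X' [Y' [Z' [eXYZ sub]]]] : exists X' Y' Z', X' + Y' + Z' = X + Y + Z + 2 /\
    {in rem d S, forall x, P x -> [&& c1 x < X', c2 x < Y' & c3 x < Z']}.
  have le' : count P (rem d S) <= ctri S c1 c2 c3 X' Y' Z'.
    by rewrite /ctri (count_remD _ dS); apply: leq_trans (count_le_in sub) (leq_addl _ _).
  by have := @cb_tri _ _ _ _ _ _ cb123 X' Y' Z'; lia.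
have regr x : x \in rem d S -> P x -> cell_region x = l.
  by move=> xr Px; have [_ _ sx] := sub_rem xr; exact: reg (PA x xr Px).
case: l l3 regr {reg} => [|[|[|//]]] _ regr;
  [exists X, Y.+1, Z.+1 | exists X.+1, Y, Z.+1 | exists X.+1, Y.+1, Z];
  (split; first lia); move=> x xr Px; have e := regr x xr Px;
  move: Px; rewrite /P e; case: (region_pos xr); rewrite e => -[] //= _ *; lia.
Qed.

Lemma reduced_pre2 m : cpre reduced c2 m <= m.
Proof.
pose P x := c2 (shift (cell_region x) x) < m.
have -> : cpre reduced c2 m = count P (rem d S).
  by rewrite /reduced /cpre count_map; apply: eq_count.
pose A x := c2 x < m.+1.
have PA : {in rem d S, forall x, P x -> A x}.
  move=> x xr; rewrite /P /A; case: (region_pos xr) => -[-> ? ?] /=; lia.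
have leA : count P (rem d S) <= count A (rem d S) := count_le_in PA.
have eA : count A S = A d + count A (rem d S) := count_remD A dS.
have bA : count A S <= m.+1 := cb_pre2 cb123 m.+1.
have [e|ne] := eqVneq (count A S) m.+1; last by lia.
have Ad : A d := gapL (ltn0Sn m) e.
by rewrite Ad in eA; lia.
Qed.

(** Saturated rows avoiding [d] must lose a one: a one of their last row that belongs to the top
    region keeps its row, while the number of rows drops by one. *)
Lemma reduced_pre1 m : cpre reduced c1 m <= m.
Proof.
pose P x := c1 (shift (cell_region x) x) < m.
have -> : cpre reduced c1 m = count P (rem d S).
  by rewrite /reduced /cpre count_map; apply: eq_count.
pose A x := c1 x < m.+1.
have PA : {in rem d S, forall x, P x -> A x}.
  move=> x xr; rewrite /P /A; case: (region_pos xr) => -[-> ? ?] /=; lia.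
have leA : count P (rem d S) <= count A (rem d S) := count_le_in PA.
have eA : count A S = A d + count A (rem d S) := count_remD A dS.
have bA : count A S <= m.+1 := cb_pre1 cb123 m.+1.
have [e|ne] := eqVneq (count A S) m.+1; last by lia.
have [Ad|nAd] := boolP (A d); first by rewrite Ad in eA; lia.
have lt1 : m.+1 <= c1 d by rewrite /A in nAd; lia.
(* Both upper strips enter the top m + 1 rows, with a one of the last of
   these rows between them. *)
have [w wS [ew reg]] : exists2 w, w \in S & c1 w = m /\ cell_region w = 0.
  have zE : ep n.-1 < m.+1.
    have rE : c2 d <= n.-1 < n by lia.
    by have := st_sum stE rE; lia.
  have exE : exists j, (c2 d <= j < n) && (ep j < m.+1).
    by exists n.-1; rewrite zE; lia.
  have [j /andP[rj lj] minj] := ex_minnP exE.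
  have ltdj : c2 d < j.
    rewrite ltn_neqAle; apply/andP; split; last by lia.
    by apply/eqP => ej; rewrite -ej (st_start2 stE) in lj; lia.
  have before j' : c2 d <= j' < j -> m.+1 <= ep j'.
    move=> lj'; rewrite leqNgt; apply/negP => lt.
    by have := minj j'; rewrite lt; lia.
  have ej : ep j = m.
    have := before j.-1; have := st_step stE (a := j.-1).
    by rewrite prednK; lia.
  have sj := st_sum stE rj.
  (* The strip enters these rows at the right side of the triangle, with every one of row m on its
     left, or beyond a witness of row m. *)
  have [w wS [ew lew]] : exists2 w, w \in S & c1 w = m /\ c2 w < j.
    have [c0|[_ [w wS [ew lt]]]] := adm_2 (st_adm stE rj) e lt1 lj; last first.
      by exists w => //; have := cb_sum cb123 wS; lia.
    have [w wS ew] := cpre_edge (cb_pre1 cb123 m) (eq_leq (esym e)).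
    exists w => //; split=> //; have sw := cb_sum cb123 wS.
    rewrite ltnNge; apply/negP => le2; have e2 : c2 w = j by lia.
    by apply: (strip_notin stE cb213 dS wS); rewrite e2 // ew.
  exists w => //; split=> //; have sw := cb_sum cb123 wS.
  have [lt2|le2] := ltnP (c2 d) (c2 w).
    by rewrite cell_regionE // ifT // ew; apply: before; lia.
  have lt3 : c3 d < c3 w by lia.
  have rW : c3 d <= c3 w < n by lia.
  have sW := st_sum stW rW.
  rewrite cell_regionW // ifT // ltnNge; apply/negP => leo.
  (* The strip for [c3] was built without [wit], so inside saturated rows avoiding [d] it can only
     run along the left side. *)
  have o2 : om2 (c3 w) = 0.
    by have [||//|[]] := adm_2 (st_adm stW rW) e; lia.
  have eo : c1 w = om (c3 w) by lia.
  exact: (strip_notin stW cb312 dS wS lt3 eo).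
have wr : w \in rem d S.
  rewrite (mem_rem_uniq _ (cb_uniq cb123)) inE wS andbT.
  by apply/eqP => ed; rewrite ed in ew; lia.
have lt : count P (rem d S) + count pred0 (rem d S) <
    count A (rem d S) + count pred0 (rem d S).
  apply: (count2_lt wr) => [|x xr]; first by rewrite /P /A reg /= ew; lia.
  by have := PA x xr; case: (P x) => // ->.
by lia.
Qed.

(** As for the rows, but the one that pays lies in the right region, whose shift fixes [c3], between
    the strips for [c1] and [c2]. *)
Lemma reduced_pre3 m : cpre reduced c3 m <= m.
Proof.
pose P x := c3 (shift (cell_region x) x) < m.
have -> : cpre reduced c3 m = count P (rem d S).
  by rewrite /reduced /cpre count_map; apply: eq_count.
pose A x := c3 x < m.+1.
have PA : {in rem d S, forall x, P x -> A x}.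
  move=> x xr; rewrite /P /A; case: (region_pos xr) => -[-> ? ?] /=; lia.
have leA : count P (rem d S) <= count A (rem d S) := count_le_in PA.
have eA : count A S = A d + count A (rem d S) := count_remD A dS.
have bA : count A S <= m.+1 := cb_pre3 cb123 m.+1.
have [e|ne] := eqVneq (count A S) m.+1; last by lia.
have [Ad|nAd] := boolP (A d); first by rewrite Ad in eA; lia.
have lt3 : m.+1 <= c3 d by rewrite /A in nAd; lia.
have [w wS [ew reg]] : exists2 w, w \in S & c3 w = m /\ cell_region w = 2.
  have zE : ep3 n.-1 < m.+1.
    have rE : c2 d <= n.-1 < n by lia.
    by have := st_sum stE rE; lia.
  have exE : exists j, (c2 d <= j < n) && (ep3 j < m.+1).
    by exists n.-1; rewrite zE; lia.
  have [j /andP[rj lj] minj] := ex_minnP exE.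
  have ltdj : c2 d < j.
    rewrite ltn_neqAle; apply/andP; split; last by lia.
    by apply/eqP => ej; rewrite -ej (st_start3 stE) in lj; lia.
  have before j' : c2 d <= j' < j -> m.+1 <= ep3 j'.
    move=> lj'; rewrite leqNgt; apply/negP => lt.
    by have := minj j'; rewrite lt; lia.
  have ej : ep3 j = m.
    have := before j.-1; have := st_step stE (a := j.-1).
    by rewrite prednK; lia.
  have sj := st_sum stE rj.
  have [w wS [ew lew]] : exists2 w, w \in S & c3 w = m /\ c2 w < j.
    have [c0|[_ [w wS [ew lt]]]] := adm_3 (st_adm stE rj) e lt3 lj; last first.
      by exists w => //; have := cb_sum cb123 wS; lia.
    have [w wS ew] := cpre_edge (cb_pre3 cb123 m) (eq_leq (esym e)).
    exists w => //; split=> //; have sw := cb_sum cb123 wS.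
    rewrite ltnNge; apply/negP => le2; have e2 : c2 w = j by lia.
    by apply: (strip_notin stE cb213 dS wS); rewrite e2 //; lia.
  exists w => //; split=> //; have sw := cb_sum cb123 wS.
  have [lt2|le2] := ltnP (c2 d) (c2 w).
    rewrite cell_regionE //; case: ltnP => // lt.
    have rw : c2 d <= c2 w < n by lia.
    by have := before (c2 w); have := st_sum stE rw; lia.
  have lt1 : c1 d < c1 w by lia.
  rewrite /cell_region lt1; case: ltnP => // lt.
  have rS : c1 d <= c1 w < n by lia.
  have sS := st_sum stS rS.
  by have [||//|[]] := adm_3 (st_adm stS rS) e; lia.
have wr : w \in rem d S.
  rewrite (mem_rem_uniq _ (cb_uniq cb123)) inE wS andbT.
  by apply/eqP => ed; rewrite ed in ew; lia.
have lt : count P (rem d S) + count pred0 (rem d S) <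
    count A (rem d S) + count pred0 (rem d S).
  apply: (count2_lt wr) => [|x xr]; first by rewrite /P /A reg /= ew; lia.
  by have := PA x xr; case: (P x) => // ->.
by lia.
Qed.

Lemma reduced_balanced : balanced (n - 2) reduced.
Proof.
split; last by rewrite size_map size_rem // (proj2 bal) !uphalf_half; lia.
split; [|exact: reduced_pre1|exact: reduced_pre2|exact: reduced_pre3|exact: reduced_tri].
move=> x /mapP[y yr ->]; have [_ _ sy] := sub_rem yr.
by case: (region_pos yr) => -[-> ? ?] /=; lia.
Qed.

(** * Gluing the three regions along the strips *)

Lemma vertex_regionE v : c1 v + c2 v + c3 v = n -> c2 d < c2 v < n ->
  vertex_region v = if c1 v <= ep (c2 v) then 0 else 2.
Proof.
move=> sv /andP[lt2 lt2n]; rewrite /vertex_region lt2; case: ltnP => // lt1.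
have [||ls _] := strip_le stS (a := c1 v); try lia.
have [||le _] := strip_le stE (a := c2 v); try lia.
by rewrite ifF; [rewrite ifF // |]; lia.
Qed.

Lemma vertex_regionW v : c1 v + c2 v + c3 v = n -> c3 d < c3 v < n ->
  vertex_region v = if c1 v <= om (c3 v) then 0 else 1.
Proof.
move=> sv /andP[lt3 lt3n]; rewrite /vertex_region.
have [||lw1 lw2] := strip_le stW (a := c3 v); try lia.
have rw : c3 d <= c3 v < n by lia.
have sw := st_sum stW rw.
case: ltnP => lt1.
  have rs : c1 d <= c1 v < n by lia.
  have ss := st_sum stS rs; have [||ls1 ls2] := strip_le stS (a := c1 v); try lia.
  by rewrite ifT ?ifF //; lia.
case: ltnP => // lt2.
have re : c2 d <= c2 v < n by lia.
have se := st_sum stE re; have [||le1 le2] := strip_le stE (a := c2 v); try lia.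
by rewrite !ifT //; lia.
Qed.

Definition off_strips x :=
  [/\ c1 d < c1 x -> c2 x <> sg (c1 x), c2 d < c2 x -> c1 x <> ep (c2 x) &
      c3 d < c3 x -> c1 x <> om (c3 x)].

Lemma vertices_region x m : c1 x + c2 x + c3 x + 1 = n -> x <> d -> off_strips x ->
  vertex_region (ends m x).1 = cell_region x /\
  vertex_region (ends m x).2 = cell_region x.
Proof.
move=> sx xd [oS oE oW].
suff [h1 h2 h3] : [/\ vertex_region ((c1 x).+1, c2 x, c3 x) = cell_region x,
    vertex_region (c1 x, (c2 x).+1, c3 x) = cell_region x &
    vertex_region (c1 x, c2 x, (c3 x).+1) = cell_region x].
  by case: m => [|[|[|m]]].
have [//|[lt|lt|lt]] := region_cases sx.
- have rS : c1 d <= c1 x < n by lia.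
  have sS := st_sum stS rS; have stp := st_step stS (a := c1 x); have o := oS lt.
  by rewrite /vertex_region /cell_region /= lt ltnS (ltnW lt); split;
    do ?case: leqP => ?; lia.
- have rE : c2 d <= c2 x < n by lia.
  have sE := st_sum stE rE; have stp := st_step stE (a := c2 x); have o := oE lt.
  by rewrite !cell_regionE // !vertex_regionE /=; try lia; split;
    do ?case: leqP => ?; lia.
- have rW : c3 d <= c3 x < n by lia.
  have sW := st_sum stW rW; have stp := st_step stW (a := c3 x); have o := oW lt.
  by rewrite !cell_regionW // !vertex_regionW /=; try lia; split;
    do ?case: leqP => ?; lia.
Qed.

Variable ch' : triple -> nat.

Definition lifted_choice (x : triple) : nat :=
  if (c1 d < c1 x) && (c2 x == sg (c1 x)) then 1
  else if (c2 d < c2 x) && (c1 x == ep (c2 x)) then 2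
  else if (c3 d < c3 x) && (c1 x == om (c3 x)) then 3
  else ch' (shift (cell_region x) x).

Local Notation conn := (gconn n S lifted_choice).

Lemma edgeS a : c1 d < a < n -> conn (a, (sg a).+1, sg3 a) (a, sg a, (sg3 a).+1).
Proof.
move=> ra; have rS : c1 d <= a < n by lia.
have ss := st_sum stS rS.
have xS : (a, sg a, sg3 a) \notin S.
  by apply/negP => xS; case: (strip_notin stS cb123 dS xS) => //=; lia.
have := @gconn_edge n S lifted_choice (a, sg a, sg3 a) ss xS.
by rewrite /lifted_choice /= ifT //=; lia.
Qed.

Lemma edgeE b : c2 d < b < n -> conn ((ep b).+1, b, ep3 b) (ep b, b, (ep3 b).+1).
Proof.
move=> rb; have rE : c2 d <= b < n by lia.
have se := st_sum stE rE; have [||le1 le3] := strip_le stE (a := b); try lia.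
have sx : ep b + b + ep3 b + 1 = n by lia.
have xS : (ep b, b, ep3 b) \notin S.
  by apply/negP => xS; case: (strip_notin stE cb213 dS xS) => //=; lia.
have := @gconn_edge n S lifted_choice (ep b, b, ep3 b) sx xS.
by rewrite /lifted_choice /= ifF ?ifT //=; lia.
Qed.

Lemma edgeW c : c3 d < c < n -> conn ((om c).+1, om2 c, c) (om c, (om2 c).+1, c).
Proof.
move=> rc; have rW : c3 d <= c < n by lia.
have sw := st_sum stW rW; have [||le1 le2] := strip_le stW (a := c); try lia.
have sx : om c + om2 c + c + 1 = n by lia.
have xS : (om c, om2 c, c) \notin S.
  by apply/negP => xS; case: (strip_notin stW cb312 dS xS) => //=; lia.
have := @gconn_edge n S lifted_choice (om c, om2 c, c) sx xS.
by rewrite /lifted_choice /= 2?ifF ?ifT //=; lia.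
Qed.

(* In each of the next three lemmas the two vertices are usually the ends of
   a strip edge; the exception occurs at [d], where they are joined through the
   third vertex with the same image. *)
Lemma fiber12 a b c : a + b + c + 1 = n -> a < n -> b + 1 < n -> c + 1 < n ->
  vertex_region (a, b, c.+1) = 1 -> vertex_region (a, b.+1, c) = 2 ->
  conn (a, b, c.+1) (a, b.+1, c).
Proof.
move=> sum lta ltb ltc; rewrite /vertex_region /=; case: (ltnP (c1 d) a) => h1.
  case: (leqP b (sg a)) => // h2 _; case: (leqP b.+1 (sg a)) => // h3 _; have rS : c1 d <= a < n by lia.
  have sS := st_sum stS rS; apply: rst_sym.
  have -> : b = sg a by lia.
  have -> : c = sg3 a by lia.
  by apply: edgeS; lia.
case: (ltnP (c2 d) b) => h2; first by case: ifP.
case: (leqP a (om c.+1)) => // h3 _.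
case: (ltnP (c2 d) b.+1) => h4; last by case: ifP.
case: (leqP a (ep b.+1)) => // h5 _.
have eb : b = c2 d by lia.
have stpE := st_step stE (leqnn (c2 d)); rewrite (st_start2 stE) (st_start3 stE) -eb in stpE.
have stpW := st_step stW (leqnn (c3 d)); rewrite (st_start2 stW) (st_start3 stW) in stpW.
have ec : c = c3 d by lia.
rewrite -ec in stpW.
have ea : a = (om c.+1).+1 /\ b = om2 c.+1 by lia.
have ea' : a = (ep b.+1).+1 /\ c = ep3 b.+1 by lia.
apply: (rst_trans _ _ _ (om c.+1, (om2 c.+1).+1, c.+1)).
  rewrite {1}(proj1 ea) {1}(proj2 ea); apply: edgeW; lia.
have -> : (om c.+1, (om2 c.+1).+1, c.+1) = (ep b.+1, b.+1, (ep3 b.+1).+1).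
  by apply: tripleP => /=; lia.
have -> : (a, b.+1, c) = ((ep b.+1).+1, b.+1, ep3 b.+1) by apply: tripleP => /=; lia.
by apply: rst_sym; apply: edgeE; lia.
Qed.

Lemma fiber01 a b c : a + b + c + 1 = n -> a + 1 < n -> b + 1 < n -> c < n ->
  vertex_region (a, b.+1, c) = 0 -> vertex_region (a.+1, b, c) = 1 ->
  conn (a, b.+1, c) (a.+1, b, c).
Proof.
move=> sum lta ltb ltc; have [h3|h3] := ltnP (c3 d) c.
  rewrite !vertex_regionW /=; try lia.
  case: (leqP a (om c)) => // ? _; case: (leqP a.+1 (om c)) => // ? _; have rW : c3 d <= c < n by lia.
  have sW := st_sum stW rW.
  have -> : (a.+1, b, c) = ((om c).+1, om2 c, c) by apply: tripleP => /=; lia.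
  have -> : (a, b.+1, c) = (om c, (om2 c).+1, c) by apply: tripleP => /=; lia.
  by apply: rst_sym; apply: edgeW; lia.
rewrite /vertex_region /=; case: (ltnP (c1 d) a) => h1; first by case: ifP.
have h2 : c2 d < b.+1 by lia.
rewrite h2; case: (leqP a (ep b.+1)) => // h5 _.
case: (ltnP (c1 d) a.+1) => h4; last first.
  have h6 : c2 d < b by lia.
  by rewrite h6; case: ifP.
case: (leqP b (sg a.+1)) => // h6 _.
have stpE := st_step stE (leqnn (c2 d)); rewrite (st_start2 stE) (st_start3 stE) in stpE.
have stpS := st_step stS (leqnn (c1 d)); rewrite (st_start2 stS) (st_start3 stS) in stpS.
have ea : a = c1 d by lia.
rewrite -ea in stpS; have rS : c1 d <= a.+1 < n by lia.
have [||ls1 ls2] := strip_le stS (a := a.+1); try lia.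
have eb : b = c2 d by lia.
rewrite -eb in stpE; have sS := st_sum stS rS; have rE : c2 d <= b.+1 < n by lia.
have sE := st_sum stE rE.
apply: (rst_trans _ _ _ ((ep b.+1).+1, b.+1, ep3 b.+1)).
  have -> : (a, b.+1, c) = (ep b.+1, b.+1, (ep3 b.+1).+1) by apply: tripleP => /=; lia.
  by apply: rst_sym; apply: edgeE; lia.
have -> : ((ep b.+1).+1, b.+1, ep3 b.+1) = (a.+1, (sg a.+1).+1, sg3 a.+1).
  by apply: tripleP => /=; lia.
have -> : (a.+1, b, c) = (a.+1, sg a.+1, (sg3 a.+1).+1) by apply: tripleP => /=; lia.
by apply: edgeS; lia.
Qed.

Lemma fiber02 a b c : a + b + c + 1 = n -> a + 1 < n -> b < n -> c + 1 < n ->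
  vertex_region (a, b, c.+1) = 0 -> vertex_region (a.+1, b, c) = 2 ->
  conn (a, b, c.+1) (a.+1, b, c).
Proof.
move=> sum lta ltb ltc; have [h2|h2] := ltnP (c2 d) b.
  rewrite !vertex_regionE /=; try lia.
  case: (leqP a (ep b)) => // ? _; case: (leqP a.+1 (ep b)) => // ? _; have rE : c2 d <= b < n by lia.
  have sE := st_sum stE rE.
  have -> : (a.+1, b, c) = ((ep b).+1, b, ep3 b) by apply: tripleP => /=; lia.
  have -> : (a, b, c.+1) = (ep b, b, (ep3 b).+1) by apply: tripleP => /=; lia.
  by apply: rst_sym; apply: edgeE; lia.
rewrite /vertex_region /=; case: (ltnP (c1 d) a) => h1; first by case: ifP.
rewrite [c2 d < b]ltnNge h2 /=; case: (leqP a (om c.+1)) => // h3 _.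
case: (ltnP (c1 d) a.+1) => h4; last by case: ifP.
case: (leqP b (sg a.+1)) => // h5 _.
have stpW := st_step stW (leqnn (c3 d)); rewrite (st_start2 stW) (st_start3 stW) in stpW.
have stpS := st_step stS (leqnn (c1 d)); rewrite (st_start2 stS) (st_start3 stS) in stpS.
have ea : a = c1 d by lia.
rewrite -ea in stpS; have rS : c1 d <= a.+1 < n by lia.
have sS := st_sum stS rS.
have [||lw1 lw2] := strip_le stW (a := c.+1); try lia.
have eb : b = c2 d by lia.
have ec : c = c3 d by lia.
rewrite -ec in stpW; have rW : c3 d <= c.+1 < n by lia.
have sW := st_sum stW rW.
apply: (rst_trans _ _ _ ((om c.+1).+1, om2 c.+1, c.+1)).
  have -> : (a, b, c.+1) = (om c.+1, (om2 c.+1).+1, c.+1) by apply: tripleP => /=; lia.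
  by apply: rst_sym; apply: edgeW; lia.
have -> : ((om c.+1).+1, om2 c.+1, c.+1) = (a.+1, sg a.+1, (sg3 a.+1).+1).
  by apply: tripleP => /=; lia.
have -> : (a.+1, b, c) = (a.+1, (sg a.+1).+1, sg3 a.+1) by apply: tripleP => /=; lia.
by apply: rst_sym; apply: edgeS; lia.
Qed.

Definition unshift (l : nat) (v : triple) : triple :=
  match l with
  | 0 => (c1 v, (c2 v).+1, (c3 v).+1)
  | 1 => ((c1 v).+1, c2 v, (c3 v).+1)
  | _ => ((c1 v).+1, (c2 v).+1, c3 v)
  end.

Lemma unshiftK l v : shift l (unshift l v) = v.
Proof. by case: v l => [[? ?] ?] [|[|l]]. Qed.

Lemma ends_unshift m l x :
  ends m (unshift l x) = (unshift l (ends m x).1, unshift l (ends m x).2).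
Proof. by case: x m l => [[? ?] ?] [|[|[|m]]] [|[|l]]. Qed.

(** All vertices glued onto [v] are connected, so it does not matter which preimage represents
    it. *)
Lemma fiber_conn l l' v : c1 v + c2 v + c3 v + 2 = n -> l < 3 -> l' < 3 ->
  vertex_region (unshift l v) = l -> vertex_region (unshift l' v) = l' ->
  conn (unshift l v) (unshift l' v).
Proof.
case: v => [[a b] c] /= sum.
suff H m m' : m < m' < 3 -> vertex_region (unshift m (a, b, c)) = m ->
    vertex_region (unshift m' (a, b, c)) = m' ->
    conn (unshift m (a, b, c)) (unshift m' (a, b, c)).
  move=> l3 l3' e e'; case: (ltngtP l l') => [lt|gt|<-]; last exact: rst_refl.
    by apply: H => //; lia.
  by apply: rst_sym; apply: H => //; lia.
case: m m' => [|[|m]] [|[|[|m']]] //=; try lia; move=> _.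
- by move=> e e'; apply: fiber01 => //; lia.
- by move=> e e'; apply: fiber02 => //; lia.
- by move=> e e'; apply: fiber12 => //; lia.
Qed.

(** A right inverse of the gluing: a region in which the preimage of [v] really lies. The strips are
    read at a successor because the preimage is one line further. *)
Definition section_region (v : triple) : nat :=
  if c1 d <= c1 v then (if c2 v <= sg (c1 v).+1 then 1 else 2)
  else if c2 d <= c2 v then (if c1 v <= ep (c2 v).+1 then 0 else 2)
  else (if c1 v <= om (c3 v).+1 then 0 else 1).

Lemma section_regionP v : c1 v + c2 v + c3 v + 2 = n ->
  section_region v < 3 /\ vertex_region (unshift (section_region v) v) = section_region v.
Proof.
case: v => [[a b] c] /= sum; rewrite /section_region /=.
case: (leqP (c1 d) a) => h1.
  case: (leqP b (sg a.+1)) => h2; split=> //; rewrite /vertex_region /= ltnS h1 ?h2 //.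
  by rewrite ifF //; lia.
case: (leqP (c2 d) b) => h2.
  case: (leqP a (ep b.+1)) => h3; split=> //; rewrite vertex_regionE /=; try lia.
    by rewrite h3.
  by rewrite ifF //; lia.
case: (leqP a (om c.+1)) => h3; split=> //; rewrite vertex_regionW /=; try lia.
  by rewrite h3.
by rewrite ifF //; lia.
Qed.

(** The analogue for triangles, with strict inequalities since the preimage has to stay off the
    strips. *)
Definition lift_region (x : triple) : nat :=
  if c1 d <= c1 x then (if c2 x < sg (c1 x).+1 then 1 else 2)
  else if c2 d <= c2 x then (if c1 x < ep (c2 x).+1 then 0 else 2)
  else (if c1 x < om (c3 x).+1 then 0 else 1).

Lemma lift_regionP x : c1 x + c2 x + c3 x + 3 = n ->
  let y := unshift (lift_region x) x in
  [/\ lift_region x < 3, cell_region y = lift_region x, y <> d & off_strips y].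
Proof.
case: x => [[a b] c] /= sum.
have leS i : c1 d < i < n -> sg i <= c2 d /\ i + sg i + sg3 i + 1 = n.
  move=> ri; have rS : c1 d <= i < n by lia.
  have [||? _] := strip_le stS (a := i); try lia.
  by have := st_sum stS rS; lia.
have leE j : c2 d < j < n -> ep j <= c1 d /\ j + ep j + ep3 j + 1 = n.
  move=> rj; have rE : c2 d <= j < n by lia.
  have [||? _] := strip_le stE (a := j); try lia.
  by have := st_sum stE rE; lia.
have leW k : c3 d < k < n -> [/\ om k <= c1 d, om2 k <= c2 d & k + om k + om2 k + 1 = n].
  move=> rk; have rW : c3 d <= k < n by lia.
  have [||? ?] := strip_le stW (a := k); try lia.
  by have := st_sum stW rW; split; lia.
rewrite /lift_region /=; case: (leqP (c1 d) a) => h1.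
  case: (ltnP b (sg a.+1)) => h2; split=> //=.
  - by rewrite /cell_region /= ltnS h1 h2.
  - by move=> e; rewrite -e /= in h1; lia.
  - split=> /= *; first by lia.
      by have [|? _] := leE b; lia.
    by have [|? _ _] := leW c.+1; lia.
  - by rewrite /cell_region /= ltnS h1 ifF //; lia.
  - by move=> e; rewrite -e /= in h1; lia.
  - split=> /= *; first by lia.
      by have [|? _] := leE b.+1; lia.
    by have [|? _ _] := leW c; lia.
case: (leqP (c2 d) b) => h2.
  case: (ltnP a (ep b.+1)) => h3; split=> //=.
  - by rewrite cell_regionE /= ?h3; lia.
  - by move=> e; rewrite -e /= in h2; lia.
  - split=> /= *; [by lia..|].
    by have [|? ? ?] := leW c.+1; lia.
  - by rewrite cell_regionE /= ?ifF //; lia.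
  - by move=> e; rewrite -e /= in h2; lia.
  - split=> /= *; [by lia..|].
    by have [|? ? ?] := leW c; lia.
case: (ltnP a (om c.+1)) => h3; split=> //=.
- by rewrite cell_regionW /= ?h3; lia.
- by move=> e; rewrite -e /= in h1 h2; lia.
- by split=> /= *; lia.
- by rewrite cell_regionW /= ?ifF //; lia.
- by move=> e; rewrite -e /= in h1 h2; lia.
- by split=> /= *; lia.
Qed.

(** The preimage of the triangle copies its edge inside one region; both ends are then moved to the
    chosen preimages within their fibers. *)
Lemma section_edge x : c1 x + c2 x + c3 x + 3 = n -> x \notin reduced ->
  conn (unshift (section_region (ends (ch' x) x).1) (ends (ch' x) x).1)
       (unshift (section_region (ends (ch' x) x).2) (ends (ch' x) x).2).
Proof.
move=> sx xS; have [l3 ry yd oy] := lift_regionP sx.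
move: (lift_region x) l3 ry yd oy => l l3 ry yd oy; set y := unshift l x in ry yd oy.
have sy : c1 y + c2 y + c3 y + 1 = n.
  by rewrite /y; case: (l) l3 => [|[|[|]]] //= _; lia.
have yS : y \notin S.
  apply: contra xS => yS; apply/mapP; exists y.
    by rewrite (mem_rem_uniq _ (cb_uniq cb123)) inE yS andbT; apply/eqP.
  by rewrite ry /y unshiftK.
have chy : lifted_choice y = ch' x.
  have [oS oE oW] := oy; rewrite /lifted_choice.
  rewrite ifF; last by apply/negP => /andP[/oS ? /eqP].
  rewrite ifF; last by apply/negP => /andP[/oE ? /eqP].
  rewrite ifF; last by apply/negP => /andP[/oW ? /eqP].
  by rewrite ry /y unshiftK.
have := gconn_edge lifted_choice sy yS; rewrite chy.
have [v1 v2] := vertices_region (ch' x) sy yd oy; move: v1 v2.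
rewrite ry /y ends_unshift /=.
have [s1 s2] : c1 (ends (ch' x) x).1 + c2 (ends (ch' x) x).1 + c3 (ends (ch' x) x).1 + 2 = n /\
   c1 (ends (ch' x) x).2 + c2 (ends (ch' x) x).2 + c3 (ends (ch' x) x).2 + 2 = n.
  by case: (x) sx => [[? ?] ?]; case: (ch' _) => [|[|[|m]]] /=; lia.
case: (ends _ x) s1 s2 => u v /= su sv vu vv cuv.
have [lu ru] := section_regionP su; have [lv rv] := section_regionP sv.
apply: rst_trans (fiber_conn su lu l3 ru vu) _.
by apply: rst_trans cuv (fiber_conn sv l3 lv vv rv).
Qed.

Lemma top_region b c : 0 < b -> 0 < c -> b + c = n -> vertex_region (0, b, c) = 0.
Proof.
move=> b0 c0 sum; rewrite /vertex_region ltn0 /=; by case: (ltnP (c2 d) b).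
Qed.

Lemma left_region a c : 0 < a -> 0 < c -> a + c = n -> vertex_region (a, 0, c) = 1.
Proof.
move=> a0 c0 sum; have [lt|le] := ltnP (c1 d) a; first by rewrite /vertex_region /= lt.
have rW : c3 d <= c < n by lia.
have sW := st_sum stW rW.
by rewrite vertex_regionW /= ?ifF //; lia.
Qed.

Lemma right_region a b : 0 < a -> 0 < b -> a + b = n -> vertex_region (a, b, 0) = 2.
Proof.
move=> a0 b0 sum; have [lt|le] := ltnP (c1 d) a.
  have rS : c1 d <= a < n by lia.
  by have sS := st_sum stS rS; rewrite /vertex_region /= lt ifF //; lia.
have rE : c2 d <= b < n by lia.
have sE := st_sum stE rE.
by rewrite vertex_regionE /= ?ifF //; lia.
Qed.

Lemma region_unshift v : c1 v + c2 v + c3 v = n -> c1 v < n -> c2 v < n -> c3 v < n ->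
  exists l v', [/\ l < 3, vertex_region v = l, v = unshift l v' &
    c1 v' + c2 v' + c3 v' + 2 = n].
Proof.
move=> sv lt1 lt2 lt3.
have posE : c2 d < c2 v -> c1 v <= ep (c2 v) -> 0 < c3 v.
  move=> lt le; have rE : c2 d <= c2 v < n by lia.
  by have := st_sum stE rE; lia.
have posW : c3 d < c3 v -> c1 v <= om (c3 v) -> 0 < c2 v.
  move=> lt le; have rW : c3 d <= c3 v < n by lia.
  by have := st_sum stW rW; lia.
have posS : c1 d < c1 v -> c2 v <= sg (c1 v) -> 0 < c3 v.
  move=> lt le; have rS : c1 d <= c1 v < n by lia.
  by have := st_sum stS rS; lia.
suff [l [l3 rl pl]] : exists l, [/\ l < 3, vertex_region v = l &
    match l with 0 => 0 < c2 v /\ 0 < c3 v | 1 => 0 < c1 v /\ 0 < c3 v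
    | _ => 0 < c1 v /\ 0 < c2 v end].
  exists l, (shift l v); case: l l3 rl pl => [|[|[|]]] //= _ rl pl; split=> //; try lia;
    by apply: tripleP => /=; lia.
rewrite /vertex_region; case: (ltnP (c1 d) (c1 v)) => h1.
  case: (leqP (c2 v) (sg (c1 v))) => h2; [exists 1 | exists 2]; split=> //; last by lia.
  by split; [lia | exact: posS].
case: (ltnP (c2 d) (c2 v)) => h2.
  case: (leqP (c1 v) (ep (c2 v))) => h3; [exists 0 | exists 2]; split=> //; last by lia.
  by split; [lia | exact: posE].
case: (leqP (c1 v) (om (c3 v))) => h3; [exists 0 | exists 1]; split=> //; last by lia.
by split; [apply: posW; lia | lia].
Qed.

End Reduction.

Lemma solvable_reduced n S d sg sg3 ep ep3 om om2 :
  2 <= n -> balanced n S -> d \in S ->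
  strip S false c1 c2 c3 n d sg sg3 -> strip S true c2 c1 c3 n d ep ep3 ->
  strip S false c3 c1 c2 n d om om2 ->
  solvable (n - 2) (reduced S d sg ep om) -> solvable n S.
Proof.
move=> n_ge2 bal dS stS stE stW [ch' [cb' pat']].
pose ch := lifted_choice d sg ep om ch'.
pose psi v := unshift (section_region d sg ep om v) v.
have psi_conn u v : gconn (n - 2) (reduced S d sg ep om) ch' u v ->
    gconn n S ch (psi u) (psi v).
  apply: gconn_map => x sx xS.
  have sx' : c1 x + c2 x + c3 x + 3 = n by lia.
  exact: (section_edge n_ge2 bal dS stS stE stW ch' sx' xS).
have psiE l v : c1 v + c2 v + c3 v + 2 = n -> l < 3 ->
    vertex_region d sg ep om (unshift l v) = l -> gconn n S ch (unshift l v) (psi v).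
  move=> sv l3 rl; have [l3' rl'] := section_regionP n_ge2 bal dS stS stE stW sv.
  exact: (fiber_conn n_ge2 bal dS stS stE stW).
have lift l l' u v : c1 u + c2 u + c3 u + 2 = n -> c1 v + c2 v + c3 v + 2 = n ->
    l < 3 -> l' < 3 -> vertex_region d sg ep om (unshift l u) = l ->
    vertex_region d sg ep om (unshift l' v) = l' ->
    gconn (n - 2) (reduced S d sg ep om) ch' u v ->
    gconn n S ch (unshift l u) (unshift l' v).
  move=> su sv l3 l3' rl rl' /psi_conn cuv; apply: rst_trans (psiE _ _ su l3 rl) _.
  by apply: rst_trans cuv _; apply: rst_sym; exact: psiE.
have topR b c : b + c + 2 = n -> vertex_region d sg ep om (unshift 0 (0, b, c)) = 0.
  by move=> sum; apply: (@top_region n) => /=; lia.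
have leftR a c : a + c + 2 = n -> vertex_region d sg ep om (unshift 1 (a, 0, c)) = 1.
  by move=> sum; apply: (left_region n_ge2 bal dS stS stE stW) => /=; lia.
have rightR a b : a + b + 2 = n -> vertex_region d sg ep om (unshift 2 (a, b, 0)) = 2.
  by move=> sum; apply: (right_region om n_ge2 bal dS stS stE) => /=; lia.
exists ch; split=> [v sv|[|k] lek].
(* The three corners have no counterpart in size n - 2, but they are boundary vertices
   themselves. *)
- have [/and3P[lt1 lt2 lt3]|corner] := boolP [&& c1 v < n, c2 v < n & c3 v < n]; last first.
    by exists v; [rewrite /boundary sv eqxx /=; lia | exact: rst_refl].
  have [l [v' [l3 rv ev sv']]] := region_unshift n_ge2 bal dS stS stE stW sv lt1 lt2 lt3.
  rewrite ev in rv *; have [|[[a b] c] bw cvw] := cb' v'; first by lia.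
  have [sw bnd] := andP bw; rewrite /= in sw bnd.
  have sw' : a + b + c + 2 = n by lia.
  have [a0|a0] := eqVneq a 0.
    subst a; exists (unshift 0 (0, b, c)); first by rewrite /boundary /=; lia.
    by apply: lift => //; exact: topR.
  have [b0|b0] := eqVneq b 0.
    subst b; exists (unshift 1 (a, 0, c)); first by rewrite /boundary /=; lia.
    by apply: lift => //; apply: leftR; lia.
  have c0 : c = 0 by lia.
  subst c; exists (unshift 2 (a, b, 0)); first by rewrite /boundary /=; lia.
  by apply: lift => //; apply: rightR; lia.
- by rewrite subn0; split; exact: rst_refl.
(* The connections for k + 1 are the lifts of those for k: the vertices of each side other than the
   corners lie in the region of that side. *)
- have [|p1 p2 p3] := pat' k; first by lia.
  have e : n - k.+1 = (n - 2 - k).+1 by lia.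
  have sum : n - 2 - k + k + 2 = n by lia.
  rewrite e; split.
  + by apply: (lift 0 1 _ _ _ _ _ _ _ _ p1) => /=; try lia; [apply: topR | apply: leftR]; lia.
  + by apply: (lift 0 2 _ _ _ _ _ _ _ _ p2) => /=; try lia; [apply: topR | apply: rightR]; lia.
  + by apply: (lift 1 2 _ _ _ _ _ _ _ _ p3) => /=; try lia; [apply: leftR | apply: rightR]; lia.
Qed.

(** * Sliding the ones of a saturated set of rows *)

(* [x] can slide by one row along its [p3]-line. *)
Definition movable (T : eqType) (S : seq T) (p1 p2 p3 : T -> nat) n x :=
  cpre S p2 (p2 x) <> p2 x /\ forall X Z, (p1 x).+1 < X -> p3 x < Z ->
    ctri S p1 p2 p3 X (p2 x) Z + n + 1 <> X + p2 x + Z.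

(** Only a set containing [y] but not [x] can gain a one; its bound on [p2] is then exactly [p2 x],
    which is what [movable] controls. *)
Lemma movable_bounds (T : eqType) (S : seq T) (p1 p2 p3 : T -> nat) n x y :
  convex_bounds S p1 p2 p3 n -> x \in S -> movable S p1 p2 p3 n x ->
  p1 y = (p1 x).+1 -> (p2 y).+1 = p2 x -> p3 y = p3 x ->
  convex_bounds (y :: rem x S) p1 p2 p3 n.
Proof.
move=> cb xS [npre ntri] y1 y2 y3.
have cnt P : count P (y :: rem x S) + P x = P y + count P S.
  by rewrite /= (count_remD P xS); lia.
split.
- move=> z; rewrite inE => /orP[/eqP->|/mem_rem/(cb_sum cb)//].
  by have := cb_sum cb xS; lia.
- move=> m; have := cnt (fun z => p1 z < m); have := cb_pre1 cb m; rewrite /cpre; lia.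
- move=> m; have := cnt (fun z => p2 z < m); have le := cb_pre2 cb m.
  have [<-|ne] := eqVneq (p2 x) m; last by rewrite /cpre in le *; lia.
  by have := cb_pre2 cb (p2 x); rewrite /cpre in npre le *; lia.
- move=> m; have := cnt (fun z => p3 z < m); have := cb_pre3 cb m; rewrite /cpre; lia.
- move=> X Y Z leXYZ; have := cnt (fun z => [&& p1 z < X, p2 z < Y & p3 z < Z]).
  have le := cb_tri cb leXYZ; rewrite /ctri in le *.
  have [lt|ge] := boolP [&& (p1 x).+1 < X, p2 x == Y & p3 x < Z]; last by lia.
  have [ltX /eqP eY ltZ] := and3P lt.
  by have := ntri X Z ltX ltZ; rewrite /ctri eY; lia.
Qed.

(** The obstacles are those of a strip standing at [x], where admissibility is trivial, so they
    uncross. Two saturated sets of lines are excluded by the saturated rows and the total number of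
    ones. *)
Lemma movable_or (T : eqType) (S : seq T) (p1 p2 p3 : T -> nat) n m x :
  convex_bounds S p1 p2 p3 n -> 2 * size S <= n.+1 -> x \in S ->
  cpre S p1 m = m -> (p1 x).+1 < m ->
  movable S p1 p2 p3 n x \/ movable S p1 p3 p2 n x.
Proof.
move=> cb szS xS tight ltm; have sx := cb_sum cb xS.
have adm : admissible S false p1 p2 p3 n x (p1 x) (p2 x) (p3 x).
  by split=> [X Y Z _ //|Y _|Z _]; lia.
pose btri q2 q3 := exists X Z, [/\ ctri S p1 q2 q3 X (q2 x) Z + n + 1 = X + q2 x + Z,
  p1 x + 1 < X & q3 x < Z].
have mv q2 q3 : ~ (btri q2 q3 \/ cpre S q2 (q2 x) = q2 x) -> movable S p1 q2 q3 n x.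
  move=> nb; split=> [e|X Z ltX ltZ e]; first by apply: nb; right.
  by apply: nb; left; exists X, Z; split=> //; lia.
have [bl2|/mv] := classic (btri p2 p3 \/ cpre S p2 (p2 x) = p2 x); last by left.
have [bl3|/mv] := classic (btri p3 p2 \/ cpre S p3 (p3 x) = p3 x); last by right.
have sx' : p1 x + p3 x + p2 x + 1 = n by lia.
exfalso; case: bl2 bl3 => [[X [Z [tA ltX ltZ]]]|tA] [[X' [Y [tB ltX' ltY]]]|tB].
- apply: (uncross_tri_tri cb xS adm sx _ _ tA ltX ltZ _ ltX' ltY) => //.
  by rewrite ctriC; lia.
- by apply: (uncross_tri_pre cb xS adm sx _ _ tA ltX ltZ tB).
- by apply: (uncross_tri_pre (convex_boundsC cb) xS (admissibleC adm) sx' _ _ tB ltX' ltY tA).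
(* Three sets of saturated lines: each one of [S] satisfies indicator sum <= 2 + indicator of the
   common triangle, strictly at [x], which lies in the rows only. Summing, and bounding the
   triangle, gives n + 1 < 2 |S|. *)
- have := @cb_tri _ _ _ _ _ _ cb m (p2 x) (p3 x).
  have ptw : {in S, forall y, (p1 y < m) + ((p2 y < p2 x) + (p3 y < p3 x)) <=
      2 + [&& p1 y < m, p2 y < p2 x & p3 y < p3 x]} by move=> y _; lia.
  have : count (fun y => p1 y < m) S + (count (fun y => p2 y < p2 x) S +
       count (fun y => p3 y < p3 x) S) < size S + (size S + ctri S p1 p2 p3 m (p2 x) (p3 x)).
    rewrite /ctri; elim: (S) xS ptw => //= y s IH; rewrite inE => yx H.
    have Hy := H y (mem_head _ _).
    have Hs : {in s, forall y, (p1 y < m) + ((p2 y < p2 x) + (p3 y < p3 x)) <=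
      2 + [&& p1 y < m, p2 y < p2 x & p3 y < p3 x]}.
      by move=> z zs; apply: H; rewrite inE zs orbT.
    case/orP: yx => [/eqP e|/IH/(_ Hs)]; last by lia.
    have : count (fun y => p1 y < m) s + (count (fun y => p2 y < p2 x) s +
       count (fun y => p3 y < p3 x) s) <= size s + (size s + 
       count (fun y => [&& p1 y < m, p2 y < p2 x & p3 y < p3 x]) s).
      elim: (s) Hs => //= z s' IH' H'.
      have := H' z (mem_head _ _).
      by have := IH' (fun y ys => H' y (mem_behead (s := z :: s') ys)); lia.
    by rewrite e; lia.
  by rewrite /cpre in tight tA tB *; lia.
Qed.

Definition row (S : seq triple) (r : nat) : seq nat := [seq c2 x | x <- S & c1 x == r].

Lemma rowP S r b :
  reflect (exists2 x, x \in S & c1 x = r /\ c2 x = b) (b \in row S r).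
Proof.
apply: (iffP mapP) => [[x]|[x xS [e1 e2]]].
  by rewrite mem_filter => /andP[/eqP e1 xS] ->; exists x.
by exists x; rewrite ?mem_filter ?xS ?e1 ?eqxx.
Qed.

(** [P] ranges over the sets that a one cannot leave when it slides within the first m rows.
    Saturated columns, and their intersection with these rows, are such sets. *)
Definition pushes (m : nat) (S S' : seq triple) := forall P : pred triple,
  (forall x y, c1 y < m -> c2 y <= c2 x -> c3 y <= c3 x -> P x -> P y) ->
  count P S <= count P S'.

(** [mv] lists the slides as pairs of second coordinates, in row r and in row r + 1: equal ones when
    the third coordinate drops instead. *)
Record row_slide n m r (S S' : seq triple) (mv : seq (nat * nat)) : Prop := RowSlide {
  rs_balanced : balanced n S';
  rs_src : uniq (map fst mv);
  rs_dst : uniq (map snd mv);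
  rs_step : forall e, e \in mv -> e.2 = e.1 \/ e.2.+1 = e.1;
  rs_row : row S r =i map fst mv;
  rs_next : row S' r.+1 =i [predU row S r.+1 & map snd mv];
  rs_disjoint : forall b, b \in map snd mv -> b \notin row S r.+1;
  rs_empty : row S' r = [::];
  rs_other : forall x, c1 x != r -> c1 x != r.+1 -> (x \in S') = (x \in S);
  rs_pushes : pushes m S S'
}.

(** The ones slide one at a time, because every move changes the saturated sets that decide the
    direction of the next. *)
Lemma row_slide_exists n m r S :
  balanced n S -> cpre S c1 m = m -> r.+1 < m ->
  exists S' mv, row_slide n m r S S' mv.
Proof.
move: {2}(size _) (leqnn (size (row S r))) => q; elim: q S => [|q IH] S leq bal tight ltm.
  have e0 : row S r = [::] by apply: size0nil; lia.
  exists S, [::]; split=> // x; first by rewrite e0.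
  by rewrite !inE orbF.
have [bds szS] := bal.
have [e0|] := eqVneq (row S r) [::]; first by apply: IH => //; rewrite e0.
rewrite -size_eq0 -lt0n => gt0.
have : head 0 (row S r) \in row S r by case: row gt0 => //= *; rewrite inE eqxx.
case/rowP => x xS [ex _].
have szS2 : 2 * size S <= n.+1 by rewrite szS uphalf_half; lia.
have ltx : (c1 x).+1 < m by rewrite ex.
have sx := cb_sum bds xS.
have [y [y1 y23 bds1]] : exists y, [/\ c1 y = r.+1,
     (c2 y).+1 = c2 x /\ c3 y = c3 x \/ c2 y = c2 x /\ (c3 y).+1 = c3 x &
     convex_bounds (y :: rem x S) c1 c2 c3 n].
  have [mv|mv] := movable_or bds szS2 xS tight ltx.
    have gt : 0 < c2 x.
      by case: mv => h _; have := cb_pre2 bds 0; case: (c2 x) h => // h; lia.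
    exists (r.+1, (c2 x).-1, c3 x); split=> //=; first by left; lia.
    by apply: (movable_bounds bds xS mv) => /=; rewrite ?ex; lia.
  have gt : 0 < c3 x.
    by case: mv => h _; have := cb_pre3 bds 0; case: (c3 x) h => // h; lia.
  exists (r.+1, c2 x, (c3 x).-1); split=> //=; first by right; lia.
  by apply/convex_boundsC/(movable_bounds (convex_boundsC bds) xS mv) => /=; rewrite ?ex; lia.
have cnt (P : pred triple) : count P (y :: rem x S) + P x = P y + count P S.
  by rewrite /= (count_remD P xS) -addnA [_ + P x]addnC.
have uS := cb_uniq bds; have := cb_uniq bds1; rewrite /= => /andP[yr ur].
have rows i : size (row (y :: rem x S) i) + (c1 x == i) = (c1 y == i) + size (row S i).
  by rewrite /row !size_map !size_filter; exact: cnt (fun z => c1 z == i).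
have yS : y \notin S.
  apply: contra yr => yS; rewrite mem_rem_uniq // inE yS andbT.
  by apply/eqP => e; rewrite -ex e in y1; lia.
have [|||//|S' [mv rs]] := IH (y :: rem x S).
- by have := rows r; rewrite ex y1 eqxx; lia.
- by split=> //=; rewrite size_rem // -szS; case: (S) xS.
- have e : cpre (y :: rem x S) c1 m + (c1 x < m) = (c1 y < m) + cpre S c1 m := cnt _.
  by rewrite tight in e; lia.
have inj z z' : z \in S -> z' \in S -> c1 z = c1 z' -> c2 z = c2 z' -> z = z'.
  by move=> /(cb_sum bds) ? /(cb_sum bds) ? ? ?; apply: tripleP => //; lia.
have row1 b : (b \in row S r) = (b == c2 x) || (b \in map fst mv).
  rewrite -(rs_row rs); apply/rowP/orP => [[z zS [z1 <-]]|].
    have [->|ne] := eqVneq z x; [by left | right].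
    by apply/rowP; exists z; rewrite // inE mem_rem_uniq // inE ne zS orbT.
  case=> [/eqP->|/rowP[z]]; first by exists x.
  rewrite inE => /orP[/eqP->|/mem_rem zS] [z1 z2]; first by lia.
  by exists z.
have row2 b : (b \in row (y :: rem x S) r.+1) = (b == c2 y) || (b \in row S r.+1).
  apply/rowP/orP => [[z]|].
    rewrite inE => /orP[/eqP->|/mem_rem zS] [z1 <-]; [by left | right].
    by apply/rowP; exists z.
  case=> [/eqP->|/rowP[z zS [z1 z2]]]; first by exists y; rewrite ?mem_head.
  exists z; rewrite // inE mem_rem_uniq // inE zS andbT.
  by rewrite (_ : z != x) ?orbT //; apply/eqP => e; rewrite -ex e in z1; lia.
have xm : c2 x \notin map fst mv.
  rewrite -(rs_row rs); apply/negP => /rowP[z].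
  rewrite inE => /orP[/eqP->|zr] [z1 z2]; first by lia.
  have ez : z = x by apply: inj => //; [exact: mem_rem zr | lia].
  by move: zr; rewrite ez mem_rem_uniq // inE eqxx.
exists S', ((c2 x, c2 y) :: mv); split.
- exact: rs_balanced rs.
- by rewrite /= xm (rs_src rs).
- rewrite /= (rs_dst rs) andbT; apply/negP => /(rs_disjoint rs).
  by rewrite row2 eqxx.
- by move=> e; rewrite inE => /orP[/eqP->|/(rs_step rs)//] /=; lia.
- by move=> b; rewrite row1 inE.
- move=> b; rewrite (rs_next rs) !inE row2; by do ![case: (_ == _) => //=|case: (_ \in _) => //=].
- move=> b; rewrite inE => /orP[/eqP->|/(rs_disjoint rs)]; last by rewrite row2 negb_or => /andP[].
  apply: contra yS => /rowP[z zS [z1 z2]].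
  have -> // : y = z.
  have sz := cb_sum bds zS; have := cb_sum bds1 (mem_head y _); move=> sy.
  by rewrite /= in z2; apply: tripleP; lia.
- exact: rs_empty rs.
- move=> z z1 z2; rewrite (rs_other rs) // inE mem_rem_uniq // inE.
  have [e|_] := eqVneq z y; first by rewrite e y1 eqxx in z2.
  by have [e|//] := eqVneq z x; rewrite e ex eqxx in z1.
- move=> P dP; apply: leq_trans (rs_pushes rs dP).
  have := cnt P; have := dP x y; case: (P x); case: (P y) => //; lia.
Qed.

(** * Rebuilding the rows above a saturated line *)

(* [M] labels the attached vertices of a row; the vertices of the row above take
   the label of the last attached vertex on their left up to [beta], and of the
   first one on their right beyond. *)
Section Labels.
Variables (N lo hi : nat) (J W : pred nat) (M : nat -> nat) (beta : nat).
Hypothesis M_mono : forall a b, a <= b -> b < N -> ~~ W a -> ~~ W b -> M a <= M b.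
Hypothesis M_range : forall a, a < N -> ~~ W a -> lo < M a < hi.
Hypothesis M_surj : forall l, lo < l < hi -> exists2 a, a < N & ~~ W a /\ M a = l.
Hypothesis lo_le : lo <= hi.
Hypothesis J_sub : forall b, J b -> W b.
Hypothesis beta_lt : beta < N.
Hypothesis betaP : J beta \/ (~~ W beta /\ exists2 g, beta < g < N & ~~ W g /\ M g = M beta).

Fixpoint label_left b :=
  if b is a.+1 then if W a then label_left a else M a else lo.

Fixpoint label_right_from k :=
  if k is j.+1 then if W (N - k) then label_right_from j else M (N - k) else hi.

Let label_right b := label_right_from (N - b).

Let rightE b : b < N -> label_right b = if W b then label_right b.+1 else M b.
Proof.
move=> ltb; rewrite /label_right; have -> : N - b = (N - b.+1).+1 by lia.
by rewrite /= (_ : N - (N - b.+1).+1 = b) //; lia.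
Qed.

Let left_spec b : b <= N ->
  label_left b = lo \/ exists2 a, a < b & ~~ W a /\ label_left b = M a.
Proof.
elim: b => [|b IH] ltb /=; first by left.
case: ifP => Wb; last by right; exists b; rewrite // Wb.
by have [|->|[a lta ha]] := IH; [lia | left | right; exists a; [lia|]].
Qed.

Let right_spec b : b <= N ->
  label_right b = hi \/ exists2 a, b <= a < N & ~~ W a /\ label_right b = M a.
Proof.
move=> leb; rewrite -(subKn leb); move: (N - b) (leq_subr b N) => k.
elim: k => [|k IH] lek; first by left; rewrite /label_right subn0 subnn.
rewrite rightE; last by lia.
case: ifP => Wb; last by right; exists (N - k.+1); rewrite ?Wb //; lia.
have -> : (N - k.+1).+1 = N - k by lia.
by have [|->|[a lta ha]] := IH; [lia | left | right; exists a; [lia|]].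
Qed.

Let left_ge a b : a < b -> b <= N -> ~~ W a -> M a <= label_left b.
Proof.
elim: b => // b IH ltab leb nW /=; case: ifP => Wb.
  have [e|ne] := eqVneq a b; first by rewrite e Wb in nW.
  by apply: IH => //; lia.
by apply: M_mono; rewrite ?Wb //; lia.
Qed.

Let right_le a b : b <= a -> a < N -> ~~ W a -> label_right b <= M a.
Proof.
move=> leba lta nW; have leb : b <= N by lia.
move: leba; rewrite -(subKn leb); move: (N - b) (leq_subr b N) => k.
elim: k => [|k IH] lek leka; first by lia.
rewrite rightE; last by lia.
case: ifP => Wb; last by apply: M_mono; rewrite ?Wb //; lia.
have -> : (N - k.+1).+1 = N - k by lia.
apply: IH; first by lia.
by have [e|ne] := eqVneq (N - k.+1) a; [rewrite e (negbTE nW) in Wb | lia].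
Qed.

Let label b := if b <= beta then label_left b else label_right b.

(** Left labels serve an attached vertex b through [F b.+1], right labels through [F b]. The change
    of rule at [beta] is harmless: either a one there requires no edge, or the label of [beta]
    occurs again further right, so that the right rule gives it at [beta.+1]. *)
Lemma labels_exist : exists F : nat -> nat,
  [/\ forall a b, a <= b -> b <= N -> F a <= F b,
      F 0 = lo /\ F N = hi,
      forall l, lo <= l <= hi -> exists2 b, b <= N & F b = l,
      forall b, b < N -> ~~ W b -> M b = F b \/ M b = F b.+1 &
      forall b, b < N -> W b -> ~~ J b -> F b = F b.+1].
Proof.
have lo_left b : b <= N -> lo <= label_left b <= hi.
  by move=> leb; have [->|[a lta [nW ->]]] := left_spec leb; [lia | have := @M_range _ _ nW; lia].
have right_hi b : b <= N -> lo <= label_right b <= hi.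
  by move=> leb; have [->|[a lta [nW ->]]] := right_spec leb; [lia | have := @M_range _ _ nW; lia].
have mono_left a b : a <= b -> b <= N -> label_left a <= label_left b.
  move=> leab leb; have lea : a <= N by lia.
  have [->|[c ltc [nW ->]]] := left_spec lea; first by have := lo_left b leb; lia.
  by apply: left_ge => //; lia.
have mono_right a b : a <= b -> b <= N -> label_right a <= label_right b.
  move=> leab leb; have [->|[c ltc [nW ->]]] := right_spec leb; first by have := right_hi a; lia.
  by apply: right_le => //; lia.
have mid a b : a <= b -> b <= N -> label_left a <= label_right b.
  move=> leab leb; have [->|[c ltc [nW ->]]] := right_spec leb; first by have := lo_left a; lia.
  have lea : a <= N by lia.
  have [->|[c' ltc' [nW' ->]]] := left_spec lea; last by apply: M_mono => //; lia.
  by have := @M_range c; lia.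
have labelN : label N = hi by rewrite /label leqNgt beta_lt /= /label_right subnn.
have stepA b : b < N -> ~~ W b -> M b = label b \/ M b = label b.+1.
  move=> ltb nW; rewrite /label; case: (ltngtP b beta) => cmp.
  - by right; rewrite /= (negbTE nW).
  - by left; rewrite rightE // (negbTE nW).
  - right; rewrite cmp in nW *.
    case: betaP => [/J_sub|[nWb [g ltg [nWg eg]]]]; first by rewrite (negbTE nW).
    have ge : label_right beta.+1 <= M beta by rewrite -eg; apply: right_le => //; lia.
    suff : M beta <= label_right beta.+1 by lia.
    have [|->|[a lta [nWa ->]]] := @right_spec beta.+1; first by lia.
      by have := M_range beta_lt nWb; lia.
    by apply: M_mono => //; lia.
exists label; split.
- move=> a b leab leb; rewrite /label; case: (leqP a beta) => ha; case: (leqP b beta) => hb; try lia.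
  + exact: mono_left.
  + exact: mid.
  + exact: mono_right.
- by split=> //; rewrite /label.
- move=> l rl; have [->|ne] := eqVneq l lo; first by exists 0.
  have [->|ne'] := eqVneq l hi; first by exists N.
  have [|a lta [nW <-]] := @M_surj l; first by lia.
  by have [e|e] := stepA a lta nW; [exists a | exists a.+1] => //; lia.
- exact: stepA.
- move=> b ltb Wb nJ; rewrite /label; case: (ltngtP b beta) => cmp.
  + by rewrite /= Wb.
  + by rewrite rightE // Wb.
  + by case: betaP => [|[]]; rewrite -cmp ?Wb ?(negbTE nJ).
Qed.

End Labels.

Lemma repeated_label (N lo hi : nat) (s : seq nat) (M : nat -> nat) :
  (forall a, a < N -> a \notin s -> lo < M a < hi) -> lo < hi -> N + lo >= size s + hi ->
  exists a b, [/\ a < b < N, a \notin s, b \notin s & M b = M a].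
Proof.
move=> rng lt_hi sz; apply: NNPP => none.
pose A := [seq a <- iota 0 N | a \notin s].
have AP a : a \in A -> a < N /\ a \notin s by rewrite mem_filter mem_iota => /andP[-> ?]; lia.
have szA : N <= size A + size s.
  rewrite -[leqLHS](size_iota 0) -(count_predC (mem s) (iota 0 N)) -!size_filter addnC.
  apply: leq_add => //; apply: uniq_leq_size; first exact: filter_uniq (iota_uniq _ _).
  by move=> a; rewrite mem_filter => /andP[].
have uM : uniq (map M A).
  rewrite map_inj_in_uniq ?filter_uniq ?iota_uniq // => a b /AP[lta na] /AP[ltb nb] e.
  case: (ltngtP a b) => // lt; case: none.
    by exists a, b; split; rewrite ?lt.
  by exists b, a; split; rewrite ?lt.
have sub : {subset map M A <= iota lo.+1 (hi - lo.+1)}.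
  by move=> _ /mapP[a /AP[lta na] ->]; have := rng a lta na; rewrite mem_iota; lia.
have szM : size A <= hi - lo.+1.
  by rewrite -(size_map M) -(size_iota lo.+1 (hi - lo.+1)); exact: uniq_leq_size uM sub.
by lia.
Qed.

Lemma uniq_map_inj (T U : eqType) (f : T -> U) (s : seq T) :
  uniq (map f s) -> {in s &, injective f}.
Proof.
elim: s => //= x s IH /andP[nx us] y z; rewrite !inE.
case/orP=> [/eqP->|ys] /orP[/eqP->|zs] // e; last exact: IH.
  by rewrite e map_f in nx.
by rewrite -e map_f in nx.
Qed.

(* The ones of a row that slide to the right pass their vertex on to the next
   vertex on the right, the others to the next one on the left. *)
Lemma slide_escape N (mv : seq (nat * nat)) (R : nat -> nat -> Prop) :
  uniq (map snd mv) -> (forall e, e \in mv -> e.2 = e.1 \/ e.2.+1 = e.1) ->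
  (forall e, e \in mv -> e.1 <= N /\ e.2 < N) ->
  (forall u, R u u) -> (forall u v, R u v -> R v u) ->
  (forall u v w, R u v -> R v w -> R u w) ->
  (forall e, e \in mv -> R e.2 e.2.+1) ->
  forall u, u <= N -> exists v, [/\ v <= N, v \notin map fst mv & R u v].
Proof.
move=> /uniq_map_inj inj stp bnd rfl sy tr Rmv.
have right u : u <= N -> (u, u) \in mv -> exists v, [/\ v <= N, v \notin map fst mv & R u v].
  move=> leu; rewrite -(subKn leu); move: (N - u) (leq_subr u N) => k.
  elim: k => [|k IH] lek umv; first by case: (bnd _ umv) => /=; lia.
  have Ru := Rmv _ umv; rewrite /= in Ru; have ek : (N - k.+1).+1 = N - k by lia.
  rewrite ek in Ru; have [/mapP[[w w'] wmv /= ew]|nin] := boolP (N - k \in map fst mv); last first.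
    by exists (N - k); split=> //; lia.
  case: (stp _ wmv) => /= ew'.
    have [|//|v [lev nv Rv]] := IH; first by lia.
      by rewrite ew -{2}ew'.
    by exists v; split=> //; exact: tr Ru Rv.
  have /(inj _ _ umv wmv)[] : (N - k.+1, N - k.+1).2 = (w, w').2 by move=> /=; lia.
  by lia.
have left u : u <= N -> (u, u.-1) \in mv -> 0 < u -> exists v, [/\ v <= N, v \notin map fst mv & R u v].
  elim: u => // u IH leu umv _; have Ru := Rmv _ umv; rewrite /= in Ru.
  have [/mapP[[w w'] wmv /= ew]|nin] := boolP (u \in map fst mv); last first.
    by exists u; split=> //; [lia | exact: sy].
  case: (stp _ wmv) => /= ew'.
    have /(inj _ _ umv wmv)[] : (u.+1, u).2 = (w, w').2 by move=> /=; lia.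
    by lia.
  have [|||v [lev nv Rv]] := IH; [by lia| |by lia|].
    by rewrite (_ : u.-1 = w') ?ew //; lia.
  by exists v; split=> //; exact: tr (sy _ _ Ru) Rv.
move=> u leu; have [/mapP[[w w'] wmv /= ew]|nin] := boolP (u \in map fst mv); last first.
  by exists u.
subst w; case: (stp _ wmv) => /= e; first by apply: right => //; rewrite -{2}e.
by apply: left => //; [rewrite -{2}e | rewrite -e].
Qed.

Definition vertex_at n a b : triple := (a, b, n - a - b).

Definition upper_edge n (S : seq triple) r ch (u v : triple) := exists x,
  [/\ c1 x < r, c1 x + c2 x + c3 x + 1 = n, x \notin S & (u, v) = ends (ch x) x].

Definition upper_conn n S r ch := clos_refl_sym_trans triple (upper_edge n S r ch).

(* The first [r] rows can be filled below any monotone labelling of the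
   vertices of row [r] outside [W]: [W] lists the vertices that are not joined to
   the row above. *)
Definition fillable n S r (W : seq nat) := forall M : nat -> nat,
  (forall a b, a <= b -> b <= n - r -> a \notin W -> b \notin W -> M a <= M b) ->
  (forall a, a <= n - r -> a \notin W -> r <= M a <= n - r) ->
  (forall l, r <= l <= n - r -> exists2 a, a <= n - r & a \notin W /\ M a = l) ->
  exists ch,
    (forall b, b <= n - r -> b \notin W ->
       upper_conn n S r ch (vertex_at n r b) (vertex_at n 0 (M b))) /\
    (forall a b, a < r -> b <= n - a -> exists l,
       [/\ l <= n, upper_conn n S r ch (vertex_at n a b) (vertex_at n 0 l),
           b = 0 -> l = a & b = n - a -> l = n - a]).

(** A monotone map of n + 1 positions onto n + 1 labels is the identity. *)
Lemma fillable0 n S : fillable n S 0 [::].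
Proof.
move=> M mono rng surj; exists (fun=> 1); split=> // b; rewrite subn0 in mono rng surj *.
move=> leb _; suff -> : M b = b by exact: rst_refl.
have inj a a' : a < a' -> a' <= n -> M a < M a'.
  move=> lt le; rewrite ltn_neqAle mono ?(ltnW lt) // andbT; apply/eqP => e.
  have sub : {subset iota 0 n.+1 <= map M (rem a (iota 0 n.+1))}.
    move=> l; rewrite mem_iota => rl; have [|c lec [_ <-]] := surj l; first by lia.
    have [->|ne] := eqVneq c a.
      by rewrite e map_f // mem_rem_uniq ?iota_uniq // inE mem_iota; lia.
    by rewrite map_f // mem_rem_uniq ?iota_uniq // inE ne mem_iota; lia.
  have := uniq_leq_size (iota_uniq _ _) sub.
  rewrite size_map size_rem ?size_iota; first by lia.
  by rewrite mem_iota; lia.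
have low c : c <= n -> c <= M c.
  elim: c => // c IH lec; have lt := inj c c.+1 (ltnSn c) lec.
  by apply: leq_ltn_trans lt; apply: IH; lia.
have high c : c <= n -> M (n - c) <= n - c.
  elim: c => [|c IH] lec; first by have := rng n (leqnn n) isT; rewrite subn0; lia.
  have [h1 h2] : n - c.+1 < n - c /\ n - c <= n by lia.
  by have := inj _ _ h1 h2; have := IH (ltnW lec); lia.
by have := low b leb; have := high (n - b); rewrite subKn //; lia.
Qed.

(** In row r, the triangles reached by a sliding one get a horizontal edge; every other triangle
    without a one joins its bottom vertex to an upper vertex with the same label. Vertices detached
    from above are reached along the horizontal edges. *)
Lemma fillable_slide n S r (W W' : seq nat) (mv : seq (nat * nat)) :
  (forall x, x \in S -> c1 x + c2 x + c3 x + 1 = n) ->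
  2 * r.+1 <= n.+1 -> uniq (map snd mv) ->
  (forall e, e \in mv -> e.2 = e.1 \/ e.2.+1 = e.1) ->
  (forall e, e \in mv -> e.1 + r <= n /\ e.2 + r < n) ->
  W =i map fst mv -> W' =i [predU row S r & map snd mv] ->
  (forall b, b \in map snd mv -> b \notin row S r) ->
  size W' <= r.+1 -> (row S r = [::] -> size W' <= r) ->
  fillable n S r W -> fillable n S r.+1 W'.
Proof.
move=> sumS le_n usnd stp bnd eW eW' disj szW' szW0 fill M mono rng surj.
have [beta lt_beta betaP] : exists2 beta, beta < n - r & beta \in row S r \/ (beta \notin W' /\
    exists2 g, beta < g < n - r & g \notin W' /\ M g = M beta).
  (* Without a one in the row, at most r of the n - r vertices are detached, and the others share n
     - 2r - 1 labels: some label is repeated. *)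
  have [e0|] := eqVneq (row S r) [::].
    have [|||a [b [ltab na nb e]]] := @repeated_label (n - r) r (n - r) W' M.
    - by move=> a lta na; have := rng a; lia.
    - by lia.
    - by have := szW0 e0; lia.
    by exists a; [lia | right; split=> //; exists b].
  rewrite -size_eq0 -lt0n => gt0.
  have : head 0 (row S r) \in row S r by case: row gt0 => //= *; rewrite inE eqxx.
  move=> hin; exists (head 0 (row S r)); last by left.
  have /mapP[x] := hin; rewrite mem_filter => /andP[/eqP ex xS] ->.
  by have := sumS x xS; lia.
have Wlt b : b \in W' -> b < n - r.
  rewrite eW' inE => /orP[/mapP[x]|/mapP[e emv ->]]; last first.
    by rewrite ltn_subRL addnC; case: (bnd e emv).
  by rewrite mem_filter => /andP[/eqP ex xS] ->; have := sumS x xS; lia.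
have [|||||F [F_mono [F0 FN] F_surj FA FD]] := @labels_exist (n - r) r (n - r)
   (fun b => b \in row S r) (fun b => b \in W') M beta _ _ _ _ _ lt_beta betaP.
- by move=> a b leab ltb; apply: mono; lia.
- by move=> a lta na; have := rng a; lia.
- by move=> l rl; have [|a lea ha] := surj l; [lia | exists a => //; lia].
- by lia.
- by move=> b bJ; rewrite eW' inE bJ.
(* Labels are constant along the horizontal edges, so each of them still occurs at a vertex joined
   to the row above. *)
have escF u : u <= n - r -> exists v, [/\ v <= n - r, v \notin map fst mv & F u = F v].
  apply: (slide_escape (R := fun u v => F u = F v) usnd stp); try by move=> *; congruence.
    by move=> [e1 e2] emv; have := bnd _ emv => /=; lia.
  move=> [e1 e2] emv; have [/= be1 be2] := bnd _ emv; apply: FD => /=; first by lia.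
    by rewrite eW' inE (map_f snd emv) orbT.
  by apply: disj; exact: (map_f snd emv).
have [|||ch [chW chT]] := fill F.
- by move=> a b leab leb _ _; exact: F_mono.
- move=> a lea _; have := F_mono 0 a; have := F_mono a (n - r); lia.
- move=> l rl; have [b leb <-] := F_surj l rl; have [v [lev nv e]] := escF b leb.
  by exists v => //; rewrite eW.
pose ch' x := if c1 x < r then ch x else if c2 x \in map snd mv then 1 else
  if M (c2 x) == F (c2 x) then 2 else 3.
have up u v : upper_conn n S r ch u v -> upper_conn n S r.+1 ch' u v.
  apply: conn_mono => x y [z [ltz sz zS e]]; apply: rst_step; exists z.
  by split=> //; [exact: ltnW | rewrite /ch' ltz].
have row_cell b : b < n - r -> b \notin row S r -> (r, b, n - r - b - 1) \notin S.
  by move=> ltb; apply: contra => xS; apply/mapP; exists (r, b, n - r - b - 1);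
    rewrite ?mem_filter ?xS ?eqxx.
have cell_conn b : b < n - r -> b \notin row S r ->
    upper_conn n S r.+1 ch' (ends (ch' (r, b, n - r - b - 1)) (r, b, n - r - b - 1)).1
      (ends (ch' (r, b, n - r - b - 1)) (r, b, n - r - b - 1)).2.
  move=> ltb nb; apply: rst_step; exists (r, b, n - r - b - 1); split=> //=; try lia.
    exact: row_cell.
  by case: ends.
have escC u : u <= n - r -> exists v, [/\ v <= n - r, v \notin map fst mv &
    upper_conn n S r.+1 ch' (vertex_at n r u) (vertex_at n r v) /\ F u = F v].
  apply: (slide_escape (R := fun u v => upper_conn n S r.+1 ch' (vertex_at n r u) (vertex_at n r v) /\ F u = F v)
     usnd stp).
  - by move=> [e1 e2] emv; have := bnd _ emv => /=; lia.
  - by move=> ?; split=> //; exact: rst_refl.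
  - by move=> ? ? [? ->]; split=> //; exact: rst_sym.
  - by move=> ? ? ? [h ->] [h' ->]; split=> //; exact: rst_trans h h'.
  - move=> [e1 e2] emv; have [/= be1 be2] := bnd _ emv; have eD : e2 \in map snd mv := map_f snd emv.
    split; last by apply: FD => /=; [lia | rewrite eW' inE eD orbT | exact: disj].
    have := cell_conn e2; rewrite /ch' /= ltnn eD /= => h.
    have -> : vertex_at n r e2 = (r, e2, (n - r - e2 - 1).+1) by apply: tripleP => //=; lia.
    have -> : vertex_at n r e2.+1 = (r, e2.+1, n - r - e2 - 1) by apply: tripleP => //=; lia.
    by apply: rst_sym; apply: h; [lia | exact: disj].
have rowC b : b <= n - r -> upper_conn n S r.+1 ch' (vertex_at n r b) (vertex_at n 0 (F b)).
  move=> leb; have [v [lev nv [cv ->]]] := escC b leb; apply: rst_trans cv _.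
  by apply/up/chW => //; rewrite eW.
exists ch'; split=> [b leb nb|a b].
  have ltb : b < n - r by lia.
  have nJ : b \notin row S r by apply: contra nb; rewrite eW' inE => ->.
  have nD : b \notin map snd mv by apply: contra nb; rewrite eW' inE => ->; rewrite orbT.
  have := cell_conn b ltb nJ; rewrite /ch' /= ltnn (negbTE nD).
  have ec : n - r - b = (n - r - b - 1).+1 by lia.
  have ec' : n - r.+1 - b = n - r - b - 1 by lia.
  have ec2 : n - r - b.+1 = n - r - b - 1 by lia.
  case: eqP => [->|ne] /= h.
    by rewrite {1}/vertex_at ec'; apply: rst_trans h _; rewrite -ec; apply: rowC; lia.
  have -> : M b = F b.+1 by case: (FA b ltb nb).
  by rewrite {1}/vertex_at ec'; apply: rst_trans h _; rewrite -ec2; apply: rowC; lia.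
rewrite ltnS leq_eqVlt => /orP[/eqP->|lta] leb.
  exists (F b); split; [|exact: rowC|by move=> ->|by move=> ->].
  by have := F_mono b (n - r); lia.
have [l [lel cl l0 ln]] := chT a b lta leb; exists l; split=> //; exact: up.
Qed.

(** * The labels received from below *)

Definition vertices n : seq triple := [seq vertex_at n a b | a <- iota 0 n.+1, b <- iota 0 (n - a).+1].

Definition cells n := if n is m.+1 then vertices m else [::].

Lemma mem_vertices n v : (v \in vertices n) = (c1 v + c2 v + c3 v == n).
Proof.
apply/allpairsPdep/eqP => [[a [b []]]|sv].
  by rewrite !mem_iota => ra rb ->; rewrite /vertex_at /=; lia.
exists (c1 v), (c2 v); rewrite !mem_iota; split; try lia.
by apply: tripleP => //=; lia.
Qed.

Lemma mem_cells n x : (x \in cells n) = (c1 x + c2 x + c3 x + 1 == n).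
Proof. by case: n => [|n]; rewrite /= ?mem_vertices ?addn1 // in_nil; case: eqP => //; lia. Qed.

Lemma uniq_vertices n : uniq (vertices n).
Proof.
apply: allpairs_uniq_dep => [|a _|]; try exact: iota_uniq.
by move=> [a b] [a' b'] _ _ /= [-> ->].
Qed.

Lemma uniq_cells n : uniq (cells n).
Proof. by case: n => //= n; exact: uniq_vertices. Qed.

Lemma size_vertices n : size (vertices n) = size (cells n) + n + 1.
Proof.
have szV k : size (vertices k) = sumn [seq (k - a).+1 | a <- iota 0 k.+1].
  by rewrite size_allpairs_dep; congr sumn; apply: eq_map => a; rewrite size_iota.
case: n => // n; rewrite /cells !szV.
have -> : iota 0 n.+2 = 0 :: map (addn 1) (iota 0 n.+1) by rewrite -iotaDl addn0.
rewrite -cat1s map_cat sumn_cat -map_comp /= addn0 subn0.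
by under eq_map => a do rewrite /= add1n subSS; lia.
Qed.

Definition edges n S ch : seq (triple * triple) :=
  [seq ends (ch x) x | x <- cells n & x \notin (S : seq triple)].

Lemma gconn_edges n S ch u v : gconn n S ch u v <-> edge_conn (edges n S ch) u v.
Proof.
split; apply: conn_mono => x y.
  case=> z [sz zS e]; apply: rst_step; apply/mapP; exists z => //.
  by rewrite mem_filter zS mem_cells sz /=.
case/mapP=> z; rewrite mem_filter mem_cells => /andP[zS /eqP sz] e.
by apply: rst_step; exists z.
Qed.

Lemma size_edges n S ch : uniq S -> {subset S <= cells n} ->
  size (edges n S ch) + size S = size (cells n).
Proof.
move=> uS sub; rewrite size_map size_filter -(count_predC (mem S) (cells n)) addnC.
congr (_ + _); rewrite -size_filter; apply/perm_size/uniq_perm => //.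
  exact: filter_uniq (uniq_cells n).
by move=> x; rewrite mem_filter /=; case: (boolP (x \in S)) => // /sub ->.
Qed.

(** A triangle with a one carries no edge, so every further one demands a further component. *)
Lemma reach_count n S ch R : uniq S -> {subset S <= cells n} ->
  (forall v, v \in vertices n -> exists2 r, r \in R & gconn n S ch v r) ->
  n + 1 + size S <= size R.
Proof.
move=> uS sub reach; have sE := size_edges ch uS sub; have sV := size_vertices n.
have H v : v \in vertices n -> exists2 r, r \in R & edge_conn (edges n S ch) v r.
  by case/reach=> r rR /gconn_edges; exists r.
have le : size (vertices n) <= size R + size (edges n S ch) :=
  conn_count (uniq_vertices n) H.
by lia.
Qed.

(* One vertex of each block: the top side and the lower half of the left side. *)
Definition reps n : seq triple :=
  [seq vertex_at n 0 b | b <- iota 0 n.+1] ++ [seq (d, 0, n - d) | d <- iota n./2.+1 (uphalf n)].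

Lemma size_reps n : size (reps n) = n + 1 + uphalf n.
Proof. by rewrite size_cat !size_map !size_iota; lia. Qed.

Lemma reps_top n b : b <= n -> vertex_at n 0 b \in reps n.
Proof. by move=> leb; rewrite mem_cat map_f // mem_iota; lia. Qed.

Lemma reps_left n d : n < 2 * d -> d <= n -> (d, 0, n - d) \in reps n.
Proof.
move=> lt le; rewrite mem_cat orbC (map_f (fun d => (d, 0, n - d))) // mem_iota.
by rewrite uphalf_half; lia.
Qed.

Lemma reps_vertices n : {subset reps n <= vertices n}.
Proof.
move=> v; rewrite mem_cat mem_vertices => /orP[] /mapP[d]; rewrite mem_iota ?uphalf_half => rd ->;
  rewrite /vertex_at /=; lia.
Qed.

Section Solution.
Variables (n : nat) (S : seq triple) (ch : triple -> nat).
Hypotheses (bal : balanced n S) (sol : solution n S ch).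

Lemma solution_reps v : v \in vertices n -> exists2 r, r \in reps n & gconn n S ch v r.
Proof.
rewrite mem_vertices => /eqP sv; have [w bw cw] := proj1 sol v sv.
suff [r rR cr] : exists2 r, r \in reps n & gconn n S ch w r by exists r => //; exact: rst_trans cw cr.
case: w bw {cw} => [[a b] c]; rewrite /boundary /= => /andP[/eqP sw bnd].
have [a0|a0] := eqVneq a 0.
  exists (a, b, c); last exact: rst_refl.
  by rewrite (_ : (a, b, c) = vertex_at n 0 b) ?reps_top //; [lia | apply: tripleP => //=; lia].
have [b0|b0] := eqVneq b 0; have [le|lt] := leqP (2 * a) n.
- have [p1 _ _] := proj2 sol a le; exists (vertex_at n 0 a); first by apply: reps_top; lia.
  rewrite (_ : (a, b, c) = (a, 0, n - a)) /vertex_at ?subn0; first exact: rst_sym.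
  by apply: tripleP => //=; lia.
- exists (a, 0, n - a); first by apply: reps_left; lia.
  by rewrite (_ : (a, b, c) = (a, 0, n - a)); [exact: rst_refl | apply: tripleP => //=; lia].
- have [_ p2 _] := proj2 sol a le; exists (vertex_at n 0 (n - a)); first by apply: reps_top; lia.
  rewrite (_ : (a, b, c) = (a, n - a, 0)); last by apply: tripleP => //=; lia.
  by rewrite (_ : vertex_at n 0 (n - a) = (0, n - a, a)); [exact: rst_sym | apply: tripleP => //=; lia].
- have [|_ _ p3] := proj2 sol (n - a); first by lia.
  exists (a, 0, n - a); first by apply: reps_left; lia.
  have ea : n - (n - a) = a by lia.
  rewrite ea in p3; rewrite (_ : (a, b, c) = (a, n - a, 0)); first exact: rst_sym.
  by apply: tripleP => //=; lia.
Qed.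

Let sub_cells : {subset S <= cells n}.
Proof. by move=> x xS; rewrite mem_cells (cb_sum (proj1 bal) xS). Qed.

(** Deleting this edge amounts to adding [x] to [S]. If connectivity survived, [reps n] would be too
    short for the count. *)
Lemma no_redundant_edge x : c1 x + c2 x + c3 x + 1 = n -> x \notin S ->
  ~ gconn n (x :: S) ch (ends (ch x) x).1 (ends (ch x) x).2.
Proof.
move=> sx xS red.
have H := @reach_count n (x :: S) ch (reps n).
rewrite [size (_ :: _)]/= size_reps (proj2 bal) in H.
suff : n + 1 + (uphalf n).+1 <= n + 1 + uphalf n by lia.
apply: H => [|y|v]; first by rewrite /= xS (cb_uniq (proj1 bal)).
  by rewrite inE => /orP[/eqP->|/sub_cells//]; rewrite mem_cells sx.
case/solution_reps=> r rR cvr; exists r => //; move: cvr; apply: conn_mono => y z.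
case=> w [sw wS e]; have [ew|ne] := eqVneq w x.
  by move: red; rewrite -ew -e.
by apply: rst_step; exists w; split=> //; rewrite inE negb_or ne.
Qed.

(** If two representatives were connected, one could be dropped from the list, against the same
    count. *)
Lemma reps_distinct u v : u \in reps n -> v \in reps n -> gconn n S ch u v -> u = v.
Proof.
move=> uR vR cuv; apply/eqP; apply/negPn/negP => ne.
have H := @reach_count n S ch (rem u (reps n)) (cb_uniq (proj1 bal)) sub_cells.
rewrite size_rem // size_reps (proj2 bal) in H.
suff : n + 1 + uphalf n <= (n + 1 + uphalf n).-1 by lia.
apply: H => w /solution_reps[r rR cr].
have inrem z : z \in reps n -> z != u -> z \in rem u (reps n).
  by rewrite (perm_mem (perm_to_rem uR)) inE => /orP[->|].
have [e|ner] := eqVneq r u.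
  by exists v; [apply: inrem; rewrite // eq_sym | apply: rst_trans cr _; rewrite e].
by exists r => //; exact: inrem.
Qed.

End Solution.

Lemma conn_iff (T : Type) (R : T -> T -> Prop) (P : T -> Prop) u v :
  (forall x y, R x y -> (P x <-> P y)) -> clos_refl_sym_trans T R u v -> (P u <-> P v).
Proof. by move=> H; elim=> {u v} [x y /H|x|x y _ ->|x y z _ -> _ ->]. Qed.

Lemma upper_gconn n S r ch u v : upper_conn n S r ch u v -> gconn n S ch u v.
Proof. by apply: conn_mono => x y [z [_ sz zS e]]; apply: rst_step; exists z. Qed.

Lemma row_uniq n S r : convex_bounds S c1 c2 c3 n -> uniq (row S r).
Proof.
move=> bds; rewrite map_inj_in_uniq ?filter_uniq ?(cb_uniq bds) //.
move=> x y; rewrite !mem_filter => /andP[/eqP ex /(cb_sum bds) sx] /andP[/eqP ey /(cb_sum bds) sy] e.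
by apply: tripleP; lia.
Qed.

Section TopRows.
Variables (n m : nat) (S : seq triple) (ch : triple -> nat).
Hypotheses (bal : balanced n S) (sol : solution n S ch) (m_gt0 : 0 < m).
Hypothesis tight : cpre S c1 m = m.
Hypothesis high : forall x, x \in S -> c1 x < m -> c1 x = m.-1.

Let bds : convex_bounds S c1 c2 c3 n := proj1 bal.
Let W := row S m.-1.

(* The vertices of the first rows climb to the top side, at this position. *)
Fixpoint top_label a b :=
  if a is a'.+1 then
    if ch (a', b, n - a' - b - 1) == 2 then top_label a' b else top_label a' b.+1
  else b.

Let top_label_mono a b b' : b <= b' -> top_label a b <= top_label a b'.
Proof.
elim: a b b' => //= a IH b b' le; have [->//|ne] := eqVneq b b'.
by case: ifP => _; case: ifP => _; apply: IH; lia.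
Qed.

Let top_label_le a b : a + b <= n -> top_label a b <= n.
Proof.
elim: a b => //= a IH b le; case: ifP => _; apply: IH; lia.
Qed.

Lemma top_label_conn a b : a <= m -> a + b <= n -> (a = m -> b \notin W) ->
  upper_conn n S a ch (vertex_at n a b) (vertex_at n 0 (top_label a b)).
Proof.
elim: a b => [|a IH] b lea leb nW; first exact: rst_refl.
have IHa b' : a + b' <= n -> upper_conn n S a ch (vertex_at n a b') (vertex_at n 0 (top_label a b')).
  by move=> leb'; apply: IH => //; lia.
pose x := (a, b, n - a - b - 1).
have sx : c1 x + c2 x + c3 x + 1 = n by rewrite /=; lia.
have xS : x \notin S.
  apply/negP => xS; have ea : a = m.-1 by apply: (high xS) => /=; lia.
  have : b \notin W by apply: nW; lia.
  by case/negP; apply/rowP; exists x.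
have w_up u v : upper_conn n S a ch u v -> upper_conn n S a.+1 ch u v.
  by apply: conn_mono => y z [w [ltw sw wS e]]; apply: rst_step; exists w; split=> //; lia.
have edge : upper_conn n S a.+1 ch (ends (ch x) x).1 (ends (ch x) x).2.
  by apply: rst_step; exists x; split=> //=; case: (ends _ _).
have e0 : (a, b, (n - a - b - 1).+1) = vertex_at n a b by apply: tripleP => //=; lia.
have e1 : (a, b.+1, n - a - b - 1) = vertex_at n a b.+1 by apply: tripleP => //=; lia.
have e2 : (a.+1, b, n - a - b - 1) = vertex_at n a.+1 b by apply: tripleP => //=; lia.
(* The ends of a horizontal edge already climb to the top side: to the same vertex, making the edge
   redundant, or to two vertices of different blocks, which it would connect. *)
have ne1 : ch x <> 1.
  move=> ch1; have le0 : a + b <= n by lia.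
  have le1 : a + b.+1 <= n by lia.
  have c0 := IHa b le0; have c1' := IHa b.+1 le1.
  have same : top_label a b.+1 = top_label a b.
    have := @reps_distinct n S ch bal sol (vertex_at n 0 (top_label a b.+1)) (vertex_at n 0 (top_label a b)).
    move/(_ (reps_top (top_label_le le1)) (reps_top (top_label_le le0))).
    suff h : gconn n S ch (vertex_at n 0 (top_label a b.+1)) (vertex_at n 0 (top_label a b)) by case/(_ h).
    apply: rst_trans (upper_gconn c0); apply: rst_trans (rst_sym _ _ _ _ (upper_gconn c1')) _.
    by have := upper_gconn edge; rewrite ch1 /= e0 e1.
  apply: (no_redundant_edge bal sol sx xS); rewrite ch1 /= e0 e1.
  have away u v : upper_conn n S a ch u v -> gconn n (x :: S) ch u v.
    apply: conn_mono => y z [w [ltw sw wS e]]; apply: rst_step; exists w; split=> //.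
    by rewrite inE negb_or wS andbT; apply/eqP => ew; rewrite ew /= ltnn in ltw.
  by apply: rst_trans (away _ _ c1') _; rewrite same; apply: rst_sym; exact: away.
rewrite /= -/x; case: eqP => [ch2|ne2].
  rewrite ch2 /= e2 e0 in edge; apply: rst_trans edge _; apply: w_up; apply: IHa; lia.
have ends3 : ends (ch x) x = ends 3 x by case: (ch x) ne1 ne2 => [|[|[|]]].
rewrite ends3 /= e2 e1 in edge; apply: rst_trans edge _; apply: w_up; apply: IHa; lia.
Qed.

Let size_W : size W = m.
Proof.
rewrite size_map size_filter -tight; apply: eq_in_count => x xS.
by apply/eqP/idP => [->|/(high xS)//]; lia.
Qed.

Let W_lt b : b \in W -> b + m <= n.
Proof. by case/rowP => x /(cb_sum bds) sx [e1 <-]; lia. Qed.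

Let two_m : 2 * m <= n.+1.
Proof.
have := count_size (fun x => c1 x < m) S; rewrite -/(cpre S c1 m) tight (proj2 bal) uphalf_half.
lia.
Qed.

Let label := top_label m.

(** For such l the block of the top vertex l has a vertex in row l or n - l, hence in row m or
    below. A path to it leaves the first rows, which is possible only through an attached vertex of
    row m. *)
Let label_surj l : m <= l <= n - m -> exists2 b, b <= n - m & b \notin W /\ label b = l.
Proof.
move=> rl; apply: NNPP => none.
have inR k : k <= n -> vertex_at n 0 k \in reps n := @reps_top n k.
have lel : l <= n by lia.
pose P v := c1 v < m /\ gconn n S ch v (vertex_at n 0 l).
have Pinv u v : gedge n S ch u v -> (P u <-> P v).
  move=> uv; have cuv : gconn n S ch u v by apply: rst_step.
  have cP : gconn n S ch u (vertex_at n 0 l) <-> gconn n S ch v (vertex_at n 0 l).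
    by split=> h; [apply: rst_trans (rst_sym _ _ _ _ cuv) h | exact: rst_trans cuv h].
  have [x [sx xS e]] := uv.
  have [same|[eu ev]] : c1 u = c1 v \/ u = ((c1 x).+1, c2 x, c3 x) /\ c1 v = c1 x.
    by move: e; case: (ch x) => [|[|[|k]]] /= [-> ->]; [right|left|right|right].
    by rewrite /P same cP.
  have [ex|nex] := eqVneq (c1 x).+1 m; last first.
    by rewrite /P cP ev eu /=; split=> -[? ?]; split=> //; lia.
  have epu : u = vertex_at n m (c2 x) by rewrite eu ex; apply: tripleP => //=; lia.
  have nb : c2 x \notin W.
    apply: contra xS => /rowP[y yS [y1 y2]].
    have sy := cb_sum bds yS.
    by rewrite (_ : x = y) //; apply: tripleP; lia.
  have leb : m + c2 x <= n by lia.
  split; first by case; rewrite eu /= ex ltnn.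
  case=> _ cv; case: none; exists (c2 x); first by lia.
  split=> //; have H := reps_distinct bal sol (inR _ (top_label_le leb)) (inR _ lel).
  suff /H [] : gconn n S ch (vertex_at n 0 (label (c2 x))) (vertex_at n 0 l) by [].
  apply: rst_trans (rst_sym _ _ _ _ (upper_gconn (top_label_conn (leqnn m) leb (fun _ => nb)))) _.
  by rewrite -epu; exact: rst_trans cuv cv.
have t0 : P (vertex_at n 0 l) by split=> //; exact: rst_refl.
have low v : gconn n S ch (vertex_at n 0 l) v -> m <= c1 v -> False.
  by move=> /(conn_iff Pinv)[/(_ t0) [lt _] _]; lia.
have [le|lt] := leqP (2 * l) n.
  have [p1 _ _] := proj2 sol l le; apply: (low (l, 0, n - l)); last by rewrite /=; lia.
  by rewrite /vertex_at subn0.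
have [|_ p2 _] := proj2 sol (n - l); first by lia.
apply: (low (n - l, n - (n - l), 0)); last by rewrite /=; lia.
by have -> : vertex_at n 0 l = (0, n - (n - l), n - l); [apply: tripleP => //=; lia | exact: p2].
Qed.

(** There are as many attached vertices as labels between m and n - m, so a labelling onto these
    takes no other value. *)
Let label_range b : b <= n - m -> b \notin W -> m <= label b <= n - m.
Proof.
move=> leb nb; pose A := [seq b <- iota 0 (n - m).+1 | b \notin W].
have W_sub : {subset W <= iota 0 (n - m).+1} by move=> c /W_lt; rewrite mem_iota; lia.
have szA : size A + m = (n - m).+1.
  have eW : size [seq c <- iota 0 (n - m).+1 | c \in W] = size W.
    apply/perm_size/uniq_perm; [exact: filter_uniq (iota_uniq _ _)|exact: (row_uniq _ bds)|].
    by move=> c; rewrite mem_filter; apply/andP/idP => [[]//|cW]; split=> //; exact: W_sub.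
  have := count_predC (mem W) (iota 0 (n - m).+1).
  by rewrite size_iota -!size_filter eW size_W addnC.
have bA : b \in A by rewrite mem_filter nb mem_iota; lia.
have [lt|le] := ltnP n (2 * m); first by case: (A) bA szA => //= c s _; lia.
have sub : {subset iota m (n - m - m).+1 <= map label A}.
  move=> l; rewrite mem_iota => rl; have [|c lec [nc <-]] := @label_surj l; first by lia.
  by apply: map_f; rewrite mem_filter nc mem_iota; lia.
have szle : size (map label A) <= size (iota m (n - m - m).+1).
  by rewrite size_map size_iota -(leq_add2r m) szA; have := two_m; lia.
have [_ eqi] := uniq_min_size (iota_uniq _ _) sub szle.
have : label b \in map label A := map_f _ bA.
by rewrite -eqi mem_iota; lia.
Qed.

Variable S0 : seq triple.
Hypothesis same : forall x, m <= c1 x -> (x \in S0) = (x \in S).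
Hypothesis fill : fillable n S0 m W.

Lemma solvable_refill : solvable n S0.
Proof.
have [|||ch0 [fillW fillT]] := fill (M := label).
- by move=> a b le _ _ _; exact: top_label_mono.
- exact: label_range.
- exact: label_surj.
pose chN x := if c1 x < m then ch0 x else ch x.
have up u v : upper_conn n S0 m ch0 u v -> gconn n S0 chN u v.
  by apply: conn_mono => x y [z [ltz sz zS e]]; apply: rst_step; exists z; rewrite /chN ltz.
(* The first rows are rebuilt, so each of their vertices is represented by the top vertex of its
   component. *)
pose psi v := if c1 v < m then vertex_at n 0 (top_label (c1 v) (c2 v)) else v.
have psi_conn u v : gconn n S ch u v -> gconn n S0 chN (psi u) (psi v).
  apply: gconn_map => {u v} x sx xS; have edge := gconn_edge ch sx xS.
  have [lex|ltx] := leqP m (c1 x).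
    have := @gconn_edge n S0 chN x sx; rewrite same // xS /chN ltnNge lex /= => /(_ isT).
    rewrite /psi; have [-> ->] : (c1 (ends (ch x) x).1 < m) = false /\
        (c1 (ends (ch x) x).2 < m) = false.
      by case: (ch x) => [|[|[|k]]] /=; lia.
    by [].
  have lab v : c1 v + c2 v + c3 v = n -> c1 v < m ->
      gconn n S ch v (psi v) /\ psi v \in reps n.
    move=> sv ltv; rewrite /psi ltv; split; last first.
      by apply: reps_top; apply: top_label_le; lia.
    have ev : v = vertex_at n (c1 v) (c2 v) by apply: tripleP => //=; lia.
    by rewrite {1}ev; apply: upper_gconn (top_label_conn _ _ _); lia.
  have low u v : gconn n S ch u v -> c1 u + c2 u + c3 u = n -> c1 v + c2 v + c3 v = n ->
      c1 u < m -> c1 v < m -> gconn n S0 chN (psi u) (psi v).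
    move=> cuv su sv ltu ltv; have [cu ru] := lab u su ltu; have [cv rv] := lab v sv ltv.
    have -> : psi u = psi v; last exact: rst_refl.
    apply: (reps_distinct bal sol) => //.
    by apply: rst_trans (rst_sym _ _ _ _ cu) _; exact: rst_trans cuv cv.
  have [ssu ssv] : c1 (ends (ch x) x).1 + c2 (ends (ch x) x).1 + c3 (ends (ch x) x).1 = n /\
      c1 (ends (ch x) x).2 + c2 (ends (ch x) x).2 + c3 (ends (ch x) x).2 = n.
    by case: (ch x) => [|[|[|k]]] /=; lia.
  have ltv : c1 (ends (ch x) x).2 < m by case: (ch x) => [|[|[|k]]] /=; lia.
  have [ltu|leu] := ltnP (c1 (ends (ch x) x).1) m; first exact: low.
  have eu : (ends (ch x) x).1 = vertex_at n m (c2 x) /\ c1 x = m.-1.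
    by case: (ch x) leu => [|[|[|k]]] /= leu; split; try lia; apply: tripleP => //=; lia.
  have [cv rv] := lab _ ssv ltv.
  have nb : c2 x \notin W.
    apply: contra xS => /rowP[y yS [y1 y2]].
    have sy := cb_sum bds yS.
    by rewrite (_ : x = y) //; apply: tripleP; lia.
  have leb : m + c2 x <= n by lia.
  rewrite {1}/psi ltnNge leu /= (proj1 eu) in edge *.
  suff -> : psi (ends (ch x) x).2 = vertex_at n 0 (label (c2 x)).
    by apply: up; apply: fillW => //; lia.
  apply: (reps_distinct bal sol) => //; first by apply: reps_top; exact: top_label_le.
  apply: rst_trans (rst_sym _ _ _ _ cv) _; apply: rst_trans (rst_sym _ _ _ _ edge) _.
  by apply: upper_gconn (top_label_conn _ _ _).
have psi_top k : psi (vertex_at n 0 k) = vertex_at n 0 k by rewrite /psi /= m_gt0.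
have psi_id v : m <= c1 v -> psi v = v by rewrite /psi ltnNge => ->.
have fillT' a b : a < m -> a + b <= n -> exists l,
    [/\ l <= n, gconn n S0 chN (vertex_at n a b) (vertex_at n 0 l), b = 0 -> l = a & a + b = n -> l = n - a].
  move=> lta leb; have [|l [lel cl l0 ln]] := fillT a b lta; first by lia.
  by exists l; split=> //; [exact: up | move=> e; apply: ln; lia].
exists chN; split=> [v sv|d led].
  have [ltv|lev] := ltnP (c1 v) m.
    have [|l [lel cl _ _]] := fillT' (c1 v) (c2 v) ltv; first by lia.
    exists (vertex_at n 0 l); first by rewrite /boundary /=; lia.
    by have -> : v = vertex_at n (c1 v) (c2 v) by apply: tripleP => //=; lia.
  have [w bw cvw] := proj1 sol v sv; have := psi_conn _ _ cvw; rewrite (psi_id v lev) => h.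
  exists (psi w) => //; rewrite /psi; case: ifP => // ltw; rewrite /boundary /=.
  have sw : c1 w + c2 w + c3 w = n by case/andP: bw => /eqP.
  have le : top_label (c1 w) (c2 w) <= n by apply: top_label_le; lia.
  by lia.
have [p1 p2 p3] := proj2 sol d led.
have e1 : (0, d, n - d) = vertex_at n 0 d by rewrite /vertex_at subn0.
have e2 : (0, n - d, d) = vertex_at n 0 (n - d) by apply: tripleP => //=; lia.
have le_m := two_m; split.
- have [lt|le] := ltnP d m.
    have [|l [_ cl l0 _]] := fillT' d 0 lt; first by lia.
    rewrite e1 (_ : (d, 0, n - d) = vertex_at n d 0); last by apply: tripleP => //=; lia.
    by rewrite -{1}(l0 erefl); exact: rst_sym.
  by have := psi_conn _ _ p1; rewrite e1 psi_top psi_id.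
- have [lt|le] := ltnP d m.
    have [|l [_ cl _ ln]] := fillT' d (n - d) lt; first by lia.
    rewrite e2 (_ : (d, n - d, 0) = vertex_at n d (n - d)); last by apply: tripleP => //=; lia.
    by rewrite -{1}ln; [exact: rst_sym | lia].
  by have := psi_conn _ _ p2; rewrite e2 psi_top psi_id.
- by have := psi_conn _ _ p3; rewrite !psi_id //=; lia.
Qed.

End TopRows.

Lemma size_row_le n S r : convex_bounds S c1 c2 c3 n -> size (row S r) <= r.+1.
Proof.
move=> bds; apply: leq_trans (cb_pre1 bds r.+1); rewrite size_map size_filter.
by apply: sub_count => x /eqP ->.
Qed.

Lemma push_top n m S :
  balanced n S -> cpre S c1 m = m -> 0 < m -> exists S',
  [/\ balanced n S', forall x, x \in S' -> c1 x < m -> c1 x = m.-1,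
      forall x, m <= c1 x -> (x \in S') = (x \in S), pushes m S S' &
      solvable n S' -> solvable n S].
Proof.
move=> bal tight m_gt0; have bds := proj1 bal.
have le_m : 2 * m <= n.+1.
  have := count_size (fun x => c1 x < m) S.
  by rewrite -/(cpre S c1 m) tight (proj2 bal) uphalf_half; lia.
(* The rows filled are those of the original [S]; the slid set [S'] only records which vertices of
   row r + 1 are detached from above. *)
suff H r : r < m -> exists S', [/\ balanced n S', forall x, x \in S' -> r <= c1 x,
    forall x, r < c1 x -> (x \in S') = (x \in S), pushes m S S' &
    fillable n S r.+1 (row S' r)].
  have [|S' [bal' low high psh fill]] := H m.-1; first by lia.
  rewrite prednK // in fill; exists S'; split=> //.
  - by move=> x /low; lia.
  - by move=> x lex; apply: high; lia.
  case=> ch sol; apply: (solvable_refill bal' sol m_gt0 _ _ _ fill).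
  - have := psh (fun x => c1 x < m); rewrite -/(cpre S c1 m) -/(cpre S' c1 m) tight.
    have := cb_pre1 (proj1 bal') m => h1 h2.
    by apply/eqP; rewrite eqn_leq h1 h2.
  - by move=> x /low; lia.
  - by move=> x lex; rewrite high //; lia.
elim: r => [_|r IH ltr].
  exists S; split=> //.
  have := @fillable_slide n S 0 [::] (row S 0) [::]; apply=> //.
  - exact: cb_sum bds.
  - by lia.
  - by move=> b; rewrite !inE orbF.
  - exact: size_row_le bds.
  - by move->.
  - exact: fillable0.
have [|S1 [bal1 low1 high1 psh1 fill1]] := IH; first by lia.
have tight1 : cpre S1 c1 m = m.
  have := psh1 (fun x => c1 x < m); rewrite -/(cpre S c1 m) -/(cpre S1 c1 m) tight.
  have := cb_pre1 (proj1 bal1) m => h1 h2.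
  by apply/eqP; rewrite eqn_leq h1 h2.
have [S2 [mv rs]] := row_slide_exists bal1 tight1 ltr.
have bds1 := proj1 bal1; have bds2 := proj1 (rs_balanced rs).
have erow : row S1 r.+1 =i row S r.+1.
  by move=> b; apply/rowP/rowP => -[x xS [e1 e2]]; exists x => //;
    move: xS; rewrite high1 // e1.
exists S2; split.
- exact: rs_balanced rs.
- move=> x xS; rewrite leqNgt; apply/negP => lt.
  have [e|ne] := eqVneq (c1 x) r.
    have : c2 x \in row S2 r by apply/rowP; exists x.
    by rewrite (rs_empty rs).
  move: xS; rewrite (rs_other rs) //; last by lia.
  by move/low1; lia.
- move=> x ltx; rewrite (rs_other rs); [apply: high1; lia | lia | lia].
- by move=> P dP; apply: leq_trans (psh1 P dP) (rs_pushes rs dP).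
apply: (fillable_slide _ _ (rs_dst rs) (rs_step rs) _ (rs_row rs) _ _ _ _ fill1).
- exact: cb_sum bds.
- by lia.
- move=> e emv; have : e.1 \in row S1 r by rewrite (rs_row rs) map_f.
  case/rowP => x /(cb_sum bds1) sx [ex1 ex2].
  have : e.2 \in row S2 r.+1 by rewrite (rs_next rs) inE (map_f snd emv) orbT.
  case/rowP => y /(cb_sum bds2) sy [ey1 ey2].
  by rewrite -ex2 -ey2; lia.
- by move=> b; rewrite (rs_next rs) !inE erow.
- by move=> b /(rs_disjoint rs); rewrite erow.
- exact: size_row_le bds2.
- move=> e0; have : size (row S2 r.+1) <= size (map snd mv).
    apply: uniq_leq_size (row_uniq _ bds2) _ => b; rewrite (rs_next rs) inE erow e0.
    by [].
  move=> le; apply: leq_trans le _; rewrite size_map -(size_map fst).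
  apply: leq_trans (size_row_le r bds1); apply: uniq_leq_size (rs_src rs) _ => b.
  by rewrite (rs_row rs).
Qed.

(** * The induction *)

Section Step.
Variable n : nat.
Hypotheses (n_ge2 : 2 <= n) (IH : forall S, balanced (n - 2) S -> solvable (n - 2) S).

(** The left-most columns are one of the two obstacles in a clash for the first and third strips,
    and there the hypothesis on [d] excludes it. *)
Lemma solvable_base2 S d : balanced n S -> d \in S ->
  (forall m, 0 < m -> cpre S c2 m = m -> c2 d < m) ->
  (forall Y Z, ~ clash S true c2 c1 c3 n d Y Z) -> solvable n S.
Proof.
move=> bal dS gap ncE; have cb123 := proj1 bal.
have cb231 := convex_boundsR cb123; have cb312 := convex_boundsR cb231.
have cb213 := convex_boundsC cb231.
have [Y Z [[Y0 _ leY _ _] [tY _ _]]|sg [sg3 stS]] := strip_exists (wit := false) cb123 dS.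
  by have := gap Y Y0 tY; lia.
have [ep [ep3 stE]] := strip_exists cb213 dS ncE.
have [Y Z [[_ Z0 _ leZ _] [_ tZ _]]|om [om2 stW]] := strip_exists (wit := false) cb312 dS.
  by have := gap Z Z0 tZ; lia.
apply: (solvable_reduced n_ge2 bal dS stS stE stW); apply: IH.
exact: (reduced_balanced n_ge2 bal dS stS stE stW gap).
Qed.

Lemma solvable_base1 S d : balanced n S -> d \in S ->
  (forall m, 0 < m -> cpre S c1 m = m -> c1 d < m) ->
  (forall Y Z, ~ clash S true c1 c2 c3 n d Y Z) -> solvable n S.
Proof.
move=> bal dS gap nc; apply: solvable_swap12.
apply: (solvable_base2 (d := swap12 d)).
- exact: balanced_swap12.
- exact: map_f.
- by move=> m; rewrite cpre_map; exact: gap.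
- move=> Y Z [h [tY tZ w]]; apply: (nc Y Z); split=> //; move: tY tZ; rewrite !cpre_map => tY tZ.
  split=> // wt; have [h1 h2] := w wt; split=> x xS; [apply: (h1 (swap12 x)) | apply: (h2 (swap12 x))];
    exact: map_f.
Qed.

(** After both slides no one lies before the last of the first b lines. The [d] found within these
    lines thus has no nonempty saturated set of them before it, which a clash would need. *)
Lemma solvable_meet S m b x : balanced n S ->
  cpre S c1 m = m -> cpre S c2 b = b -> x \in S -> c1 x < m -> c2 x < b -> solvable n S.
Proof.
move=> bal tm tb xS xm xb.
have [|S1 [bal1 low1 high1 psh1 sol1]] := push_top bal tm; first by lia.
apply: sol1.
have tm1 : cpre S1 c1 m = m.
  apply/eqP; rewrite eqn_leq (cb_pre1 (proj1 bal1)) -{1}tm; exact: psh1.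
have tb1 : cpre S1 c2 b = b.
  apply/eqP; rewrite eqn_leq (cb_pre2 (proj1 bal1)) -{1}tb; apply: psh1.
  by move=> y z _ le _; exact: leq_ltn_trans.
have meet1 : has (fun y => (c1 y < m) && (c2 y < b)) S1.
  have : has (fun y => (c1 y < m) && (c2 y < b)) S by apply/hasP; exists x; rewrite // xm.
  rewrite !has_count => gt; apply: leq_trans gt _; apply: psh1 => y z ltz le _ /andP[_ lty].
  by rewrite ltz; exact: leq_ltn_trans lty.
have bal1' := balanced_swap12 bal1.
have tb1' : cpre (map swap12 S1) c1 b = b by rewrite cpre_map.
have tm1' : cpre (map swap12 S1) c2 m = m by rewrite cpre_map.
apply: solvable_swap12.
have [|S2 [bal2 low2 high2 psh2 sol2]] := push_top bal1' tb1'; first by lia.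
apply: sol2.
have tm2 : cpre S2 c2 m = m.
  apply/eqP; rewrite eqn_leq (cb_pre2 (proj1 bal2)) -{1}tm1'; apply: psh2.
  by move=> y z _ le _; exact: leq_ltn_trans.
have meet2 : has (fun y => (c1 y < b) && (c2 y < m)) S2.
  have : has (fun y => (c1 y < b) && (c2 y < m)) (map swap12 S1).
    by rewrite has_map; apply: sub_has meet1 => y /=; rewrite andbC.
  rewrite !has_count => gt; apply: leq_trans gt _; apply: psh2 => y z ltz le _ /andP[_ lty].
  by rewrite ltz; exact: leq_ltn_trans lty.
have exm : exists m', (0 < m') && (cpre S2 c2 m' == m') by exists m; rewrite tm2 eqxx; lia.
have [m' /andP[m'0 /eqP tm'] minm'] := ex_minnP exm.
have lem : m' <= m by apply: minm'; rewrite tm2 eqxx; lia.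
(* If m' < m, a one counted by m' cannot be outside the first b lines: there the second slide
   changed nothing, and the first left only line m - 1. *)
have [d dS [d1 d2]] : exists2 d, d \in S2 & c1 d < b /\ c2 d < m'.
  have [em|ne] := eqVneq m' m.
    by have /hasP[d dS /andP[d1 d2]] := meet2; exists d; rewrite ?em.
  have /hasP[d dS d2] : has (fun y => c2 y < m') S2 by rewrite has_count -/(cpre S2 c2 m') tm'.
  exists d => //; split=> //; rewrite ltnNge; apply/negP => le.
  move: dS; rewrite high2 // => /mapP[y yS e]; rewrite e /= in d2.
  by have := low1 y yS; lia.
apply: (solvable_base2 bal2 dS) => [k k0 tk|Y Z [[Y0 _ leY _ _] [tY _ _]]].
  by apply: leq_trans d2 _; apply: minm'; rewrite k0 tk eqxx.
have : cpre S2 c1 Y = 0; last by lia.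
apply/eqP; rewrite -leqn0 leqNgt -has_count; apply/negP => /hasP[y yS /= lty].
by have := low2 y yS; lia.
Qed.

Let minimal (S : seq triple) (p : triple -> nat) : S != [::] ->
  exists2 d, d \in S & forall m, 0 < m -> cpre S p m = m -> p d < m.
Proof.
move=> nS; have [[m [m0 tm]]|none] := classic (exists m, 0 < m /\ cpre S p m = m).
  have exm : exists m, (0 < m) && (cpre S p m == m) by exists m; rewrite m0 tm eqxx.
  have [k /andP[k0 /eqP tk] mink] := ex_minnP exm.
  have /hasP[d dS lt] : has (fun y => p y < k) S by rewrite has_count -/(cpre S p k) tk.
  by exists d => // m' m'0 tm'; apply: leq_trans lt _; apply: mink; rewrite m'0 tm' eqxx.
case: S nS none => // d S _ none; exists d; first exact: mem_head.
by move=> m m0 tm; case: none; exists m.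
Qed.

(** If both candidates fail, their clashes give disjoint saturated sets of i rows, j left-most and k
    right-most columns. A one on the last of the k columns is no witness for either clash, which
    forces i + j + k >= n, more than the number of ones. *)
Lemma solvable_disjoint S : balanced n S ->
  (forall i j x, cpre S c1 i = i -> cpre S c2 j = j -> x \in S -> c1 x < i -> c2 x < j -> False) ->
  (forall j k x, cpre S c2 j = j -> cpre S c3 k = k -> x \in S -> c2 x < j -> c3 x < k -> False) ->
  (forall k i x, cpre S c3 k = k -> cpre S c1 i = i -> x \in S -> c3 x < k -> c1 x < i -> False) ->
  solvable n S.
Proof.
move=> bal d12 d23 d31; have bds := proj1 bal.
have nS : S != [::] by rewrite -size_eq0 (proj2 bal) uphalf_half; lia.
have [d dS gap] := minimal c2 nS.
have [[i [k [[i0 k0 _ _ _] [ti tk wE]]]]|nc] :=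
  classic (exists Y Z, clash S true c2 c1 c3 n d Y Z); last first.
  by apply: (solvable_base2 bal dS gap) => Y Z cl; apply: nc; exists Y, Z.
have [d' dS' gap'] := minimal c1 nS.
have [[j [k' [[j0 k'0 _ _ _] [tj tk' wS]]]]|nc] :=
  classic (exists Y Z, clash S true c1 c2 c3 n d' Y Z); last first.
  by apply: (solvable_base1 bal dS' gap') => Y Z cl; apply: nc; exists Y, Z.
exfalso; have [wE1 wE3] := wE isT; have [wS2 wS3] := wS isT.
have edge (p : triple -> nat) m : (forall m, cpre S p m <= m) -> 0 < m -> cpre S p m = m ->
    exists2 w, w \in S & p w + 1 = m.
  case: m => // m le _ t; have [||w wS' e] := cpre_edge (S := S) (p := p) (m := m); try by rewrite ?t.
  by exists w; rewrite // e addn1.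
have [e1 e1S e11] := edge c1 i (cb_pre1 bds) i0 ti.
have [f2 f2S f23] := edge c3 k' (cb_pre3 bds) k'0 tk'.
have [e2 e2S e23] := edge c3 k (cb_pre3 bds) k0 tk.
have [f1 f1S f12] := edge c2 j (cb_pre2 bds) j0 tj.
have e13 := wE1 e1 e1S e11; have e21 := wE3 e2 e2S e23.
have f13 := wS2 f1 f1S f12; have f22 := wS3 f2 f2S f23.
have e13' : k <= c3 e1.
  by rewrite leqNgt; apply/negP => lt; apply: (d31 k i e1) => //; lia.
have f13' : k' <= c3 f1.
  by rewrite leqNgt; apply/negP => lt; apply: (d23 j k' f1) => //; lia.
(* As no one is a witness, c3 e1 <= k and c3 f1 <= k'; if k and k' differed, the larger set would
   share [e1] or [f1] with a saturated set of another side. *)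
have ek : k = k'.
  case: (ltngtP k k') => // lt; exfalso.
    by apply: (d31 k' i e1) => //; lia.
  by apply: (d23 j k f1) => //; lia.
rewrite -ek in f23.
have f21 := wE3 f2 f2S f23.
have f22' : j <= c2 f2.
  by rewrite leqNgt; apply/negP => lt; apply: (d23 j k f2) => //; lia.
have sf2 := cb_sum bds f2S.
have ptw : {in S, forall x, (c1 x < i) + ((c2 x < j) + (c3 x < k)) <= 1}.
  move=> x xS; have := d12 i j x ti tj xS; have := d23 j k x tj tk xS; have := d31 k i x tk ti xS.
  case: (ltnP (c1 x) i) => ?; case: (ltnP (c2 x) j) => ?; case: (ltnP (c3 x) k) => ? H1 H2 H3 //;
    exfalso; by [exact: H1 | exact: H2 | exact: H3].
have : count (fun x => c1 x < i) S + (count (fun x => c2 x < j) S + count (fun x => c3 x < k) S)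
    <= size S.
  elim: (S) ptw => //= x s IHs H; have := H x (mem_head _ _).
  by have := IHs (fun y ys => H y (mem_behead (s := x :: s) ys)); lia.
rewrite -/(cpre S c1 i) -/(cpre S c2 j) -/(cpre S c3 k) ti tj tk (proj2 bal) uphalf_half.
lia.
Qed.

Lemma solvable_recursion S : balanced n S -> solvable n S.
Proof.
move=> bal.
have bal' := balanced_rot3 bal; have bal'' := balanced_rot3 bal'.
have [//|ns] := classic (solvable n S); apply: (solvable_disjoint bal).
- by move=> i j x ti tj xS xi xj; apply: ns; exact: (solvable_meet bal ti tj xS).
- move=> j k x tj tk xS xj xk; apply: ns; apply: solvable_rot3.
  by apply: (@solvable_meet _ j k (rot3 x) bal'); rewrite ?cpre_map ?map_f.
- move=> k i x tk ti xS xk xi; apply: ns; apply/solvable_rot3/solvable_rot3.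
  by apply: (@solvable_meet _ k i (rot3 (rot3 x)) bal''); rewrite ?cpre_map ?map_f.
Qed.

End Step.

Theorem balanced_solvable n S : balanced n S -> solvable n S.
Proof.
elim/ltn_ind: n S => n IH S bal; have [lt|le] := ltnP n 2; last first.
  by apply: solvable_recursion => // S' bal'; apply: IH => //; lia.
(* For n < 2 all vertices are on the boundary and only d = 0 occurs, where the required connections
   are trivial. *)
exists (fun=> 1); split=> [v sv|d led].
  by exists v; [rewrite /boundary; lia | exact: rst_refl].
have -> : d = 0 by lia.
by rewrite subn0; split; exact: rst_refl.
Qed.

(** * Necessity *)

Lemma ends_sum n m x : c1 x + c2 x + c3 x + 1 = n ->
  (ends m x).1 \in vertices n /\ (ends m x).2 \in vertices n.
Proof. by rewrite !mem_vertices; case: m => [|[|[|m]]] /=; lia. Qed.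

Section Necessity.
Variables (n : nat) (S : seq triple) (ch : triple -> nat).
Hypotheses (uS : uniq S) (subS : {subset S <= cells n}) (sol : solution n S ch).

(* Follow a path from each vertex of [I] to the first vertex outside [I]: all its
   edges lie in [A]. *)
Lemma region_count (I A : pred triple) :
  (forall v, v \in vertices n -> I v ->
     exists2 w, w \in vertices n & ~~ I w /\ gconn n S ch v w) ->
  (forall m x, x \in cells n -> I (ends m x).1 || I (ends m x).2 -> A x) ->
  size (filter I (vertices n)) + count A S <= size (filter A (cells n)).
Proof.
move=> out inA.
pose E := [seq ends (ch x) x | x <- cells n & A x && (x \notin S)].
pose R := [seq v <- vertices n | ~~ I v].
have szE : size E + count A S = size (filter A (cells n)).
  have eS : count A S = count (fun x => (x \in S) && A x) (cells n).
    rewrite -!size_filter; apply/perm_size/uniq_perm; rewrite ?filter_uniq ?uniq_cells // => x.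
    rewrite !mem_filter; apply/andP/andP => [[Ax xS]|[/andP[xS Ax] _]]; last by split.
    by rewrite xS; split=> //; exact: subS.
  rewrite eS size_map -(count_predC (mem S) [seq x <- cells n | A x]) !count_filter.
  rewrite size_filter addnC; congr (_ + _); apply: eq_count => x /=; exact: andbC.
have szR : size R + size (filter I (vertices n)) = size (vertices n).
  by rewrite !size_filter addnC; exact: count_predC.
pose P u := exists2 r, r \in R & edge_conn E u r.
have inR v : v \in vertices n -> ~~ I v -> P v.
  by move=> vV nI; exists v; [rewrite mem_filter nI | exact: rst_refl].
have Pinv u v : gedge n S ch u v -> (P u <-> P v).
  case=> x [sx xS e]; have xc : x \in cells n by rewrite mem_cells sx.
  have [uV vV] := ends_sum (ch x) sx; rewrite -e /= in uV vV.
  have [Iuv|] := boolP (I u || I v); last first.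
    by rewrite negb_or => /andP[nu nv]; split=> _; exact: inR.
  have cuv : edge_conn E u v.
    apply: rst_step; apply/mapP; exists x; rewrite // mem_filter xS xc !andbT.
    by apply: (inA (ch x)) => //; rewrite -e.
  split=> -[r rR cr]; exists r => //; last exact: rst_trans cuv cr.
  exact: rst_trans (rst_sym _ _ _ _ cuv) cr.
have le : size (vertices n) <= size R + size E.
  apply: conn_count (uniq_vertices n) _ => v vV.
  have [Iv|nI] := boolP (I v); last exact: inR.
  have [w wV [nw cvw]] := out v vV Iv.
  exact/(conn_iff Pinv cvw)/inR.
by lia.
Qed.

(** [g] matches vertices of [I] with triangles of [A]; [s] lists the triangles left over, and their
    number is the bound. *)
Lemma region_bound (I A : pred triple) (g : triple -> triple) (s : seq triple) :
  (forall v, v \in vertices n -> I v ->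
     exists2 w, w \in vertices n & ~~ I w /\ gconn n S ch v w) ->
  (forall m x, x \in cells n -> I (ends m x).1 || I (ends m x).2 -> A x) ->
  (forall x, x \in cells n -> A x ->
     x \in s \/ exists2 v, v \in vertices n & I v /\ g v = x) ->
  count A S <= size s.
Proof.
move=> out inA cover; have := region_count out inA => cnt.
suff le : size (filter A (cells n)) <= size (map g (filter I (vertices n)) ++ s).
  by rewrite size_cat size_map in le; lia.
apply: uniq_leq_size; first exact: filter_uniq (uniq_cells n).
move=> x; rewrite mem_filter mem_cat => /andP[Ax xc].
have [->|[v vV [Iv <-]]] := cover x xc Ax; first by rewrite orbT.
by rewrite map_f // mem_filter Iv.
Qed.

(** Every block meets the union of any two sides. *)
Lemma solution_sides v : v \in vertices n ->
  [/\ exists2 w, w \in vertices n & ((c1 w == 0) || (c2 w == 0)) /\ gconn n S ch v w,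
      exists2 w, w \in vertices n & ((c2 w == 0) || (c3 w == 0)) /\ gconn n S ch v w &
      exists2 w, w \in vertices n & ((c3 w == 0) || (c1 w == 0)) /\ gconn n S ch v w].
Proof.
move=> vV; have [r rR cvr] := solution_reps sol vV.
have rV := reps_vertices rR; move: rR rV; rewrite mem_cat mem_vertices.
case/orP=> /mapP[b]; rewrite mem_iota ?uphalf_half => rb er sr.
  have r0 : c1 r == 0 by rewrite er.
  split; try by exists r; [rewrite mem_vertices | split; rewrite // r0 ?orbT].
  have [le|lt] := leqP (2 * b) n.
    have [p1 _ _] := proj2 sol b le; exists (b, 0, n - b); first by rewrite mem_vertices /=; lia.
    by split=> //; apply: rst_trans cvr _; rewrite er /vertex_at subn0.
  have [|_ p2 _] := proj2 sol (n - b); first by lia.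
  exists (n - b, n - (n - b), 0); first by rewrite mem_vertices /=; lia.
  split; first by rewrite /= ?orbT.
  apply: rst_trans cvr _; rewrite (_ : r = (0, n - (n - b), n - b)) //.
  by rewrite er; apply: tripleP => //=; lia.
have r0 : c2 r == 0 by rewrite er.
split; try by exists r; [rewrite mem_vertices | split; rewrite // r0 ?orbT].
have [|_ _ p3] := proj2 sol (n - b); first by lia.
exists (n - (n - b), n - b, 0); first by rewrite mem_vertices /=; lia.
split; first by rewrite /= ?orbT.
apply: rst_trans cvr _; rewrite (_ : r = (n - (n - b), 0, n - b)) //.
by rewrite er; apply: tripleP => //=; lia.
Qed.

(** In the first X rows, the vertices off the left and right sides match all triangles except the
    right-most one of each row. *)
Lemma pre1_bound X : X <= n -> cpre S c1 X <= X.
Proof.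
move=> leX; pose I v := [&& c1 v < X, 0 < c2 v & 0 < c3 v].
pose s := [seq (a, n - a - 1, 0) | a <- iota 0 X].
have -> : X = size s by rewrite size_map size_iota.
apply: (@region_bound I _ (fun v => (c1 v, (c2 v).-1, c3 v)) s).
- by move=> v /solution_sides[_ [w wV [w0 cvw]] _] _; exists w => //; split=> //; rewrite /I; lia.
- by move=> m x _; rewrite size_map size_iota /I; case: m => [|[|[|m]]] /=; lia.
- move=> x; rewrite mem_cells size_map size_iota => sx ltX.
  have [e|ne] := eqVneq (c3 x) 0; [left | right].
    apply/mapP; exists (c1 x); rewrite ?mem_iota //; apply: tripleP => //=; lia.
  exists (c1 x, (c2 x).+1, c3 x); first by rewrite mem_vertices /=; lia.
  by split; [rewrite /I /=; lia | apply: tripleP].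
Qed.

Lemma pre2_bound X : X <= n -> cpre S c2 X <= X.
Proof.
move=> leX; pose I v := [&& c2 v < X, 0 < c3 v & 0 < c1 v].
pose s := [seq (0, a, n - a - 1) | a <- iota 0 X].
have -> : X = size s by rewrite size_map size_iota.
apply: (@region_bound I _ (fun v => (c1 v, c2 v, (c3 v).-1)) s).
- by move=> v /solution_sides[_ _ [w wV [w0 cvw]]] _; exists w => //; split=> //; rewrite /I; lia.
- by move=> m x _; rewrite size_map size_iota /I; case: m => [|[|[|m]]] /=; lia.
- move=> x; rewrite mem_cells size_map size_iota => sx ltX.
  have [e|ne] := eqVneq (c1 x) 0; [left | right].
    apply/mapP; exists (c2 x); rewrite ?mem_iota //; apply: tripleP => //=; lia.
  exists (c1 x, c2 x, (c3 x).+1); first by rewrite mem_vertices /=; lia.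
  by split; [rewrite /I /=; lia | apply: tripleP].
Qed.

Lemma pre3_bound X : X <= n -> cpre S c3 X <= X.
Proof.
move=> leX; pose I v := [&& c3 v < X, 0 < c1 v & 0 < c2 v].
pose s := [seq (n - a - 1, 0, a) | a <- iota 0 X].
have -> : X = size s by rewrite size_map size_iota.
apply: (@region_bound I _ (fun v => ((c1 v).-1, c2 v, c3 v)) s).
- by move=> v /solution_sides[[w wV [w0 cvw]] _ _] _; exists w => //; split=> //; rewrite /I; lia.
- by move=> m x _; rewrite size_map size_iota /I; case: m => [|[|[|m]]] /=; lia.
- move=> x; rewrite mem_cells size_map size_iota => sx ltX.
  have [e|ne] := eqVneq (c2 x) 0; [left | right].
    apply/mapP; exists (c3 x); rewrite ?mem_iota //; apply: tripleP => //=; lia.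
  exists ((c1 x).+1, c2 x, c3 x); first by rewrite mem_vertices /=; lia.
  by split; [rewrite /I /=; lia | apply: tripleP].
Qed.

(** The interior vertices of the triangle match all its cells above the bottom row, which has i of
    them. The pairwise inequalities say that the sides do not truncate it. *)
Lemma tri_bound X Y Z i : X + Y + Z = n + 1 + i -> X + Y <= n + 1 -> Y + Z <= n + 1 ->
  X + Z <= n + 1 -> ctri S c1 c2 c3 X Y Z <= i.
Proof.
move=> sum le12 le23 le13.
pose I v := [&& 0 < c1 v < X, 0 < c2 v < Y & 0 < c3 v < Z].
pose s := [seq (X.-1, b, n - X - b) | b <- iota (n + 1 - X - Z) i].
have -> : i = size s by rewrite size_map size_iota.
apply: (@region_bound I _ (fun v => ((c1 v).-1, c2 v, c3 v)) s).
- move=> v; rewrite mem_vertices => /eqP sv _; have [w bw cvw] := proj1 sol v sv.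
  by case/andP: bw => sw w0; exists w; rewrite ?mem_vertices //; split=> //; rewrite /I; lia.
- by move=> m x _; rewrite /I; case: m => [|[|[|m]]] /=; lia.
- move=> x; rewrite mem_cells => sx /and3P[lt1 lt2 lt3].
  have [e|ne] := eqVneq (c1 x).+1 X; [left | right].
    by apply/mapP; exists (c2 x); rewrite ?mem_iota; [lia | apply: tripleP => //=; lia].
  exists ((c1 x).+1, c2 x, c3 x); first by rewrite mem_vertices /=; lia.
  by split; [rewrite /I /=; lia | apply: tripleP].
Qed.

(** Reaching a representative bounds the number of edges from below, being a forest that separates
    the representatives bounds it from above. *)
Lemma solution_size :
  (forall u v, u \in reps n -> v \in reps n -> gconn n S ch u v -> u = v) ->
  forest (edges n S ch) -> size S = uphalf n.
Proof.
move=> dis fE; apply/eqP; rewrite eqn_leq; apply/andP; split.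
  by have := reach_count uS subS (solution_reps sol); rewrite size_reps leq_add2l.
have uR : uniq (reps n).
  have top_inj : injective (vertex_at n 0) by move=> a b /(congr1 c2).
  have left_inj : injective (fun d => (d, 0, n - d)) by move=> a b /(congr1 c1).
  rewrite cat_uniq (map_inj_uniq top_inj) (map_inj_uniq left_inj) !iota_uniq andbT /=.
  apply/hasPn => x /mapP[a]; rewrite mem_iota => ra ->.
  apply/negP; change ((a, 0, n - a) \in map (vertex_at n 0) (iota 0 n.+1) -> False).
  by case/mapP=> b _ /(congr1 c1) /=; lia.
have EV e : e \in edges n S ch -> e.1 \in vertices n /\ e.2 \in vertices n.
  case/mapP=> x; rewrite mem_filter mem_cells => /andP[_ /eqP sx] ->.
  exact: ends_sum.
have distinct u v : u \in reps n -> v \in reps n -> edge_conn (edges n S ch) u v -> u = v.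
  by move=> uK vK /gconn_edges; exact: dis.
have le : size (reps n) + size (edges n S ch) <= size (vertices n) :=
  forest_count (uniq_vertices n) uR (@reps_vertices n) EV fE distinct.
move: le; rewrite size_reps size_vertices -(size_edges ch uS subS).
set e := size (edges n S ch); set s := size S; move: e s; lia.
Qed.

End Necessity.

Import Order.TTheory GRing.Theory Num.Theory.

(** * Points of the plane *)

Definition to_point (v : triple) : point := ((c2 v)%:Z - (c3 v)%:Z, - (c1 v)%:Z)%R.

Lemma to_point_inj n : {in vertices n &, injective to_point}.
Proof.
move=> u v; rewrite !mem_vertices /to_point => /eqP su /eqP sv [e1 e2].
by apply: tripleP; lia.
Qed.

Lemma grove_vertexP n (p : point) :
  reflect (exists2 v, v \in vertices n & p = to_point v) (p \in grove_vertex n).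
Proof.
case: p => x y; rewrite inE /grove_vertex /=; apply: (iffP and3P) => [[h1 h2 /eqP h3]|[v]].
  exists (absz y, absz (((n%:Z + y + x) %/ 2)%Z), absz (((n%:Z + y - x) %/ 2)%Z)).
    by rewrite mem_vertices /=; lia.
  by rewrite /to_point /=; congr pair; lia.
by rewrite mem_vertices /to_point => /eqP sv [-> ->]; split; lia.
Qed.

(** Vertices are listed in the order of [boundary_block], so that equal blocks are equal lists. The
    representative comes first, hence is determined by its block. *)
Definition block_of n (r : triple) : seq triple :=
  if c1 r == 0 then
    if (c2 r == 0) || (c3 r == 0) then [:: r]
    else if c2 r < c3 r then [:: r; (c2 r, 0, c3 r)]
    else if c2 r == c3 r then [:: r; (c2 r, 0, c3 r); (c2 r, c3 r, 0)]
    else [:: r; (c3 r, c2 r, 0)]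
  else if c1 r == n then [:: r] else [:: r; (c1 r, c3 r, 0)].

Lemma boundary_blockP n B : 0 < n ->
  boundary_block n B <-> exists2 r, r \in reps n & B = map to_point (block_of n r).
Proof.
move=> n_gt0; split.
  have left0 b c : b + c = n -> (0, b, c) \in reps n.
    by move=> e; rewrite (_ : (0, b, c) = vertex_at n 0 b) ?reps_top //; [lia | apply: tripleP => //=; lia].
  have leftd a c : a + c = n -> n < 2 * a -> (a, 0, c) \in reps n.
    by move=> e lt; rewrite (_ : (a, 0, c) = (a, 0, n - a)) ?reps_left //; [lia | apply: tripleP => //=; lia].
  case=> [|||i ri ei|i ri ei|i ri1 ri2|en].
  - exists (0, 0, n); first by apply: left0; lia.
    by rewrite /block_of /= /to_point /=; congr [:: (_, _)]; lia.
  - exists (0, n, 0); first by apply: left0; lia.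
    by rewrite /block_of /= eqxx orbT /= /to_point /=; congr [:: (_, _)]; lia.
  - exists (n, 0, 0); first by apply: leftd; lia.
    by rewrite /block_of /= eqxx ifF; [rewrite /= /to_point /=; congr [:: (_, _)]; lia | lia].
  - exists (0, absz ((n%:Z - i) %/ 2)%Z, absz ((n%:Z + i) %/ 2)%Z); first by apply: left0; lia.
    rewrite /block_of /= ifF; last by lia.
    by rewrite ifT; [rewrite /= /to_point /=; congr [:: (_, _); (_, _)]; lia | lia].
  - exists (0, absz ((n%:Z + i) %/ 2)%Z, absz ((n%:Z - i) %/ 2)%Z); first by apply: left0; lia.
    rewrite /block_of /= ifF; last by lia.
    by rewrite ifF ?ifF; [rewrite /= /to_point /=; congr [:: (_, _); (_, _)]; lia | lia | lia].
  - exists (absz i, 0, absz (n%:Z - i)%R); first by apply: leftd; lia.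
    rewrite /block_of /= ifF; last by lia.
    by rewrite ifF; [rewrite /= /to_point /=; congr [:: (_, _); (_, _)]; lia | lia].
  - exists (0, n./2, n./2); first by apply: left0; lia.
    rewrite /block_of /= ifF; last by lia.
    rewrite ltnn eqxx /= /to_point /=; congr [:: (_, _); (_, _); (_, _)]; lia.
case=> r rR ->; have := reps_vertices rR; rewrite mem_vertices => /eqP sr.
move: rR; rewrite mem_cat => /orP[/mapP[b]|/mapP[d]]; rewrite mem_iota ?uphalf_half => rb er.
  have r1 : c1 r = 0 by rewrite er.
  rewrite /block_of r1 /=; case: ifP => [/orP[]/eqP r0|r23].
  - have -> : map to_point [:: r] = [:: (- n%:Z, 0)%R] by rewrite /= /to_point /=; congr [:: (_, _)]; lia.
    exact: WestCorner.
  - have -> : map to_point [:: r] = [:: (n%:Z, 0)%R] by rewrite /= /to_point /=; congr [:: (_, _)]; lia.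
    exact: EastCorner.
  case: ltnP => [lt|le].
    have -> : map to_point [:: r; (c2 r, 0, c3 r)] =
        [:: (- (n%:Z - 2 * (c2 r)%:Z), 0)%R;
            (((- n%:Z - (n%:Z - 2 * (c2 r)%:Z)) %/ 2)%Z,
             ((- n%:Z + (n%:Z - 2 * (c2 r)%:Z)) %/ 2)%Z)%R].
      by rewrite /= /to_point /=; congr [:: (_, _); (_, _)]; lia.
    by apply: WestPair; lia.
  case: eqVneq => [e|ne].
    have -> : map to_point [:: r; (c2 r, 0, c3 r); (c2 r, c3 r, 0)] =
        [:: (0, 0)%R; (- (n%:Z %/ 2)%Z, - (n%:Z %/ 2)%Z)%R; ((n%:Z %/ 2)%Z, - (n%:Z %/ 2)%Z)%R].
      by rewrite /= /to_point /=; congr [:: (_, _); (_, _); (_, _)]; lia.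
    by apply: MiddleTriplet; lia.
  have -> : map to_point [:: r; (c3 r, c2 r, 0)] =
      [:: (n%:Z - 2 * (c3 r)%:Z, 0)%R;
          (((n%:Z + (n%:Z - 2 * (c3 r)%:Z)) %/ 2)%Z,
           ((- n%:Z + (n%:Z - 2 * (c3 r)%:Z)) %/ 2)%Z)%R].
    by rewrite /= /to_point /=; congr [:: (_, _); (_, _)]; lia.
  by apply: EastPair; lia.
have r2 : c2 r = 0 by rewrite er.
have ed : c1 r = d by rewrite er.
rewrite /block_of ifF; last by lia.
case: eqVneq => [e|ne].
  have -> : map to_point [:: r] = [:: (0, - n%:Z)%R].
    by rewrite /= /to_point /=; congr [:: (_, _)]; lia.
  exact: SouthCorner.
have -> : map to_point [:: r; (c1 r, c3 r, 0)] =
    [:: (- n%:Z + (c1 r)%:Z, - (c1 r)%:Z)%R; (n%:Z - (c1 r)%:Z, - (c1 r)%:Z)%R].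
  by rewrite /= /to_point /=; congr [:: (_, _); (_, _)]; lia.
by apply: SouthPair; lia.
Qed.

Lemma block_of_head n r : exists s, block_of n r = r :: s.
Proof.
by rewrite /block_of; do ?[case: ifP => _]; eexists.
Qed.

Lemma block_of_boundary n r w : r \in reps n -> w \in block_of n r -> boundary n w.
Proof.
move=> rR; have := reps_vertices rR; rewrite mem_vertices => /eqP sr.
have : (c1 r == 0) || (c2 r == 0).
  by move: rR; rewrite mem_cat => /orP[] /mapP[b _ ->]; rewrite ?orbT.
rewrite /block_of /boundary; case: (c1 r =P 0) => [e1 _|ne1 /= /eqP e2].
  case: ifP => _; first by rewrite inE => /eqP->; lia.
  case: ifP => _; first by rewrite !inE => /orP[] /eqP-> /=; lia.
  case: ifP => _; first by rewrite !inE => /orP[|/orP[]] /eqP-> /=; lia.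
  by rewrite !inE => /orP[] /eqP-> /=; lia.
case: ifP => _; first by rewrite inE => /eqP->; lia.
by rewrite !inE => /orP[] /eqP-> /=; lia.
Qed.

Lemma block_of_conn n S ch r w : solution n S ch -> r \in reps n -> w \in block_of n r ->
  gconn n S ch r w.
Proof.
move=> sol rR; have := reps_vertices rR; rewrite mem_vertices => /eqP sr.
case: r rR sr => [[a b] c] rR /= sr.
have P d : 2 * d <= n -> [/\ gconn n S ch (0, d, n - d) (d, 0, n - d),
    gconn n S ch (0, n - d, d) (d, n - d, 0) & gconn n S ch (n - d, 0, d) (n - d, d, 0)] := proj2 sol d.
have : (a == 0) || (b == 0) && (n < 2 * a).
  move: rR; rewrite mem_cat => /orP[] /mapP[k]; rewrite mem_iota ?uphalf_half => rk [-> -> _] //.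
  by rewrite eqxx; lia.
rewrite /block_of /=; case: (a =P 0) => [a0 _|ne1 /= /andP[/eqP b0 lt]]; last first.
  subst b; case: ifP => _; first by rewrite inE => /eqP->; exact: rst_refl.
  rewrite !inE => /orP[] /eqP->; first exact: rst_refl.
  by have [|_ _] := P c; [lia | rewrite (_ : n - c = a); last lia].
subst a.
case: ifP => _; first by rewrite inE => /eqP->; exact: rst_refl.
have [lt|gt|e] := ltngtP b c.
- rewrite !inE => /orP[] /eqP->; first exact: rst_refl.
  by have [|+ _ _] := P b; [lia | rewrite (_ : n - b = c); last lia].
- rewrite !inE => /orP[] /eqP->; first exact: rst_refl.
  by have [|_ + _] := P c; [lia | rewrite (_ : n - c = b); last lia].
- rewrite !inE => /orP[|/orP[]] /eqP->; first exact: rst_refl.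
    by have [|+ _ _] := P b; [lia | rewrite (_ : n - b = c); last lia].
  by have [|_ + _] := P c; [lia | rewrite (_ : n - c = b) ?e; last lia].
Qed.

Lemma block_of_pattern n S ch :
  (forall r w, r \in reps n -> w \in block_of n r -> gconn n S ch r w) ->
  forall d, 2 * d <= n ->
    [/\ gconn n S ch (0, d, n - d) (d, 0, n - d),
        gconn n S ch (0, n - d, d) (d, n - d, 0) &
        gconn n S ch (n - d, 0, d) (n - d, d, 0)].
Proof.
move=> H d led; case: d led => [|d] led.
  by rewrite subn0; split; exact: rst_refl.
have R1 : (0, d.+1, n - d.+1) \in reps n.
  by have := @reps_top n d.+1; rewrite /vertex_at subn0; apply; lia.
have R2 : (0, n - d.+1, d.+1) \in reps n.
  by rewrite (_ : (0, n - d.+1, d.+1) = vertex_at n 0 (n - d.+1)) ?reps_top; [|lia|apply: tripleP => //=; lia].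
(* The middle triplet: the third connection follows from the other two. *)
have [e|ne] := eqVneq n (2 * d.+1).
  have en : n - d.+1 = d.+1 by lia.
  rewrite en in R1 *.
  have h1 : gconn n S ch (0, d.+1, d.+1) (d.+1, 0, d.+1).
    by apply: H => //; rewrite /block_of /= ltnn eqxx !inE eqxx orbT.
  have h2 : gconn n S ch (0, d.+1, d.+1) (d.+1, d.+1, 0).
    by apply: H => //; rewrite /block_of /= ltnn eqxx !inE eqxx !orbT.
  by split=> //; apply: rst_trans (rst_sym _ _ _ _ h1) h2.
have R3 : (n - d.+1, 0, d.+1) \in reps n.
  by have := @reps_left n (n - d.+1); rewrite (_ : n - (n - d.+1) = d.+1); [apply; lia | lia].
split; apply: H => //; rewrite /block_of /=.
- by rewrite ifF ?ifT ?inE ?eqxx ?orbT //; lia.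
- by rewrite ifF ?ifF ?inE ?eqxx ?orbT //; lia.
- by rewrite !ifF ?inE ?eqxx ?orbT //; lia.
Qed.

(** * From choices of edges to graphs on the plane and back *)

Definition realizes n S ch (G : rel point) := forall p q, G p q <->
  exists u v, [/\ p = to_point u, q = to_point v & gedge n S ch u v \/ gedge n S ch v u].

Lemma gedge_vertices n S ch u v : gedge n S ch u v -> u \in vertices n /\ v \in vertices n.
Proof. by case=> x [sx _ e]; have := ends_sum (ch x) sx; rewrite -e. Qed.

Lemma same_component_trans (G : rel point) p q r :
  same_component G p q -> same_component G q r -> same_component G p r.
Proof.
move=> [s sp ->] [t tp ->]; exists (s ++ t); last by rewrite last_cat.
by rewrite cat_path sp.
Qed.

Lemma same_component_sym (G : rel point) p q : symmetric G ->
  same_component G p q -> same_component G q p.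
Proof.
move=> symG [s sp ->]; exists (rev (belast p s)); last first.
  by case: s sp => //= a s _; rewrite rev_cons last_rcons.
by rewrite rev_path (eq_path (e' := G)) // => x y; rewrite symG.
Qed.

Definition avoiding (T : eqType) (G : rel T) (x y : T) : rel T := fun p q =>
  G p q && ~~ ((p == x) && (q == y) || (p == y) && (q == x)).

(** With a third vertex [z], the way back from [y] to [x] never uses the edge between them. *)
Lemma cycle_avoiding (T : eqType) (G : rel T) (x y z : T) (s : seq T) :
  ucycle G [:: x, y, z & s] -> path (avoiding G x y) y (rcons (z :: s) x).
Proof.
move=> /= /andP[/and3P[Gxy Gyz ps] /and3P[nx ny _]].
rewrite /= /avoiding Gyz eqxx /=.
have -> /= : (y == x) = false by apply: contraNF nx => /eqP->; rewrite mem_head.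
have -> /= : (z == x) = false by apply: contraNF nx => /eqP->; rewrite !inE eqxx orbT.
have {}nx : x \notin z :: s by apply: contra nx => h; rewrite inE h orbT.
elim: s z nx ny ps {Gyz} => [|t s IH] z; rewrite /= !inE !negb_or.
  by move=> /negbTE nx /negbTE ny; rewrite !(eq_sym z) nx ny => ->.
move=> /and3P[nx1 nx2 nx3] /and3P[ny1 ny2 ny3] /andP[Gzt ps].
rewrite Gzt /= !(eq_sym z) (negbTE nx1) (negbTE ny1) /=.
by apply: IH; rewrite ?inE ?negb_or ?nx2 ?ny2.
Qed.

Section Realizes.
Variables (n : nat) (S : seq triple) (ch : triple -> nat) (G : rel point).
Hypothesis GE : realizes n S ch G.

Lemma realizes_sym : symmetric G.
Proof.
move=> p q; apply/idP/idP => /GE[u [v [-> -> e]]]; apply/GE; exists v, u; split=> //; tauto.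
Qed.

Lemma gconn_component u v : gconn n S ch u v -> same_component G (to_point u) (to_point v).
Proof.
elim=> {u v} [u v e|u|u v _|u v w _ h _].
- by exists [:: to_point v] => //=; rewrite andbT; apply/GE; exists u, v; split=> //; left.
- by exists [::].
- exact: same_component_sym realizes_sym.
- exact: same_component_trans h.
Qed.

Lemma component_gconn u q : u \in vertices n -> same_component G (to_point u) q ->
  exists2 v, v \in vertices n & q = to_point v /\ gconn n S ch u v.
Proof.
move=> uV [s]; elim: s u uV => [|p s IH] u uV /=.
  by move=> _ ->; exists u => //; split=> //; exact: rst_refl.
case/andP=> /GE[u' [v [eu -> uv]]] ps eq.
have [u'V vV] : u' \in vertices n /\ v \in vertices n.
  by case: uv => /gedge_vertices[].
have {}eu : u = u' by apply: (to_point_inj uV u'V).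
have cuv : gconn n S ch u v.
  by rewrite eu; case: uv => h; [exact: rst_step | apply: rst_sym; exact: rst_step].
have [w wV [-> cvw]] := IH v vV ps eq.
by exists w => //; split=> //; exact: rst_trans cuv cvw.
Qed.

Lemma component_gconnP u v : u \in vertices n -> v \in vertices n ->
  same_component G (to_point u) (to_point v) <-> gconn n S ch u v.
Proof.
move=> uV vV; split; last exact: gconn_component.
by case/(component_gconn uV) => w wV [/(to_point_inj vV wV) <-].
Qed.

Lemma realizes_acyclic :
  (forall x, c1 x + c2 x + c3 x + 1 = n -> x \notin S ->
     ~ gconn n (x :: S) ch (ends (ch x) x).1 (ends (ch x) x).2) ->
  forall p, ucycle G p -> size p < 3.
Proof.
move=> nored [|x [|y [|z s]]] // cyc; have /andP[/andP[Gxy _] _] := cyc; rewrite /= in Gxy.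
have pa := cycle_avoiding cyc.
have [u [v [eu ev uv]]] := (GE x y).1 Gxy.
have [c [sc cS ec]] : exists c, [/\ c1 c + c2 c + c3 c + 1 = n, c \notin S &
    (u, v) = ends (ch c) c \/ (v, u) = ends (ch c) c].
  by case: uv => -[c [sc cS ec]]; exists c; split=> //; [left | right].
have [uV vV] : u \in vertices n /\ v \in vertices n.
  by case: uv => /gedge_vertices[].
suff : gconn n (c :: S) ch v u.
  move=> h; exfalso; apply: (nored c sc cS); case: ec => <- //=; exact: rst_sym.
have H t p : t \in vertices n -> path (avoiding G x y) (to_point t) p ->
    exists2 w, w \in vertices n & last (to_point t) p = to_point w /\ gconn n (c :: S) ch t w.
  elim: p t => [|q p IH] t tV /=; first by exists t => //; split=> //; exact: rst_refl.
  case/andP=> /andP[/GE[t' [w [et -> tw]]] ne] pp.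
  have [t'V wV] : t' \in vertices n /\ w \in vertices n.
    by case: tw => /gedge_vertices[].
  have {}et := to_point_inj tV t'V et; subst t'.
  have [w' w'V [-> cw]] := IH w wV pp.
  exists w' => //; split=> //; apply: rst_trans cw.
  have step a b : gedge n S ch a b -> (a, b) <> (u, v) -> (a, b) <> (v, u) ->
      gconn n (c :: S) ch a b.
    case=> d [sd dS ed] n1 n2; apply: rst_step; exists d; split=> //.
    rewrite inE negb_or dS andbT; apply/eqP => edc; rewrite edc in ed.
    by case: ec => ec; rewrite -ec in ed.
  have n1 : (t, w) <> (u, v) by case=> e1 e2; rewrite e1 e2 eu ev !eqxx in ne.
  have n2 : (t, w) <> (v, u) by case=> e1 e2; rewrite e1 e2 eu ev !eqxx orbT in ne.
  case: tw => h; first exact: step.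
  by apply: rst_sym; apply: step => // -[e1 e2]; [apply: n2 | apply: n1]; rewrite e1 e2.
rewrite {2}ev in pa; have [w wV [e cvw]] := H v _ vV pa.
by rewrite last_rcons eu in e; rewrite (to_point_inj uV wV e).
Qed.

End Realizes.

Definition side (m : nat) : nat := if m is 1 then 1 else if m is 2 then 2 else 3.

Lemma ends_side m x : ends (side m) x = ends m x.
Proof. by case: m => [|[|[|]]]. Qed.

(** An edge of the lattice belongs to a single downward triangle, so the graph determines the choice
    up to [side]. *)
Lemma ends_inj m k x y : ends m x = ends k y \/ ends m x = ((ends k y).2, (ends k y).1) ->
  x = y /\ side m = side k.
Proof.
case: x y => [[a b] c] [[a' b'] c'].
case: m k => [|[|[|m]]] [|[|[|k]]] /= [] [] *; split => //; try (exfalso; lia);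
  by congr (_, _, _); lia.
Qed.

Lemma conn_path (T : eqType) (E : seq (T * T)) u v : edge_conn E u v ->
  exists2 p, path (fun x y => ((x, y) \in E) || ((y, x) \in E)) u p & v = last u p.
Proof.
have symE : symmetric (fun x y => ((x, y) \in E) || ((y, x) \in E)).
  by move=> x y; rewrite orbC.
elim=> {u v} [u v uv|u|u v _ [p pp ->]|u v w _ [p pp ->] _ [q qq ->]].
- by exists [:: v]; rewrite //= uv.
- by exists [::].
- exists (rev (belast u p)); last by case: p pp => //= a p _; rewrite rev_cons last_rcons.
  by rewrite rev_path (eq_path (e' := fun x y => ((x, y) \in E) || ((y, x) \in E))).
- by exists (p ++ q); rewrite ?last_cat // cat_path pp.
Qed.

Section Realizes.
Variables (n : nat) (S : seq triple) (ch : triple -> nat) (G : rel point).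
Hypothesis GE : realizes n S ch G.

(** An edge whose ends are connected by later edges closes a simple path into a cycle. The path has
    at least two edges, since no lattice edge is listed twice. *)
Lemma acyclic_forest :
  (forall p, ucycle G p -> size p < 3) -> forest (edges n S ch).
Proof.
move=> acyc; rewrite /edges.
suff H s : uniq s -> {subset s <= [seq x <- cells n | x \notin S]} ->
    forest [seq ends (ch x) x | x <- s].
  by apply: H => //; exact: filter_uniq (uniq_cells n).
elim: s => [|x s IH] // /andP[nx us] sub; split; last first.
  by apply: IH => // y ys; apply: sub; rewrite inE ys orbT.
have cellP y : y \in x :: s -> c1 y + c2 y + c3 y + 1 = n /\ y \notin S.
  by move=> /sub; rewrite mem_filter mem_cells => /andP[yS /eqP].
have [sx xS] := cellP x (mem_head x s).
have [u1V u2V] := ends_sum (ch x) sx.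
case/conn_path=> p; case/shortenP=> q pq uq _ {p} eq.
have qV z : z \in q -> z \in vertices n.
  elim: q (ends (ch x) x).1 pq {uq eq} => //= a q IHq b /andP[ba /IHq h].
  rewrite inE => /orP[/eqP->|/h//]; case/orP: ba => /mapP[y ys e];
    have [sy _] := cellP y (mem_behead (s := x :: s) ys); have [] := ends_sum (ch y) sy; rewrite -e //.
suff /acyc : ucycle G (map to_point ((ends (ch x) x).1 :: q)).
  rewrite size_map; case: q pq uq eq {qV} => [|a [|b q]] //=.
    move=> _ _ e; have := congr1 c1 e; have := congr1 c2 e.
    by case: (ch x) => [|[|[|k]]] /=; lia.
  rewrite andbT => /orP[] /mapP[y ys e] _ ea _.
    have [|exy _] := @ends_inj (ch x) (ch y) x y; last by rewrite exy ys in nx.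
    by left; rewrite -e -ea; case: (ends _ x).
  have [|exy _] := @ends_inj (ch x) (ch y) x y; last by rewrite exy ys in nx.
  by right; rewrite -e /= -ea; case: (ends _ x).
apply/andP; split; last first.
  rewrite map_inj_in_uniq // => a b; rewrite !inE => aq bq.
  by apply: (@to_point_inj n); [case/orP: aq => [/eqP->|/qV] | case/orP: bq => [/eqP->|/qV]].
have Gstep a b y : y \in x :: s -> (a, b) = ends (ch y) y -> G (to_point a) (to_point b).
  move=> ys e; have [sy yS] := cellP y ys; apply/GE; exists a, b; split=> //.
  by left; exists y.
have symG := realizes_sym GE.
rewrite /= rcons_path; apply/andP; split; last first.
  rewrite last_map -eq symG; apply: (Gstep _ _ x (mem_head _ _)); by case: (ends _ x).
elim: q (ends (ch x) x).1 pq {uq eq qV} => //= a q IHq b /andP[ba /IHq ->]; rewrite andbT.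
case/orP: ba => /mapP[y ys e]; first exact: (Gstep _ _ y (mem_behead (s := x :: s) ys)).
by rewrite symG; exact: (Gstep _ _ y (mem_behead (s := x :: s) ys)).
Qed.

Lemma realizes_ends m x : c1 x + c2 x + c3 x + 1 = n ->
  G (to_point (ends m x).1) (to_point (ends m x).2) = (x \notin S) && (side (ch x) == side m).
Proof.
move=> sx; have [e1V e2V] := ends_sum m sx.
apply/idP/andP => [/GE[u [v [eu ev uv]]]|[xS /eqP e]]; last first.
  apply/GE; exists (ends m x).1, (ends m x).2; split=> //; left; exists x; split=> //.
  by rewrite -(ends_side (ch x)) e ends_side; case: (ends _ x).
have [uV vV] : u \in vertices n /\ v \in vertices n.
  by case: uv => /gedge_vertices[].
have {}eu := to_point_inj e1V uV eu; have {}ev := to_point_inj e2V vV ev.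
have [y [yS ey]] : exists y, y \notin S /\ (ends m x = ends (ch y) y \/
    ends m x = ((ends (ch y) y).2, (ends (ch y) y).1)).
  by case: uv => -[y [sy yS ey]]; exists y; split=> //; [left | right]; rewrite -ey -eu -ev;
    case: (ends m x).
by have [-> ->] := ends_inj ey.
Qed.

End Realizes.

(** * Positions of a configuration as triples *)

Definition cell_of n (t : tri n) : triple :=
  ((tri_row t).-1, (tri_lcol t).-1, n.+1 - tri_row t - tri_lcol t).

Lemma tri_bounds n (t : tri n) :
  [/\ 0 < tri_row t, 0 < tri_lcol t & tri_row t + tri_lcol t <= n.+1].
Proof. by apply/and3P; exact: (valP t). Qed.

Lemma cell_of_sum n (t : tri n) : c1 (cell_of t) + c2 (cell_of t) + c3 (cell_of t) + 1 = n.
Proof. by have [? ? ?] := tri_bounds t; rewrite /cell_of /=; lia. Qed.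

Lemma cell_of_inj n : injective (@cell_of n).
Proof.
move=> t u e; have [? ? ?] := tri_bounds t; have [? ? ?] := tri_bounds u.
have e1 := congr1 c1 e; have e2 := congr1 c2 e; rewrite /cell_of /= in e1 e2.
have er : tri_row t = tri_row u by lia.
have el : tri_lcol t = tri_lcol u by lia.
apply/val_inj; rewrite [LHS]surjective_pairing [RHS]surjective_pairing.
by congr pair; apply/val_inj.
Qed.

Lemma cell_of_surj n x : c1 x + c2 x + c3 x + 1 = n -> exists t : tri n, cell_of t = x.
Proof.
move=> sx; have ltr : (c1 x).+1 < n.+1 by lia.
have ltl : (c2 x).+1 < n.+1 by lia.
have inT : in_tri n (val (Ordinal ltr, Ordinal ltl).1, val (Ordinal ltr, Ordinal ltl).2).
  by rewrite /in_tri /=; lia.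
exists (exist _ (Ordinal ltr, Ordinal ltl) inT); apply: tripleP => //=.
by rewrite /tri_row /tri_lcol /=; lia.
Qed.

Definition corner_edges (G : rel point) (x : triple) : nat :=
  G (to_point (ends 2 x).1) (to_point (ends 2 x).2) +
  G (to_point (ends 3 x).1) (to_point (ends 3 x).2) +
  G (to_point (ends 1 x).2) (to_point (ends 1 x).1).

Lemma triangle_edgesE n (G : rel point) (t : tri n) :
  triangle_edges G t = corner_edges G (cell_of t).
Proof.
have [? ? ?] := tri_bounds t; have st := cell_of_sum t; rewrite /triangle_edges /corner_edges /=.
have e1 : bottom_vertex t = to_point ((c1 (cell_of t)).+1, c2 (cell_of t), c3 (cell_of t)).
  by rewrite /bottom_vertex /to_point /cell_of /=; congr pair; lia.
have e3 : ((bottom_vertex t).1 - 1, (bottom_vertex t).2 + 1)%R =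
    to_point (c1 (cell_of t), c2 (cell_of t), (c3 (cell_of t)).+1).
  by rewrite e1 /to_point /=; congr pair; lia.
have e2 : ((bottom_vertex t).1 + 1, (bottom_vertex t).2 + 1)%R =
    to_point (c1 (cell_of t), (c2 (cell_of t)).+1, c3 (cell_of t)).
  by rewrite e1 /to_point /=; congr pair; lia.
by rewrite e2 e3 e1.
Qed.

Lemma realizes_edges n S ch (G : rel point) x : realizes n S ch G ->
  c1 x + c2 x + c3 x + 1 = n -> corner_edges G x = (x \notin S).
Proof.
move=> GE sx; rewrite /corner_edges (realizes_sym GE (to_point (ends 1 x).2)).
rewrite !(realizes_ends GE) //; case: (x \notin S) => //=.
by case: (ch x) => [|[|[|]]].
Qed.

Lemma adjacent_ends n u v : u \in vertices n -> v \in vertices n ->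
  adjacent (to_point u) (to_point v) ->
  exists m x, c1 x + c2 x + c3 x + 1 = n /\ ((u, v) = ends m x \/ (v, u) = ends m x).
Proof.
rewrite !mem_vertices => /eqP su /eqP sv; rewrite /adjacent !inE /to_point !xpair_eqE /=.
case: u v su sv => [[a b] c] [[a' b'] c'] /= su sv.
have tri x y z x' y' z' : x = x' -> y = y' -> z = z' -> (x, y, z) = (x', y', z') :> triple.
  by move=> -> -> ->.
case/or4P=> [e|e|e|/or3P[e|e|e]].
- by exists 1, (a, b, c.-1); split=> /=; [lia | right; congr pair; apply: tri; lia].
- by exists 1, (a, b.-1, c); split=> /=; [lia | left; congr pair; apply: tri; lia].
- by exists 3, (a.-1, b, c); split=> /=; [lia | left; congr pair; apply: tri; lia].
- by exists 3, (a, b.-1, c); split=> /=; [lia | right; congr pair; apply: tri; lia].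
- by exists 2, (a, b, c.-1); split=> /=; [lia | right; congr pair; apply: tri; lia].
- by exists 2, (a.-1, b, c); split=> /=; [lia | left; congr pair; apply: tri; lia].
Qed.

(* Selects the only edge of a triangle that has at most one. *)
Definition edge_choice (G : rel point) (x : triple) : nat :=
  if G (to_point (ends 1 x).1) (to_point (ends 1 x).2) then 1
  else if G (to_point (ends 2 x).1) (to_point (ends 2 x).2) then 2 else 3.

Lemma grove_realizes n S (G : rel point) : simplified_grove n G ->
  (forall x, c1 x + c2 x + c3 x + 1 = n -> corner_edges G x = (x \notin S)) ->
  realizes n S (edge_choice G) G.
Proof.
move=> grove cor; have symG := grove_sym grove.
have choice m x : c1 x + c2 x + c3 x + 1 = n ->
    G (to_point (ends m x).1) (to_point (ends m x).2) = (x \notin S) && (side (edge_choice G x) == side m).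
  move=> sx; have := cor x sx; rewrite /corner_edges /edge_choice (symG (to_point (ends 1 x).2)).
  rewrite -(ends_side m); move: (x \notin S) => b.
  have : [|| side m == 1, side m == 2 | side m == 3] by case: m => [|[|[|]]].
  case/or3P=> /eqP->; do 3!case: (G _ _) => //=; by case: b.
have edge u v : gedge n S (edge_choice G) u v -> G (to_point u) (to_point v).
  case=> x [sx xS e]; have := choice (edge_choice G x) x sx.
  by rewrite -e xS eqxx.
move=> p q; split=> [Gpq|[u [v [-> -> [/edge//|/edge]]]]]; last by rewrite symG.
have /and3P[/grove_vertexP[u uV eu] /grove_vertexP[v vV ev] adj] := grove_edge grove Gpq.
rewrite eu ev in adj Gpq; exists u, v; split=> //.
have [m [x [sx e]]] := adjacent_ends uV vV adj.
have /andP[xS /eqP em] : (x \notin S) && (side (edge_choice G x) == side m).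
  by rewrite -choice //; case: e => <- //=; rewrite symG.
have exG : ends (edge_choice G x) x = ends m x by rewrite -ends_side em ends_side.
by case: e => e; [left | right]; exists x; split; rewrite ?exG.
Qed.

Lemma upward_triangleP n r s i : 0 < i ->
  all (in_tri n) (upward_triangle r s i) = [&& 0 < r, i <= s & r + s + i <= n.+2].
Proof.
move=> i_gt0; apply/allP/and3P => [H|[r_gt0 les le] t].
  have inU p q : q <= p -> p < i -> (r + p, s - q) \in upward_triangle r s i.
    by move=> leq ltp; apply/allpairsPdep; exists p, q; rewrite !mem_iota; split=> //; lia.
  have lti : i.-1 < i by lia.
  have := H _ (inU 0 0 (leqnn _) i_gt0); have := H _ (inU i.-1 i.-1 (leqnn _) lti).
  have := H _ (inU i.-1 0 (leq0n _) lti).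
  by rewrite /in_tri /= => *; split; lia.
by case/allpairsPdep=> p [q []]; rewrite !mem_iota /in_tri => rp rq -> /=; lia.
Qed.

Lemma mem_upward_triangle n r s i (t : tri n) : 0 < i -> 0 < r -> i <= s ->
  ((tri_row t, tri_lcol t) \in upward_triangle r s i) =
  [&& c1 (cell_of t) < r + i - 1, c2 (cell_of t) < s & c3 (cell_of t) < n.+2 - r - s].
Proof.
move=> i_gt0 r_gt0 les; have [? ? ?] := tri_bounds t; rewrite /cell_of /=.
apply/allpairsPdep/and3P => [[p [q []]]|[? ? ?]].
  by rewrite !mem_iota => rp rq [er el]; split; lia.
exists (tri_row t - r), (s - tri_lcol t); rewrite !mem_iota; split; try lia.
by congr pair; lia.
Qed.

Section Ones.
Variables (n : nat) (c : configuration n).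

Definition one_cells : seq triple := [seq cell_of t | t <- enum {: tri n} & c t == 1%R].

Lemma mem_one_cells t : (cell_of t \in one_cells) = (c t == 1%R).
Proof. by rewrite (mem_map (@cell_of_inj n)) mem_filter mem_enum andbT. Qed.

Lemma one_cells_uniq : uniq one_cells.
Proof. by rewrite (map_inj_uniq (@cell_of_inj n)) filter_uniq ?enum_uniq. Qed.

Lemma one_cells_sum x : x \in one_cells -> c1 x + c2 x + c3 x + 1 = n.
Proof. by case/mapP=> t _ ->; exact: cell_of_sum. Qed.

Lemma ones_inE (A : pred (tri n)) (P : pred triple) :
  (forall t, A t = P (cell_of t)) -> ones_in c A = count P one_cells.
Proof.
move=> AP; rewrite /ones_in cardE /enum_mem size_filter /one_cells count_map count_filter.
by rewrite /enum_mem filter_predT; apply: eq_count => t /=; rewrite inE AP.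
Qed.

Lemma sum_ones : zero_one c -> (\sum_(t : tri n) c t = (size one_cells)%:Z)%R.
Proof.
move=> c01; rewrite /one_cells size_map size_filter -sum1_count.
rewrite (big_morph Posz PoszD (erefl : Posz 0 = 0%R)) big_enum_cond [RHS]big_mkcond /=.
by apply: eq_bigr => t _; case: (c01 t) => ->.
Qed.

End Ones.

Lemma uphalf_div n : n.+1 %/ 2 = uphalf n.
Proof. by rewrite divn2. Qed.

Lemma grove_solution n S (G : rel point) : 0 < n -> simplified_grove n G ->
  realizes n S (edge_choice G) G ->
  solution n S (edge_choice G) /\
  (forall u v, u \in reps n -> v \in reps n -> gconn n S (edge_choice G) u v -> u = v).
Proof.
move=> n_gt0 grove GE; set ch := edge_choice G in GE *.
have repV := @reps_vertices n.
have blockV r w : r \in reps n -> w \in block_of n r -> w \in vertices n.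
  by move=> rR /(block_of_boundary rR) /andP[sw _]; rewrite mem_vertices.
have head r : r \in block_of n r by have [s ->] := block_of_head n r; exact: mem_head.
have sol : solution n S ch.
  split=> [v /eqP sv|]; last first.
    apply: block_of_pattern => r w rR wr.
    have bB : boundary_block n (map to_point (block_of n r)) by apply/boundary_blockP => //; exists r.
    have [p /grove_vertexP[v vV ->] inB] := grove_block grove bB.
    have cvr := (component_gconnP GE vV (repV _ rR)).1 (inB _ (map_f to_point (head r))).
    have cvw := (component_gconnP GE vV (blockV _ _ rR wr)).1 (inB _ (map_f to_point wr)).
    exact: rst_trans (rst_sym _ _ _ _ cvr) cvw.
  rewrite -mem_vertices in sv.
  have pV : to_point v \in grove_vertex n by apply/grove_vertexP; exists v.
  have [B [[bB inB] _]] := grove_component grove pV.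
  move: bB inB => /(boundary_blockP _ n_gt0)[r rR ->] inB.
  exists r; first exact: block_of_boundary rR (head r).
  exact/(component_gconnP GE sv (repV _ rR))/inB/map_f/head.
split=> // u v uR vR cuv.
have pV : to_point u \in grove_vertex n by apply/grove_vertexP; exists u; rewrite ?repV.
have [B [_ uniqB]] := grove_component grove pV.
have inB r : r \in reps n -> gconn n S ch u r -> B = map to_point (block_of n r).
  move=> rR cur; apply: uniqB; split; first by apply/boundary_blockP => //; exists r.
  move=> _ /mapP[w wr ->]; apply: (gconn_component GE).
  exact: rst_trans cur (block_of_conn sol rR wr).
have eB := inB v vR cuv; rewrite (inB u uR (rst_refl _ _ _)) in eB.
have [s es] := block_of_head n u; have [s' es'] := block_of_head n v.
rewrite es es' in eB; case: eB => e1 e2 _.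
by apply: (to_point_inj (repV _ uR) (repV _ vR)); rewrite /to_point e1 e2.
Qed.

Lemma solution_grove n S ch : 0 < n -> balanced n S -> solution n S ch ->
  exists2 G : rel point, simplified_grove n G & realizes n S ch G.
Proof.
move=> n_gt0 bal sol; have repV := @reps_vertices n.
pose G : rel point := fun p q => has (fun e => (p == to_point e.1) && (q == to_point e.2) ||
  (p == to_point e.2) && (q == to_point e.1)) (edges n S ch).
have edgeP u v : (u, v) \in edges n S ch <-> gedge n S ch u v.
  split=> [/mapP[x]|[x [sx xS e]]].
    by rewrite mem_filter mem_cells => /andP[xS /eqP sx] e; exists x.
  by apply/mapP; exists x => //; rewrite mem_filter xS mem_cells sx eqxx.
have GE : realizes n S ch G.
  move=> p q; split=> [/hasP[[u v] /edgeP uv] /= /orP[]/andP[/eqP-> /eqP->]|[u [v [-> -> [] /edgeP uv]]]].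
  - by exists u, v; split=> //; left.
  - by exists v, u; split=> //; right.
  - by apply/hasP; exists (u, v); rewrite //= !eqxx.
  - by apply/hasP; exists (v, u); rewrite //= !eqxx orbT.
exists G => //; split.
- exact: realizes_sym GE.
- move=> p q /GE[u [v [-> -> uv]]].
  have [uV vV] : u \in vertices n /\ v \in vertices n by case: uv => /gedge_vertices[].
  apply/and3P; split; try by apply/grove_vertexP; eexists; last reflexivity.
  have adj x : adjacent (to_point (ends (ch x) x).1) (to_point (ends (ch x) x).2) /\
      adjacent (to_point (ends (ch x) x).2) (to_point (ends (ch x) x).1).
    by rewrite /adjacent !inE /to_point !xpair_eqE; case: (ch x) => [|[|[|m]]] /=; split; lia.
  by case: uv => -[x [_ _ e]]; have [] := adj x; rewrite -e.
- apply: (realizes_acyclic GE) => x sx xS; exact: (no_redundant_edge bal sol).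
- move=> p /grove_vertexP[v vV ->]; have [r rR cvr] := solution_reps sol vV.
  have inB w : w \in block_of n r -> gconn n S ch v w.
    by move=> wr; exact: rst_trans cvr (block_of_conn sol rR wr).
  exists (map to_point (block_of n r)); split.
    split; first by apply/boundary_blockP => //; exists r.
    by move=> _ /mapP[w wr ->]; apply/(gconn_component GE)/inB.
  move=> B [/(boundary_blockP _ n_gt0)[r' rR' ->] inB'].
  suff -> : r = r' by [].
  have [s es] := block_of_head n r'.
  have cvr' : gconn n S ch v r'.
    by apply/(component_gconnP GE vV (repV _ rR'))/inB'/map_f; rewrite es mem_head.
  by apply: (reps_distinct bal sol rR rR'); exact: rst_trans (rst_sym _ _ _ _ cvr) cvr'.
- move=> B /(boundary_blockP _ n_gt0)[r rR ->]; exists (to_point r).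
    by apply/grove_vertexP; exists r; rewrite ?repV.
  by move=> _ /mapP[w wr ->]; apply/(gconn_component GE)/(block_of_conn sol rR wr).
Qed.

Lemma balanced_of_bounds n S : uniq S ->
  (forall x, x \in S -> c1 x + c2 x + c3 x + 1 = n) -> size S = uphalf n ->
  (forall i, 0 < i <= n -> cpre S c1 i <= i) ->
  (forall i, 0 < i <= n -> cpre S c2 i <= i) ->
  (forall i, 0 < i <= n -> cpre S c3 i <= i) ->
  (forall i r s, 0 < i <= n -> 0 < r -> i <= s -> r + s + i <= n.+2 ->
     ctri S c1 c2 c3 (r + i - 1) s (n.+2 - r - s) <= i) ->
  balanced n S.
Proof.
move=> uS sumS sz h1 h2 h3 ht; split=> //.
have pre (p : triple -> nat) : (forall i, 0 < i <= n -> cpre S p i <= i) ->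
    forall m, cpre S p m <= m.
  move=> h m; have [le|lt] := leqP m n.
    case: m le => [|m] le; last by apply: h; lia.
    by rewrite leqn0 /cpre (eq_count (a2 := pred0)) ?count_pred0.
  by apply: leq_trans (count_size _ _) _; rewrite sz uphalf_half; lia.
have p1 := pre c1 h1; have p2 := pre c2 h2; have p3 := pre c3 h3.
split=> // X Y Z le.
have le1 : ctri S c1 c2 c3 X Y Z <= cpre S c1 X by apply: sub_count => x /and3P[].
have le2 : ctri S c1 c2 c3 X Y Z <= cpre S c2 Y by apply: sub_count => x /and3P[].
have le3 : ctri S c1 c2 c3 X Y Z <= cpre S c3 Z by apply: sub_count => x /and3P[].
have := p1 X; have := p2 Y; have := p3 Z => b3 b2 b1.
(* If two of the bounds, say X and Y, exceed n together, the bound Z on lines is already at most X +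
   Y + Z - n - 1. *)
have [/and3P[l12 l23 l13]|big] := boolP [&& X + Y <= n, Y + Z <= n & X + Z <= n]; last by lia.
have [e|ne] := eqVneq (X + Y + Z) (n + 1).
  suff : ctri S c1 c2 c3 X Y Z = 0 by lia.
  apply/eqP; rewrite -leqn0 leqNgt -has_count; apply/negP => /hasP[x /sumS sx /and3P[]].
  lia.
(* The upward triangle of this size i whose last row is X, rows being numbered from 1; its first row
   is thus X - i + 1. *)
have := ht (X + Y + Z - n - 1) (X - (X + Y + Z - n - 1) + 1) Y.
rewrite (_ : _ + _ - 1 = X); last by lia.
rewrite (_ : n.+2 - _ - Y = Z); last by lia.
lia.
Qed.

Local Open Scope ring_scope.

Theorem theorem1 (n : nat) (hn : (1 <= n)%N) (c : configuration n) :
  permutation_triangle c <->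
  [/\ zero_one c,
      \sum_(t : tri n) c t = (n.+1 %/ 2)%N%:Z &
  [/\
      forall i : nat, (1 <= i <= n)%N ->
        (ones_in c (fun t => tri_row t <= i)%N <= i)%N,
      forall i : nat, (1 <= i <= n)%N ->
        (ones_in c (fun t => tri_lcol t <= i)%N <= i)%N,
      forall i : nat, (1 <= i <= n)%N ->
        (ones_in c (fun t => tri_rcol t <= i)%N <= i)%N &
      forall i r s : nat, (1 <= i <= n)%N ->
        all (in_tri n) (upward_triangle r s i) ->
        (ones_in c (fun t => (tri_row t, tri_lcol t) \in
                               upward_triangle r s i) <= i)%N]].
Proof.
have row i (t : tri n) : (tri_row t <= i)%N = (c1 (cell_of t) < i)%N.
  by have [? ? ?] := tri_bounds t; rewrite /cell_of /=; lia.
have lcol i (t : tri n) : (tri_lcol t <= i)%N = (c2 (cell_of t) < i)%N.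
  by have [? ? ?] := tri_bounds t; rewrite /cell_of /=; lia.
have rcol i (t : tri n) : (tri_rcol t <= i)%N = (c3 (cell_of t) < i)%N.
  by have [? ? ?] := tri_bounds t; rewrite /tri_rcol /cell_of /=; lia.
have rowE i : ones_in c (fun t => tri_row t <= i)%N = cpre (one_cells c) c1 i.
  exact: (ones_inE c (P := fun x => c1 x < i)%N (row i)).
have lcolE i : ones_in c (fun t => tri_lcol t <= i)%N = cpre (one_cells c) c2 i.
  exact: (ones_inE c (P := fun x => c2 x < i)%N (lcol i)).
have rcolE i : ones_in c (fun t => tri_rcol t <= i)%N = cpre (one_cells c) c3 i.
  exact: (ones_inE c (P := fun x => c3 x < i)%N (rcol i)).
have upE i r s : (0 < i)%N -> (0 < r)%N -> (i <= s)%N ->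
    ones_in c (fun t => (tri_row t, tri_lcol t) \in upward_triangle r s i) =
    ctri (one_cells c) c1 c2 c3 (r + i - 1) s (n.+2 - r - s).
  by move=> i0 r0 les; apply: ones_inE => t; exact: mem_upward_triangle.
have uS := one_cells_uniq c; have sumS := @one_cells_sum n c.
have subS : {subset one_cells c <= cells n}.
  by move=> x /sumS sx; rewrite mem_cells sx.
split=> [[[G grove cE] c01]|[c01 sumc [h1 h2 h3 ht]]].
  have GE : realizes n (one_cells c) (edge_choice G) G.
    apply: grove_realizes grove _ => x sx; have [t <-] := cell_of_surj sx.
    rewrite -triangle_edgesE mem_one_cells; have := cE t.
    by case: (c01 t) => -> /=; lia.
  have [sol dis] := grove_solution hn grove GE.
  have sz := solution_size uS subS sol dis (acyclic_forest GE (grove_acyclic grove)).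
  split=> //; first by rewrite (sum_ones c01) sz uphalf_div.
  split=> [i ri|i ri|i ri|i r s ri].
  - by rewrite rowE; apply: (pre1_bound uS subS sol); lia.
  - by rewrite lcolE; apply: (pre2_bound uS subS sol); lia.
  - by rewrite rcolE; apply: (pre3_bound uS subS sol); lia.
  - rewrite upward_triangleP; last by lia.
    by case/and3P=> r0 les le; rewrite upE //; [apply: (tri_bound uS subS sol); lia | lia].
have bal : balanced n (one_cells c).
  apply: balanced_of_bounds => // [|i ri|i ri|i ri|i r s ri r0 les le].
  - by move: sumc; rewrite (sum_ones c01) uphalf_div => -[].
  - by rewrite -rowE; apply: h1.
  - by rewrite -lcolE; apply: h2.
  - by rewrite -rcolE; apply: h3.
  - rewrite -upE //; [apply: ht => //; rewrite upward_triangleP ?r0 ?les //; lia | lia].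
have [ch sol] := balanced_solvable bal.
have [G grove GE] := solution_grove hn bal sol.
split=> //; exists G => // t.
rewrite triangle_edgesE (realizes_edges GE (cell_of_sum t)) mem_one_cells.
by case: (c01 t) => ->.
Qed.
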